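(* Let $n,m$ be positive integers and $M=\mathrm{lcm}(n,m)$. Let $p,\bar p,\tilde p$ be primes, with $p$ coprime to $M$, such that $\bar p\equiv p \pmod M$ and $\tilde p\equiv p^{-1}\pmod M$ (where $p^{-1}$ is an inverse of $p$ modulo $M$), and suppose none of $p,\bar p,\tilde p$ divides $nm$. Then $$a(\mathcal{F}_{n,m}^{(p)})=a(\mathcal{F}_{n,m}^{(\bar p)})=a(\mathcal{F}_{n,m}^{(\tilde p)}).$$
   Context: For positive integers $n,m$ and a prime $\ell$ not dividing $nm$, $\mathcal{F}_{n,m}^{(\ell)}$ denotes the function field $K(U,V)$ with $U^n+V^m+1=0$, where $K$ is an algebraically closed field of characteristic $\ell$. Cartier operator: let $F/K$ be a function field over a perfect field $K$ of characteristic $\ell>0$ and let $t$ be a separating element. Every differential $\omega$ of $F/K$ can be written uniquely as $\omega=(x_0^\ell+x_1^\ell t+\cdots+x_{\ell-1}^\ell t^{\ell-1})\,dt$ with $x_i\in F$, and $\mathcal{C}(\omega):=x_{\ell-1}\,dt$; this does not depend on $t$, and $\mathcal{C}$ maps holomorphic differentials to holomorphic differentials. The $a$-number $a(F)$ is the $K$-dimension of the kernel of $\mathcal{C}$ acting on the holomorphic differentials of $F$. *)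

(* Defs.v *)
From HB Require Import structures.
From mathcomp Require Import all_boot all_order all_algebra.
From mathcomp Require Import generic_quotient ring_quotient separable freeg.
From mathcomp Require Import boolp classical_sets.

Set Implicit Arguments.
Unset Strict Implicit.
Unset Printing Implicit Defensive.

Import Order.TTheory GRing.Theory Num.Theory.

Local Open Scope ring_scope.
Local Open Scope quotient_scope.

(* A field extension F/K is given throughout by its structure morphism
   iota : {rmorphism K -> F}. *)

(* Kaehler differentials: the free F-module on the symbols <<x>>, x in F,
   modulo the F-submodule generated by the relations of a K-derivation. *)
Section KahlerDifferentials.

Context {K F : fieldType} (iota : {rmorphism K -> F}).

Inductive kahler_null : {freeg F / F} -> Prop :=
| KahlerAdd x y : kahler_null (<< x + y >> - << x >> - << y >>)
| KahlerLeibniz x y : kahler_null (<< x * y >> - x *: << y >> - y *: << x >>)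
| KahlerConst c : kahler_null << iota c >>
| KahlerNull0 : kahler_null 0
| KahlerNullD u v : kahler_null u -> kahler_null v -> kahler_null (u + v)
| KahlerNullZ a u : kahler_null u -> kahler_null (a *: u).

Definition kahler_nullb : pred {freeg F / F} := fun u => `[< kahler_null u >].

Lemma kahler_nullb_closed : zmod_closed kahler_nullb.
Proof.
split=> [|u v]; rewrite !unfold_in; first exact/asboolP/KahlerNull0.
move=> /asboolP nu /asboolP nv; apply/asboolP; rewrite -scaleN1r.
by apply: KahlerNullD => //; apply: KahlerNullZ.
Qed.

HB.instance Definition _ :=
  GRing.isZmodClosed.Build {freeg F / F} kahler_nullb kahler_nullb_closed.

Definition kahler_submod : zmodClosed {freeg F / F} :=
  GRing.ZmodClosed.clone _ kahler_nullb _.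

Definition differential : Type := {ideal_quot kahler_submod}.

HB.instance Definition _ := GRing.Zmodule.on differential.
HB.instance Definition _ := Quotient.on differential.

Local Notation cl := \pi_differential.

Definition scale_differential (a : F) (w : differential) : differential :=
  cl (a *: repr w).

Lemma kahler_class_is_zmod_morphism : zmod_morphism cl.
Proof. exact: (@pi_is_zmod_morphism _ _ _ {ideal_quot kahler_submod}). Qed.

HB.instance Definition _ :=
  GRing.isZmodMorphism.Build {freeg F / F} differential cl
    kahler_class_is_zmod_morphism.

Lemma kahler_class_eqP u v : cl u = cl v <-> kahler_null (u - v).
Proof.
have E := Quotient.idealrBE kahler_submod u v.
split=> uv; first by apply/asboolP/(etrans E); apply/eqP.
by apply/eqP/(etrans (esym E))/asboolP.
Qed.

Lemma kahler_classZ a u : cl (a *: u) = scale_differential a (cl u).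
Proof.
rewrite /scale_differential; apply/kahler_class_eqP.
rewrite -scalerBr; apply: KahlerNullZ; apply/kahler_class_eqP.
by rewrite reprK.
Qed.

Lemma scale_differentialA a b w :
  scale_differential a (scale_differential b w) = scale_differential (a * b) w.
Proof.
rewrite -[w]reprK -(kahler_classZ b) -(kahler_classZ a).
by rewrite -(kahler_classZ (a * b)) scalerA.
Qed.

Lemma scale_differential1 : left_id 1 scale_differential.
Proof. by move=> w; rewrite -[w]reprK -kahler_classZ scale1r. Qed.

Lemma scale_differentialDr : right_distributive scale_differential +%R.
Proof.
move=> a v w; rewrite -[v]reprK -[w]reprK -raddfD -!(kahler_classZ a).
by rewrite -raddfD scalerDr.
Qed.

Lemma scale_differentialDl w :
  {morph scale_differential^~ w : a b / a + b}.
Proof.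
move=> a b; rewrite -[w]reprK -(kahler_classZ a) -(kahler_classZ b).
by rewrite -(kahler_classZ (a + b)) -raddfD scalerDl.
Qed.

HB.instance Definition _ := GRing.Zmodule_isLmodule.Build F differential
  scale_differentialA scale_differential1
  scale_differentialDr scale_differentialDl.

Lemma kahler_class_scalable : scalable cl. Proof. exact: kahler_classZ. Qed.

HB.instance Definition _ :=
  GRing.isScalable.Build F {freeg F / F} differential _ cl
    kahler_class_scalable.

Definition diff (x : F) : differential := cl << x >>.

Definition is_derivation (M : lmodType F) (D : F -> M) : Prop :=
  [/\ forall x y, D (x + y) = D x + D y,
      forall x y, D (x * y) = x *: D y + y *: D x
    & forall c, D (iota c) = 0].

Lemma diff_is_derivation : is_derivation diff.
Proof.
split=> [x y|x y|c]; rewrite /diff.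
- by rewrite -raddfD; apply/kahler_class_eqP; rewrite opprD addrA; apply: KahlerAdd.
- transitivity (cl (x *: << y >> + y *: << x >>)); last first.
    by rewrite raddfD /= !linearZ.
  by apply/kahler_class_eqP; rewrite opprD addrA; apply: KahlerLeibniz.
- rewrite -[0](raddf0 cl); apply/kahler_class_eqP.
  by rewrite subr0; apply: KahlerConst.
Qed.

Lemma diff_span (w : differential) :
  exists s : seq (F * F), w = \sum_(u <- s) u.1 *: diff u.2.
Proof.
exists [seq (coeff x (repr w), x) | x <- dom (repr w)].
transitivity (\sum_(x <- dom (repr w)) cl << coeff x (repr w) *g x >>).
  by rewrite -{1}[w]reprK -{1}[repr w]freeg_sumE; apply: raddf_sum.
rewrite [RHS]big_map; apply: eq_bigr => x _; rewrite /diff /= -linearZ /=.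
by congr cl; apply/eqP/freeg_eqP => y; rewrite coeffZ !coeffU mul1r.
Qed.

Lemma diff_universal (M : lmodType F) (D : F -> M) : is_derivation D ->
  exists f : {linear differential -> M}, forall x, f (diff x) = D x.
Proof.
case=> DD DM DC.
have [L LU] : exists L : {additive {freeg F / F} -> M},
    forall k x, L << k *g x >> = k *: D x.
  pose LA := GRing.isAdditive.Build _ M (fglift D) (lift_is_additive D).
  pose L : {additive {freeg F / F} -> M} := HB.pack (fglift D) LA.
  by exists L => k x; apply: liftU.
have LZ a u : L (a *: u) = a *: L u.
  rewrite -[u]freeg_sumE scaler_sumr !(raddf_sum L) scaler_sumr.
  apply: eq_bigr => x _; rewrite LU scalerA -LU; congr (L _).
  by apply/eqP/freeg_eqP => y; rewrite coeffZ !coeffU mulrA.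
have lift0 u : kahler_null u -> L u = 0.
  elim=> {u} [x y|x y|c||u v _ u0 _ v0|a u _ u0].
  - by rewrite !raddfB /= !LU !scale1r DD addrAC addrK subrr.
  - by rewrite !raddfB /= !LZ !LU !scale1r DM addrAC addrK subrr.
  - by rewrite LU DC scaler0.
  - exact: raddf0.
  - by rewrite raddfD /= u0 v0 addr0.
  - by rewrite LZ u0 scaler0.
pose f (w : differential) := L (repr w).
have fE u : f (cl u) = L u.
  apply/eqP; rewrite -subr_eq0 -raddfB; apply/eqP/lift0/kahler_class_eqP.
  by rewrite reprK.
have fL : linear f.
  by move=> a v w; rewrite -[v]reprK -[w]reprK -linearZ -raddfD !fE raddfD LZ.
pose lf := GRing.isLinear.Build F differential M _ f fL.
pose F' : {linear differential -> M} := HB.pack f lf.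
by exists F' => x; rewrite /= fE LU scale1r.
Qed.

End KahlerDifferentials.

Section FunctionField.

Context {K F : fieldType} (iota : {rmorphism K -> F}).

(* z lies in the subfield K(t) *)
Definition in_rational_subfield (t z : F) : Prop :=
  exists p q : {poly K}, (map_poly iota q).[t] != 0 /\
    z = (map_poly iota p).[t] / (map_poly iota q).[t].

(* F/K(t) is a separable algebraic extension; when F/K is a function field
   (in one variable) it is then finite and t is transcendental over K. *)
Definition separating (t : F) : Prop :=
  forall z : F, exists q : {poly F},
    [/\ forall i, in_rational_subfield t q`_i, separable_poly q & root q z].

Definition cartier_graph (l : nat) (w w' : differential iota) : Prop :=
  exists (t : F) (x : nat -> F),
    [/\ separating t,
        w = (\sum_(i < l) x i ^+ l * t ^+ i) *: diff iota t
      & w' = x l.-1 *: diff iota t].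

(* In characteristic l > 0, for a function field over a perfect field, each w
   has exactly one image w' under cartier_graph. *)
Definition cartier (l : nat) (w : differential iota) : differential iota :=
  xget 0 (cartier_graph l w).

(* Places are given by their normalized discrete valuations; v 0 is
   irrelevant (the usual convention would be v 0 = +oo). *)
Definition place (v : F -> int) : Prop :=
  [/\ forall x y, x != 0 -> y != 0 -> v (x * y) = v x + v y,
      forall x y, x != 0 -> y != 0 -> x + y != 0 ->
        Num.min (v x) (v y) <= v (x + y),
      forall c, c != 0 -> v (iota c) = 0
    & exists t, t != 0 /\ v t = 1].

Definition holomorphic_at (v : F -> int) (w : differential iota) : Prop :=
  exists t f : F,
    [/\ t != 0, v t = 1, w = f *: diff iota t & f = 0 \/ 0 <= v f].

Definition holomorphic (w : differential iota) : Prop :=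
  forall v, place v -> holomorphic_at v w.

(* P is a K-subspace of dimension k of the space of differentials *)
Definition has_dim (P : set (differential iota)) (k : nat) : Prop :=
  exists b : 'I_k -> differential iota,
    (forall c : 'I_k -> K,
       \sum_(i < k) iota (c i) *: b i = 0 -> forall i, c i = 0) /\
    (forall w, P w <->
       exists c : 'I_k -> K, w = \sum_(i < k) iota (c i) *: b i).

(* 0 by convention when P is not a finite-dimensional subspace *)
Definition dimK (P : set (differential iota)) : nat := xget 0%N (has_dim P).

Definition a_number (l : nat) : nat :=
  dimK [set w | holomorphic w /\ cartier l w = 0].

(* F = K(U, V) is the function field of the curve U^n + V^m + 1 = 0. *)
Definition fermat_function_field (n m : nat) (U V : F) : Prop :=
  [/\ U ^+ n + V ^+ m + 1 = 0,
      ~ algebraicOver iota U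
    & forall z : F, exists a b : {poly {poly K}},
        (map_poly (map_poly iota) b).[U, V] != 0 /\
        z = (map_poly (map_poly iota) a).[U, V]
              / (map_poly (map_poly iota) b).[U, V]].

End FunctionField.

(* Main.v *)
(* The holomorphic differentials of U^n + V^m + 1 = 0 have the basis
   w_(i,j) = U^(i-1) V^(j-m) dU for i, j > 0 and i/n + j/m < 1. In
   characteristic l the Cartier operator maps w_(i,j) to a multiple of
   w_(i',j'), where l i' = i mod n and l j' = j mod m, and this multiple is
   nonzero exactly when i'/n + j'/m < 1. Hence the a-number is the number of
   regular indices that multiplication by 1/l makes irregular: it depends only
   on l modulo lcm(n, m), and is the same for l and 1/l because multiplication
   by l permutes the indices.

   Places are described by two models of the field of the shape S^N = p(Z),
   with K[Z, S] smooth at the points in question: (Z, S) = (U, V) for the finite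
   places, and a monomial change of coordinates for the infinite ones. *)

Require Import Defs.
From HB Require Import structures.
From mathcomp Require Import all_boot all_order all_algebra.
From mathcomp Require Import polyXY separable boolp classical_sets zify ring.

Set Implicit Arguments.
Unset Strict Implicit.
Unset Printing Implicit Defensive.

Import Order.TTheory GRing.Theory Num.Theory.
Local Open Scope ring_scope.

(** [cartier] chooses a value of a relation in which the separating element t is arbitrary. Its
    kernel is controlled by a condition free of t. With E = d/dt, the form with coefficients [x i]
    is exact iff [x l.-1 = 0]: E^l = 0, while E^(l-1) extracts (l-1)! times the l-th power of that
    coefficient. So the kernel consists of exact forms, and taking t = U it is tested by D^(l-1),
    where D = d/dU. This iterate is computable. As V^m is a polynomial in U, each U^i V^j / V^(m-1)
    with a regular index is an l-th power times (-(U^n + 1))^N U^i, and D is linear over l-th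
    powers. In the binomial expansion D^(l-1) keeps only exponents congruent to -1 modulo l. There
    is one candidate term; it is present iff its position is at most N, and this inequality is the
    regularity of the target index. The outcome is an identity between l-th powers. Since K contains
    l-th roots of its elements, a vanishing sum becomes a linear relation between monomials, which
    are independent. *)

Section RootsOfConstants.
Context {K : closedFieldType} (N : nat).
Hypothesis N_neq0 : N%:R != 0 :> K.

Lemma charf_exp_gt0 : (0 < N)%N.
Proof. by case: N N_neq0 => //; rewrite eqxx. Qed.

(** The derivative is a nonzero multiple of X^(N-1), so a common divisor of it and X^N - c divides
    X^N, hence the constant c: the polynomial is separable. *)
Lemma XnsubC_split (c : K) : c != 0 ->
  exists r : seq K, [/\ uniq r, size r = N
    & 'X^N - c%:P = \prod_(z <- r) ('X - z%:P)].
Proof.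
move=> c0; have [r rE] := closed_field_poly_normal ('X^N - c%:P : {poly K}).
have Ngt := charf_exp_gt0.
rewrite (monicP (monicXnsubC _ Ngt)) scale1r in rE.
exists r; split=> //; last first.
  by apply: succn_inj; rewrite -(size_XnsubC c Ngt) rE size_prod_XsubC.
rewrite -separable_prod_XsubC -rE unlock.
rewrite /= derivB derivC subr0 derivXn -scaler_nat coprimepZr //.
apply/coprimepP => q qN qN1.
have qX : q %| 'X^N by rewrite -(prednK Ngt) exprS dvdp_mull.
have : q %| c%:P by rewrite -(subKr 'X^N c%:P) dvdp_sub.
by rewrite -alg_polyC dvdpZr // dvdp1 size_poly_eq1.
Qed.

End RootsOfConstants.

(** * Evaluation of bivariate polynomials *)

Section Evaluation.
Context {K : fieldType} {F : fieldType} (iota : {rmorphism K -> F}).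

Definition eval1 (Z : F) (p : {poly K}) : F := (map_poly iota p).[Z].

Lemma eval1_is_zmod_morphism Z : zmod_morphism (eval1 Z).
Proof. by move=> p q; rewrite /eval1 rmorphB hornerD hornerN. Qed.
Lemma eval1_is_monoid_morphism Z : monoid_morphism (eval1 Z).
Proof.
by split=> [|p q]; rewrite /eval1 ?rmorph1 ?hornerC // rmorphM hornerM.
Qed.
HB.instance Definition _ Z := GRing.isZmodMorphism.Build {poly K} F (eval1 Z)
  (eval1_is_zmod_morphism Z).
HB.instance Definition _ Z := GRing.isMonoidMorphism.Build {poly K} F (eval1 Z)
  (eval1_is_monoid_morphism Z).

(** The inner variable is sent to Z and the outer one to S. In [a.[ga, al]] the outer value comes
    first, so this is the value of a at the point (Z, S) = (al, ga). *)
Definition eval2 (Z S : F) (a : {poly {poly K}}) : F :=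
  (map_poly (eval1 Z) a).[S].

Lemma eval2_is_zmod_morphism Z S : zmod_morphism (eval2 Z S).
Proof. by move=> p q; rewrite /eval2 rmorphB hornerD hornerN. Qed.
Lemma eval2_is_monoid_morphism Z S : monoid_morphism (eval2 Z S).
Proof.
by split=> [|p q]; rewrite /eval2 ?rmorph1 ?hornerC // rmorphM hornerM.
Qed.
HB.instance Definition _ Z S := GRing.isZmodMorphism.Build {poly {poly K}} F
  (eval2 Z S) (eval2_is_zmod_morphism Z S).
HB.instance Definition _ Z S := GRing.isMonoidMorphism.Build {poly {poly K}} F
  (eval2 Z S) (eval2_is_monoid_morphism Z S).

Lemma eval1C Z c : eval1 Z c%:P = iota c.
Proof. by rewrite /eval1 map_polyC hornerC. Qed.
Lemma eval1X Z : eval1 Z 'X = Z.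
Proof. by rewrite /eval1 map_polyX hornerX. Qed.
Lemma eval2C Z S p : eval2 Z S p%:P = eval1 Z p.
Proof. by rewrite /eval2 map_polyC hornerC. Qed.
(* Rewriting with rmorphB or rmorphN under these morphisms does not terminate in
   reasonable time, hence the specialized versions. *)
Lemma eval1B Z : {morph eval1 Z : a b / a - b}.
Proof. exact: eval1_is_zmod_morphism. Qed.
Lemma eval1N Z : {morph eval1 Z : a / - a}.
Proof. by move=> a; rewrite -[- a]sub0r eval1B rmorph0 sub0r. Qed.
Lemma eval2B Z S : {morph eval2 Z S : a b / a - b}.
Proof. exact: eval2_is_zmod_morphism. Qed.
Lemma eval2N Z S : {morph eval2 Z S : a / - a}.
Proof. by move=> a; rewrite -[- a]sub0r eval2B rmorph0 sub0r. Qed.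
Lemma eval2X Z S : eval2 Z S 'X = S.
Proof. by rewrite /eval2 map_polyX hornerX. Qed.
Lemma eval1Z Z c p : eval1 Z (c *: p) = iota c * eval1 Z p.
Proof. by rewrite -mul_polyC rmorphM /= eval1C. Qed.
Lemma eval2Z Z S c p : eval2 Z S (c *: p) = eval1 Z c * eval2 Z S p.
Proof. by rewrite -mul_polyC rmorphM /= eval2C. Qed.

Lemma eval2E Z S a : eval2 Z S a = \sum_(i < size a) eval1 Z a`_i * S ^+ i.
Proof.
rewrite {1}[a](esym (coefK a)) poly_def rmorph_sum /=; apply: eq_bigr => i _.
by rewrite eval2Z rmorphXn /= eval2X.
Qed.

Definition gen_by (Z S x : F) : Prop :=
  exists a b, eval2 Z S b != 0 /\ x = eval2 Z S a / eval2 Z S b.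

Section GenBy.
Context (Z S : F).
Local Notation gen := (gen_by Z S).

Lemma gen_by_eval a : gen (eval2 Z S a).
Proof. by exists a, 1; rewrite rmorph1 divr1 oner_eq0. Qed.

Lemma gen_byD x y : gen x -> gen y -> gen (x + y).
Proof.
move=> [a [b [b0 ->]]] [a' [b' [b0' ->]]]; exists (a * b' + a' * b), (b * b').
by rewrite rmorphD !rmorphM /= mulf_neq0 // addf_div.
Qed.

Lemma gen_byM x y : gen x -> gen y -> gen (x * y).
Proof.
move=> [a [b [b0 ->]]] [a' [b' [b0' ->]]]; exists (a * a'), (b * b').
by rewrite !rmorphM /= mulf_neq0 // mulf_div.
Qed.

Lemma gen_byV x : gen x -> gen x^-1.
Proof.
move=> [a [b [b0 ->]]]; have [a0|a0] := eqVneq (eval2 Z S a) 0.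
  by rewrite a0 mul0r invr0 -(rmorph0 (eval2 Z S)); apply: gen_by_eval.
by exists b, a; rewrite invf_div.
Qed.

Lemma gen_byX x k : gen x -> gen (x ^+ k).
Proof.
move=> gx; elim: k => [|k IHk]; last by rewrite exprS; apply: gen_byM.
by rewrite expr0 -(rmorph1 (eval2 Z S)); apply: gen_by_eval.
Qed.

Lemma gen_by_sub U V x : gen U -> gen V -> gen_by U V x -> gen x.
Proof.
move=> gU gV [a [b [_ ->]]].
have gev c : gen (eval2 U V c).
  have g1 q : gen (eval1 U q).
    elim/poly_ind: q => [|q q0 IHq].
      by rewrite rmorph0 -(rmorph0 (eval2 Z S)); apply: gen_by_eval.
    rewrite rmorphD rmorphM /= eval1X eval1C.
    apply: gen_byD; first exact: gen_byM.
    by rewrite -(eval1C Z) -(eval2C Z S); apply: gen_by_eval.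
  elim/poly_ind: c => [|c q IHc].
    by rewrite rmorph0 -(rmorph0 (eval2 Z S)); apply: gen_by_eval.
  rewrite rmorphD rmorphM /= eval2X eval2C.
  by apply: gen_byD => //; apply: gen_byM.
by apply: gen_byM => //; apply: gen_byV.
Qed.

Lemma gen_byl : gen Z.
Proof. by have := gen_by_eval 'X%:P; rewrite eval2C eval1X. Qed.
Lemma gen_byr : gen S.
Proof. by have := gen_by_eval 'X; rewrite eval2X. Qed.

End GenBy.

Lemma horner2_eval U V (b : {poly {poly K}}) :
  (map_poly (map_poly iota) b).[U, V] = eval2 V U b.
Proof.
elim/poly_ind: b => [|b q IHb]; first by rewrite !rmorph0 !horner0.
rewrite !rmorphD !rmorphM /= eval2X eval2C map_polyX map_polyC.
by rewrite !hornerE IHb mulrC.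
Qed.

Lemma fermat_gen_by n m U V : fermat_function_field iota n m U V ->
  forall x, gen_by U V x.
Proof.
move=> [_ _ gUV] x; have [a [b]] := gUV x; rewrite !horner2_eval => -[b0 xE].
by apply: (@gen_by_sub U V V U); [exact: gen_byr|exact: gen_byl|exists a, b].
Qed.

End Evaluation.

Section Transcendental.
Context {K : closedFieldType} {F : fieldType} (iota : {rmorphism K -> F}).

(** Since K is algebraically closed, an element algebraic over K is a constant, so this is the usual
    notion; [eval1_eq0] gives its usual form. *)
Definition transcendental (Z : F) : Prop := forall c, Z != iota c.

Lemma algebraic_const (Z : F) (q : {poly K}) :
  q != 0 -> eval1 iota Z q = 0 -> exists c, Z = iota c.
Proof.
move=> q0; have [r qE] := closed_field_poly_normal q.
rewrite qE eval1Z rmorph_prod /= => /eqP; rewrite mulf_eq0 fmorph_eq0.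
rewrite lead_coef_eq0 (negPf q0) prodf_seq_eq0 /= => /hasP[c _ /=].
rewrite rmorphB /= eval1X eval1C subr_eq0 => /eqP ZE; by exists c.
Qed.

Lemma eval1_eq0 Z q : transcendental Z -> (eval1 iota Z q == 0) = (q == 0).
Proof.
move=> trZ; apply/eqP/eqP => [q0|->]; last by rewrite rmorph0.
apply/eqP; apply: contraT => qn0.
by have [c /eqP] := algebraic_const qn0 q0; rewrite (negPf (trZ c)).
Qed.

End Transcendental.

(** * Function fields S^N = p(Z) *)

Lemma mup_exp (K : fieldType) (x : K) (p : {poly K}) k : p != 0 ->
  mup x (p ^+ k) = (k * mup x p)%N.
Proof.
move=> p0; elim: k => [|k IHk].
  by rewrite expr0 mul0n mupNroot // root1.
by rewrite exprS mupM ?expf_neq0 // IHk mulSn.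
Qed.

Lemma mup_simple_root (K : fieldType) (x : K) (p : {poly K}) :
  p.[x] = 0 -> p^`().[x] != 0 -> mup x p = 1%N.
Proof.
move=> px dpx; have p0 : p != 0.
  by apply: contra_neq dpx => ->; rewrite deriv0 horner0.
apply/eqP; rewrite eqn_leq mup_leq // mup_geq //.
rewrite dvdp_XsubCl rootE px eqxx andbT; apply: contra dpx.
move=> /dvdpP[q ->]; rewrite derivM deriv_exp !hornerE.
by rewrite /= subrr !(mulr0, mul0rn, addr0).
Qed.

(** A simple root b of p acts as in Eisenstein's criterion at Z = b: it makes X^N - p(Z) irreducible
    over K(Z), which [se_indep] expresses as the independence of 1, S, ..., S^(N-1). *)
Record superelliptic (K : closedFieldType) (F : fieldType)
    (iota : {rmorphism K -> F}) (N : nat) (p : {poly K}) (Z S : F) : Prop :=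
  Superelliptic {
    se_exp : N%:R != 0 :> K;
    se_trans : transcendental iota Z;
    se_eqn : S ^+ N = eval1 iota Z p;
    se_root : exists2 b, p.[b] = 0 & p^`().[b] != 0;
    se_gen : forall x, gen_by iota Z S x
  }.

Section Superelliptic.
Context {K : closedFieldType} {F : fieldType} {iota : {rmorphism K -> F}}.
Context {N : nat} {p : {poly K}} {Z S : F}.
Hypothesis M : superelliptic iota N p Z S.

Local Notation ev1 := (eval1 iota Z).
Local Notation ev2 := (eval2 iota Z S).

Definition se_poly : {poly {poly K}} := 'X^N - p%:P.
Local Notation f := se_poly.

Let N_gt0 : (0 < N)%N := charf_exp_gt0 (se_exp M).
Let ev1_eq0 q : (ev1 q == 0) = (q == 0) := eval1_eq0 q (se_trans M).

Lemma ev1_inj : injective ev1.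
Proof.
move=> q r qr; apply/eqP; rewrite -subr_eq0 -ev1_eq0 rmorphB /=.
by rewrite subr_eq0; apply/eqP.
Qed.

Lemma se_p_neq0 : p != 0.
Proof.
have [b _] := se_root M; apply: contra_neq => ->.
by rewrite deriv0 horner0.
Qed.

Lemma se_S_neq0 : S != 0.
Proof.
have : S ^+ N != 0 by rewrite (se_eqn M) ev1_eq0 se_p_neq0.
by apply: contra_neq => ->; rewrite expr0n gtn_eqF.
Qed.

Lemma se_poly_monic : f \is monic.
Proof. exact: monicXnsubC. Qed.

Lemma size_se_poly : size f = N.+1.
Proof. exact: size_XnsubC. Qed.

Lemma eval2_se_poly : ev2 f = 0.
Proof.
by rewrite /f eval2B rmorphXn /= eval2X eval2C (se_eqn M) subrr.
Qed.

(* A relation of minimal degree k in S divides X^N - S^N, which splits over F,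
   so its constant coefficient is a constant times S^k; the N-th power of that
   coefficient has order divisible by N and also = k mod N at a simple root of
   p, hence N divides k. *)
Lemma se_indep (a : {poly {poly K}}) : (size a <= N)%N -> ev2 a = 0 -> a = 0.
Proof.
move=> szN eva; apply/eqP; apply: contraT => a0.
pose P k := `[< exists b : {poly {poly K}}, [/\ b != 0, size b = k & ev2 b = 0] >].
have exP : exists k, P k by exists (size a); apply/asboolP; exists a.
(* [k] is a size: the minimal relation has degree [k.-1], and it is [k.-1] that N is shown to
   divide. *)
case: (ex_minnP exP) => k /asboolP[b [b0 szb evb]] kmin.
have minb (r : {poly {poly K}}) : (size r < k)%N -> ev2 r = 0 -> r = 0.
  move=> szr evr; apply/eqP; apply: contraTT szr => r0.
  by rewrite -leqNgt; apply: kmin; apply/asboolP; exists r.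
have kN : (k <= N)%N.
  by apply: leq_trans szN; apply: kmin; apply/asboolP; exists a.
have lcb : ev1 (lead_coef b) != 0 by rewrite ev1_eq0 lead_coef_eq0.
have eqd := Pdiv.Idomain.divp_eq f b.
have r0 : f %% b = 0.
  apply: minb; first by rewrite -szb ltn_modp.
  have := congr1 ev2 eqd.
  by rewrite eval2Z eval2_se_poly mulr0 rmorphD rmorphM /= evb mulr0 add0r.
have {r0 eqd} eqd : ev1 (lead_coef b ^+ scalp f b) *: ('X^N - (S ^+ N)%:P) =
    map_poly ev1 (f %/ b) * map_poly ev1 b.
  rewrite -rmorphM /= -[f %/ b * b]addr0 -r0 -eqd map_polyZ /=.
  by rewrite rmorphB /= map_polyXn map_polyC /= (se_eqn M).
pose B := map_poly ev1 b.
have szB : size B = k by rewrite -szb /B size_map_inj_poly ?rmorph0 //; apply: ev1_inj.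
have lcB : lead_coef B = ev1 (lead_coef b).
  by rewrite /B lead_coef_map_inj ?rmorph0 //; apply: ev1_inj.
have dvB : B %| 'X^N - (S ^+ N)%:P.
  have c0 : ev1 (lead_coef b ^+ scalp f b) != 0 by rewrite rmorphXn expf_neq0.
  by rewrite -(dvdpZr _ _ c0) eqd dvdp_mull.
have [r [ur szr rE]] := XnsubC_split (se_exp M) (oner_neq0 K).
have splitS : 'X^N - (S ^+ N)%:P = \prod_(z <- r) ('X - (iota z * S)%:P).
  have Ngt := N_gt0.
  rewrite -(big_map (fun z => iota z * S) xpredT (fun z => 'X - z%:P)).
  rewrite [LHS](@all_roots_prod_XsubC _ _ [seq iota z * S | z <- r]).
  - by rewrite (monicP (monicXnsubC _ Ngt)) scale1r.
  - by rewrite size_XnsubC // size_map szr.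
  - apply/allP => _ /mapP[z zr ->]; rewrite rootE !hornerE exprMn.
    have : root ('X^N - 1%:P) z by rewrite rE root_prod_XsubC.
    rewrite rootE !hornerE subr_eq0 => /eqP zN.
    by rewrite -rmorphXn zN rmorph1 mul1r subrr.
  - rewrite uniq_rootsE map_inj_uniq // => y z /(mulIf se_S_neq0).
    exact: fmorph_inj.
rewrite splitS in dvB; have [m Bm] := dvdp_prod_XsubC dvB.
set T := \prod_(i <- _) _ in Bm.
have BT : B = lead_coef B *: T.
  have [[c1 c2] /= /andP[c10 c20] cE] := eqpP _ _ Bm.
  have := congr1 lead_coef cE; rewrite !lead_coefZ.
  rewrite (monicP (monic_prod_XsubC _ _ _)) mulr1 => c2E.
  by apply: (scalerI c10); rewrite scalerA c2E.
have szm : size (mask m r) = k.-1.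
  have := congr1 (fun q : {poly F} => (size q).-1) BT.
  by rewrite size_scale ?lcB // size_prod_XsubC szB.
pose u := \prod_(z <- mask m r) (- z).
have B0 : ev1 b`_0 = ev1 (lead_coef b) * iota u * S ^+ k.-1.
  have := congr1 (fun q : {poly F} => q.[0]) BT.
  rewrite hornerZ lcB horner_coef0 coef_map /= => ->; rewrite -mulrA; congr (_ * _).
  rewrite /T horner_prod /u rmorph_prod -szm.
  elim: (mask m r) => [|z s IHs]; first by rewrite !big_nil mulr1.
  by rewrite !big_cons IHs !hornerE /= rmorphN exprS; ring.
have u0 : u != 0.
  apply/negP; rewrite prodf_seq_eq0 => /hasP[z /mem_mask zr /=].
  rewrite oppr_eq0 => /eqP z0; have : root ('X^N - 1%:P) z by rewrite rE root_prod_XsubC.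
  by rewrite rootE z0 !hornerE expr0n gtn_eqF // ?sub0r ?add0r oppr_eq0 oner_eq0.
have key : b`_0 ^+ N = lead_coef b ^+ N * u%:P ^+ N * p ^+ k.-1.
  apply: ev1_inj; rewrite !rmorphM !rmorphXn /= B0 !exprMn eval1C.
  by rewrite -exprM mulnC exprM (se_eqn M).
have [x0 px0 dpx0] := se_root M.
have lb0 : lead_coef b != 0 by rewrite lead_coef_eq0.
have b00 : b`_0 != 0.
  have : b`_0 ^+ N != 0.
    by rewrite key !mulf_neq0 ?expf_neq0 ?polyC_eq0 ?se_p_neq0.
  by apply: contra_neq => ->; rewrite expr0n gtn_eqF.
have := congr1 (mup x0) key.
have uN : u%:P != 0 :> {poly K} by rewrite polyC_eq0.
rewrite mupM ?mulf_neq0 ?expf_neq0 ?se_p_neq0 // mupM ?expf_neq0 //.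
rewrite !mup_exp ?se_p_neq0 // (mup_simple_root px0 dpx0) (@mupNroot _ _ u%:P); last first.
  by rewrite rootC.
rewrite muln0 addn0 muln1 => kE; have kdvd : (N %| k.-1)%N.
  by rewrite -(dvdn_addr _ (dvdn_mulr (mup x0 (lead_coef b)) (dvdnn N))) -kE dvdn_mulr.
have [k1|k1] := posnP k.-1; last first.
  by have := dvdn_leq k1 kdvd; move: k1 kN; clear; lia.
have szb1 : (size b <= 1)%N by rewrite szb; move: k1; clear; case: k => [|[]].
move: evb; rewrite (size1_polyC szb1).
by rewrite eval2C => /eqP; rewrite ev1_eq0 (negPf b00).
Qed.
End Superelliptic.

(** * Integrality over K[Z] and denominators *)

Section Relations.
Context {K : closedFieldType} {F : fieldType} {iota : {rmorphism K -> F}}.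
Context {N : nat} {p : {poly K}} {Z S : F}.
Hypothesis M : superelliptic iota N p Z S.

Local Notation ev1 := (eval1 iota Z).
Local Notation ev2 := (eval2 iota Z S).
Local Notation f := (@se_poly K N p).

Lemma se_reduce (a : {poly {poly K}}) : exists q r : {poly {poly K}},
  [/\ a = q * f + r, (size r <= N)%N & ev2 r = ev2 a].
Proof.
exists (Pdiv.Ring.rdivp a f), (Pdiv.Ring.rmodp a f).
have aE := Pdiv.RingMonic.rdivp_eq (se_poly_monic M) a.
split=> //.
  by rewrite -ltnS -(size_se_poly M) Pdiv.Ring.ltn_rmodpN0 ?monic_neq0 ?(se_poly_monic M).
by rewrite {2}aE rmorphD rmorphM /= (eval2_se_poly M) mulr0 add0r.
Qed.

(** The remainder modulo the monic [se_poly] also vanishes at (Z, S) and has degree below N, so it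
    is zero by [se_indep]. Hence values at points of the curve and derivations can be defined on
    representatives. *)
Lemma se_kernel a : ev2 a = 0 -> exists q, a = q * f.
Proof.
have [q [r [aE szr <-]]] := se_reduce a => /(se_indep M szr) r0.
by exists q; rewrite aE r0 addr0.
Qed.

Lemma se_point al ga a b : ga ^+ N = p.[al] -> ev2 a = ev2 b ->
  a.[ga, al] = b.[ga, al].
Proof.
move=> gaN /eqP; rewrite -subr_eq0 -eval2B => /eqP/se_kernel[q abE].
apply/eqP; rewrite -subr_eq0 -!hornerN -!hornerD abE /f !hornerE.
by rewrite -gaN subrr mulr0.
Qed.

Lemma eval2_integral a : integralOver ev1 (ev2 a).
Proof.
apply: integral_horner.
  by apply/integral_poly => i; rewrite coef_map; apply: integral_id.
exists f; first exact: (se_poly_monic M).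
by rewrite rootE; apply/eqP/(eval2_se_poly M).
Qed.

Lemma eval2_comp (q a : {poly {poly K}}) : ev2 (q \Po a) = (map_poly ev1 q).[ev2 a].
Proof.
elim/poly_ind: q => [|q c IHq]; first by rewrite comp_poly0 !rmorph0 horner0.
rewrite comp_poly_MXaddC !rmorphD !rmorphM /= IHq eval2C.
by rewrite map_polyX map_polyC /= !hornerE.
Qed.

(** A substitute for the norm to K[Z]: once its factors X are stripped, an integral equation of
    [ev2 a] has a nonzero constant term, which is a multiple of [ev2 a]. *)
Lemma eval2_dvd_eval1 a : ev2 a != 0 ->
  exists u c, c != 0 /\ ev2 u * ev2 a = ev1 c.
Proof.
move=> a0; have [q qm qa] := eval2_integral a.
have {qm} := monic_neq0 qm; elim/poly_ind: q qa => [|q c IHq]; first by rewrite eqxx.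
rewrite rootE rmorphD rmorphM /= map_polyX map_polyC /= !hornerE => qac q0.
have [c0|c0] := eqVneq c 0.
  rewrite c0 rmorph0 addr0 mulf_eq0 (negPf a0) orbF in qac.
  apply: IHq; first by rewrite rootE.
  by apply: contra_neq q0 => ->; rewrite mul0r c0 addr0.
exists (q \Po a), (- c); rewrite oppr_eq0 c0; split=> //.
by apply/eqP; rewrite eval2_comp eval1N -addr_eq0.
Qed.

(** The cofactor of [eval2_dvd_eval1] clears S from the denominator. This gives the coordinates of x
    over K(Z) in the basis 1, S, ..., S^(N-1). *)
Lemma se_quotient x : exists (a : {poly {poly K}}) (c : {poly K}),
  [/\ c != 0, (size a <= N)%N & ev1 c * x = ev2 a].
Proof.
have [a [b [b0 ->]]] := se_gen M x; have [u [c [c0 ubE]]] := eval2_dvd_eval1 b0.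
have [_ [r [_ szr rE]]] := se_reduce (u * a); exists r, c; split=> //.
by rewrite rE -ubE rmorphM /= -mulrA (mulrC (ev2 b)) divfK.
Qed.

(** For some nonzero c, the element c x is integral over K[Z]. Its equation composed with c X is an
    equation of x, and composition with a polynomial of degree one cannot make it zero. *)
Lemma se_algebraic x : exists2 q, q != 0 & eval2 iota Z x q = 0.
Proof.
have [a [c [c0 _ cx]]] := se_quotient x; have [q qm qa] := eval2_integral a.
have szcX : size (c *: 'X : {poly {poly K}}) = 2 by rewrite size_scale ?size_polyX.
exists (q \Po (c *: 'X)).
  by rewrite -size_poly_eq0 size_comp_poly2 // size_poly_eq0 monic_neq0.
have compE r : eval2 iota Z x (r \Po (c *: 'X)) = (map_poly ev1 r).[ev1 c * x].
  elim/poly_ind: r => [|r d IHr]; first by rewrite comp_poly0 !rmorph0 horner0.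
  rewrite comp_poly_MXaddC !rmorphD !rmorphM /= IHr eval2C eval2Z eval2X.
  by rewrite map_polyX map_polyC /= !hornerE.
by rewrite compE cx; apply/eqP.
Qed.

End Relations.

(** * Derivations and differentials *)

Section ChainRule.
Context {K F : fieldType} {iota : {rmorphism K -> F}}.
Context {L : lmodType F} {delta : F -> L}.
Hypothesis der : is_derivation iota delta.

Let derD x y : delta (x + y) = delta x + delta y. Proof. by case: der. Qed.
Let derM x y : delta (x * y) = x *: delta y + y *: delta x.
Proof. by case: der. Qed.
Let derC c : delta (iota c) = 0. Proof. by case: der. Qed.

Lemma derivation0 : delta 0 = 0.
Proof. by rewrite -(rmorph0 iota) derC. Qed.

Lemma derivation1 : delta 1 = 0.
Proof. by rewrite -(rmorph1 iota) derC. Qed.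

Lemma derivationX x k : delta (x ^+ k) = (k%:R * x ^+ k.-1) *: delta x.
Proof.
elim: k => [|k IHk]; first by rewrite expr0 derivation1 mul0r scale0r.
rewrite exprS derM IHk scalerA -scalerDl; congr (_ *: _).
case: k {IHk} => [|k] /=; first by rewrite !expr0; ring.
by rewrite exprS -[in RHS]natr1; ring.
Qed.

Lemma derivation_sum I (r : seq I) (P : pred I) (G : I -> F) :
  delta (\sum_(i <- r | P i) G i) = \sum_(i <- r | P i) delta (G i).
Proof. by apply: big_morph => //; apply: derivation0. Qed.

Lemma derivation_eval1 Z q :
  delta (eval1 iota Z q) = eval1 iota Z q^`() *: delta Z.
Proof.
elim/poly_ind: q => [|q c IHq].
  by rewrite deriv0 !rmorph0 derivation0 scale0r.
rewrite derivD derivM derivX derivC addr0 mulr1 !rmorphD !rmorphM /= eval1X eval1C.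
by rewrite derD derC addr0 derM IHq scalerA -scalerDl mulrC addrC mulrC.
Qed.

Lemma eval2_swap Z S a : eval2 iota S Z (swapXY a) = eval2 iota Z S a.
Proof. by rewrite -!horner2_eval -swapXY_map horner2_swapXY. Qed.

(** Formal differentiation acts on the outer variable S. For the partial derivative in Z the
    variables are exchanged by [swapXY], and the result is evaluated in the opposite order. *)
Lemma derivation_eval2 Z S a : delta (eval2 iota Z S a) =
  eval2 iota S Z (swapXY a)^`() *: delta Z + eval2 iota Z S a^`() *: delta S.
Proof.
elim/poly_ind: a => [|a q IHa].
  by rewrite !(rmorph0, deriv0) derivation0 !scale0r addr0.
rewrite !rmorphD !rmorphM /= swapXY_X swapXY_polyC.
rewrite !derivD !derivM !derivX !derivC !addr0 mulr0 addr0 mulr1.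
rewrite !rmorphD !rmorphM /= eval2X !eval2C eval1X.
rewrite derD derM IHa derivation_eval1.
have -> : eval2 iota S Z (q^:P)^`() = eval1 iota Z q^`().
  by rewrite deriv_map /= -swapXY_polyC eval2_swap eval2C.
rewrite !scalerDl scalerDr !scalerA ![S * _]mulrC.
by rewrite [_ *: _ + (_ + _)]addrC -!addrA; congr (_ + _); rewrite addrA addrC.
Qed.

Lemma derivation_quot x y : y != 0 ->
  delta (x / y) = (y ^- 2) *: (y *: delta x - x *: delta y).
Proof.
move=> y0; have := derM (x / y) y; rewrite divfK // => ->.
rewrite [y *: (_ + _)]scalerDr !scalerA (mulrC y) divfK // [_ + _ *: _]addrC addrK.
by rewrite scalerA -expr2 mulVf ?expf_neq0 // scale1r.
Qed.

End ChainRule.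

Lemma scale_regE (F : fieldType) (x : F) (y : F^o) : x *: y = x * y.
Proof. by []. Qed.

Section Derivation.
Context {K : closedFieldType} {F : fieldType} {iota : {rmorphism K -> F}}.
Context {N : nat} {p : {poly K}} {Z S : F}.
Hypothesis M : superelliptic iota N p Z S.

Local Notation ev1 := (eval1 iota Z).
Local Notation ev2 := (eval2 iota Z S).
Local Notation f := (@se_poly K N p).

(** The value that differentiating S^N = p(Z) forces on dS/dZ. *)
Definition se_dS : F := ev1 p^`() / (N%:R * S ^+ N.-1).

Lemma se_natr_neq0 : N%:R != 0 :> F.
Proof. by rewrite -(rmorph_nat iota) fmorph_eq0 (se_exp M). Qed.

Let dS_den : N%:R * S ^+ N.-1 != 0 :> F.
Proof. by rewrite mulf_neq0 ?se_natr_neq0 ?expf_neq0 ?(se_S_neq0 M). Qed.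

Let dd a : F := eval2 iota S Z (swapXY a)^`() + ev2 a^`() * se_dS.

Let ddD a b : dd (a + b) = dd a + dd b.
Proof. by rewrite /dd !(derivD, rmorphD) /= mulrDl addrACA. Qed.

Let ddM a b : dd (a * b) = ev2 a * dd b + ev2 b * dd a.
Proof.
rewrite /dd !(derivM, rmorphM, rmorphD) /= !eval2_swap; ring.
Qed.

(** On a multiple q f, [dd] equals [ev2 q] times [dd f], and [dd f], the derivative of S^N - p(Z)
    along the curve, is zero by the choice of [se_dS]. Hence [dd a] depends only on [ev2 a]. *)
Let dd_eq0 a : ev2 a = 0 -> dd a = 0.
Proof.
move=> /(se_kernel M)[q ->]; rewrite ddM (eval2_se_poly M) mul0r addr0.
suff -> : dd f = 0 by rewrite mulr0.
rewrite /dd /se_poly !derivB derivC subr0 derivXn.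
have -> : swapXY ('X^N - p%:P) = ('X ^+ N)%:P - p^:P.
  by rewrite raddfB /= swapXY_polyC [swapXY _]rmorphXn /= swapXY_X polyC_exp.
rewrite derivB derivC sub0r deriv_map /= eval2N -swapXY_polyC eval2_swap eval2C.
rewrite rmorphMn rmorphXn /= eval2X /se_dS -mulr_natl mulrC divfK //.
by rewrite addNr.
Qed.

(** This is d/dZ, obtained by the quotient rule on fractions of representatives. Equal fractions
    give the same result because [dd] kills the cross difference a b' - a' b. *)
Lemma se_derivation :
  exists D : F -> F^o, is_derivation iota D /\ D Z = 1.
Proof.
pose dq a b : F := (dd a * ev2 b - ev2 a * dd b) / ev2 b ^+ 2.
have ddB a b : dd (a - b) = dd a - dd b.
  by apply/eqP; rewrite eq_sym subr_eq -ddD subrK.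
have dqE a b a' b' : ev2 b != 0 -> ev2 b' != 0 ->
    ev2 a / ev2 b = ev2 a' / ev2 b' -> dq a b = dq a' b'.
  move=> b0 b0' /eqP; rewrite eqr_div // => /eqP abE.
  have /dd_eq0 : ev2 (a * b' - a' * b) = 0 by rewrite eval2B !rmorphM /= abE subrr.
  rewrite ddB !ddM => dE; rewrite /dq; apply/eqP.
  rewrite eqr_div ?expf_neq0 // -subr_eq0; apply/eqP.
  (* [ev2 a] and [dd a] are solved for; after substitution the two quotient rules agree
     identically. *)
  have aE : ev2 a = ev2 a' * ev2 b / ev2 b' by rewrite -abE mulfK.
  have daE : dd a = (ev2 a' * dd b + ev2 b * dd a' - ev2 a * dd b') / ev2 b'.
    apply: (mulIf b0'); rewrite divfK //; apply/eqP.
    by rewrite -subr_eq0 -[X in _ == X]dE; apply/eqP; ring.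
  by rewrite daE aE; field.
have [D DE] : exists D : F -> F, forall a b, ev2 b != 0 -> D (ev2 a / ev2 b) = dq a b.
  have : forall x, exists y, forall a b, ev2 b != 0 -> x = ev2 a / ev2 b -> y = dq a b.
    move=> x; have [a [b [b0 xE]]] := se_gen M x; exists (dq a b) => a' b' b0' xE'.
    by apply: dqE => //; rewrite -xE.
  by move=> /choice[D DE]; exists D => a b b0; apply: DE.
have dd1 : dd 1 = 0.
  by rewrite /dd rmorph1 -polyC1 !derivC !rmorph0 mul0r addr0.
have DE1 a : D (ev2 a) = dd a.
  have := DE a 1; rewrite rmorph1 divr1 oner_eq0 => -> //.
  by rewrite /dq dd1 rmorph1 mulr0 subr0 mulr1 expr1n divr1.
exists D; split; last first.
  rewrite -[X in D X](eval1X iota Z) -(eval2C _ _ S) DE1 /dd derivC rmorph0 mul0r addr0.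
  by rewrite swapXY_polyC map_polyX derivX rmorph1.
split=> [x y|x y|c].
- have [a [b [b0 ->]]] := se_gen M x; have [a' [b' [b0' ->]]] := se_gen M y.
  rewrite addf_div // -!rmorphM -rmorphD !DE ?rmorphM ?mulf_neq0 // /dq.
  by rewrite !(ddD, ddM, rmorphM, rmorphD) /=; field; rewrite ?b0 ?b0'.
- have [a [b [b0 ->]]] := se_gen M x; have [a' [b' [b0' ->]]] := se_gen M y.
  rewrite mulf_div // -!rmorphM !DE ?rmorphM ?mulf_neq0 // /dq.
  by rewrite !(ddD, ddM, rmorphM, rmorphD) /= /GRing.scale /=; field; rewrite ?b0 ?b0'.
- rewrite -(eval1C iota Z) -(eval2C _ _ S) DE1 /dd derivC rmorph0 mul0r addr0.
  by rewrite swapXY_polyC map_polyC derivC rmorph0.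
Qed.

Definition se_der : F -> F := projT1 (cid se_derivation).

Lemma se_derP : is_derivation iota (se_der : F -> F^o).
Proof. by rewrite /se_der; case: cid => D []. Qed.

Lemma se_derZ : se_der Z = 1.
Proof. by rewrite /se_der; case: cid => D []. Qed.

Lemma derivation_S (L : lmodType F) (delta : F -> L) :
  is_derivation iota delta -> delta S = se_dS *: delta Z.
Proof.
move=> dP; have := derivation_eval1 dP Z p; rewrite -(se_eqn M) (derivationX dP).
move=> /(congr1 (fun v => (N%:R * S ^+ N.-1)^-1 *: v)).
by rewrite !scalerA mulVf // scale1r mulrC.
Qed.

(** The value on Z forces the one on S through S^N = p(Z), and F = K(Z, S). *)
Lemma derivation_der (L : lmodType F) (delta : F -> L) (x : F) :
  is_derivation iota delta -> delta x = se_der x *: delta Z.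
Proof.
move=> dP; have key a : delta (ev2 a) = se_der (ev2 a) *: delta Z.
  rewrite (derivation_eval2 dP) (derivation_eval2 se_derP).
  rewrite (derivation_S dP) (derivation_S se_derP) se_derZ.
  by rewrite !scale_regE !mulr1 scalerDl !scalerA.
have [a [b [b0 ->]]] := se_gen M x.
rewrite (derivation_quot dP _ b0) (derivation_quot se_derP _ b0) !key.
by rewrite !scale_regE !scalerA -scalerBl scalerA.
Qed.

Lemma diff_der x : diff iota x = se_der x *: diff iota Z.
Proof. exact/derivation_der/diff_is_derivation. Qed.

(** The linear form that the universal property attaches to [se_der] sends dZ to 1. *)
Lemma diffZ_scale_inj (g h : F) : g *: diff iota Z = h *: diff iota Z -> g = h.
Proof.
have [phi phiE] := diff_universal se_derP.
move=> /(congr1 phi); rewrite !linearZ /= phiE se_derZ.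
by rewrite !scale_regE !mulr1.
Qed.

Lemma differential_der (w : differential iota) : exists g, w = g *: diff iota Z.
Proof.
have [s ->] := diff_span w; exists (\sum_(u <- s) u.1 * se_der u.2).
by rewrite scaler_suml; apply: eq_bigr => u _; rewrite -scalerA -diff_der.
Qed.

End Derivation.

(** * Places centered at a smooth point *)

Lemma root_sub (R : comNzRingType) (q : {poly R}) x :
  exists r, q = r * ('X - x%:P) + q.[x]%:P.
Proof.
have : root (q - q.[x]%:P) x by rewrite rootE !hornerE subrr.
by move=> /factor_theorem[r rE]; exists r; rewrite -rE subrK.
Qed.

Section PlaceTheory.
Context {K F : fieldType} {iota : {rmorphism K -> F}} {v : F -> int}.
Hypothesis pv : place iota v.

Lemma placeM x y : x != 0 -> y != 0 -> v (x * y) = v x + v y.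
Proof. by case: pv => vM _ _ _; apply: vM. Qed.

Lemma placeC c : c != 0 -> v (iota c) = 0.
Proof. by case: pv => _ _ vC _; apply: vC. Qed.

Lemma place1 : v 1 = 0.
Proof. by rewrite -(rmorph1 iota) placeC // oner_eq0. Qed.

Lemma placeN x : x != 0 -> v (- x) = v x.
Proof.
move=> x0; rewrite -mulN1r placeM ?oppr_eq0 ?oner_eq0 //.
by rewrite -(rmorphN1 iota) placeC ?oppr_eq0 ?oner_eq0 // add0r.
Qed.

Lemma placeV x : x != 0 -> v x^-1 = - v x.
Proof.
move=> x0; apply/eqP; rewrite -addr_eq0 -placeM ?invr_eq0 //.
by rewrite mulVf // place1.
Qed.

Lemma placeX x k : x != 0 -> v (x ^+ k) = v x *+ k.
Proof.
move=> x0; elim: k => [|k IHk]; first by rewrite expr0 place1 mulr0n.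
by rewrite exprS placeM ?expf_neq0 // IHk mulrS.
Qed.

Lemma placeZ x (k : int) : x != 0 -> v (x ^ k) = v x * k.
Proof.
move=> x0; case: k => k.
  by rewrite -exprnP placeX // -mulr_natr natz.
rewrite NegzE -exprnN placeV ?expf_neq0 // placeX // -mulr_natr natz.
by rewrite mulrN.
Qed.

(* Place valuations are irrelevant at 0, so 0 is allowed explicitly. *)
Definition vge (k : int) (x : F) : Prop := x = 0 \/ k <= v x.

Lemma vge0 k : vge k 0. Proof. by left. Qed.

Lemma vgeP k x : x != 0 -> vge k x -> k <= v x.
Proof. by move=> /negPf x0 [/eqP|//]; rewrite x0. Qed.

Lemma vgeD k x y : vge k x -> vge k y -> vge k (x + y).
Proof.
move=> [->|kx]; first by rewrite add0r.
move=> [->|ky]; first by rewrite addr0; right.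
have [->|x0] := eqVneq x 0; first by rewrite add0r; right.
have [->|y0] := eqVneq y 0; first by rewrite addr0; right.
have [->|xy0] := eqVneq (x + y) 0; first by left.
right; case: pv => _ vD _ _; apply: le_trans (vD _ _ x0 y0 xy0).
by rewrite le_min kx.
Qed.

Lemma vgeM k l x y : vge k x -> vge l y -> vge (k + l) (x * y).
Proof.
move=> [->|kx]; first by rewrite mul0r; left.
move=> [->|ly]; first by rewrite mulr0; left.
have [->|x0] := eqVneq x 0; first by rewrite mul0r; left.
have [->|y0] := eqVneq y 0; first by rewrite mulr0; left.
by right; rewrite placeM // lerD.
Qed.

Lemma vgeN k x : vge k x -> vge k (- x).
Proof.
have [->|x0] := eqVneq x 0; first by rewrite oppr0.
by move=> /(vgeP x0) kx; right; rewrite placeN.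
Qed.

Lemma vgeB k x y : vge k x -> vge k y -> vge k (x - y).
Proof. by move=> kx /vgeN; apply: vgeD. Qed.

Lemma vgeC c : vge 0 (iota c).
Proof.
by have [->|c0] := eqVneq c 0; [left; rewrite rmorph0|right; rewrite placeC].
Qed.

Lemma vgeW k l x : l <= k -> vge k x -> vge l x.
Proof. by move=> lk [->|kx]; [left|right; apply: le_trans kx]. Qed.

Lemma vgeM0 x y : vge 0 x -> vge 0 y -> vge 0 (x * y).
Proof. exact: vgeM. Qed.

Lemma vgeX x k : vge 0 x -> vge 0 (x ^+ k).
Proof.
move=> x0; elim: k => [|k IHk]; last by rewrite exprS; apply: vgeM0.
by rewrite expr0 -(rmorph1 iota); apply: vgeC.
Qed.

Lemma vge_sum k I (r : seq I) (P : pred I) (G : I -> F) :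
  (forall i, P i -> vge k (G i)) -> vge k (\sum_(i <- r | P i) G i).
Proof. by move=> Gk; apply: big_ind => //; [exact: vge0|move=> x y; apply: vgeD]. Qed.

Lemma vge_eval1 Z q : vge 0 Z -> vge 0 (eval1 iota Z q).
Proof.
move=> Z0; elim/poly_ind: q => [|q c IHq]; first by rewrite rmorph0; left.
rewrite rmorphD rmorphM /= eval1X eval1C.
by apply: vgeD; [apply: vgeM0|apply: vgeC].
Qed.

Lemma vge_eval2 Z S a : vge 0 Z -> vge 0 S -> vge 0 (eval2 iota Z S a).
Proof.
move=> Z0 S0; elim/poly_ind: a => [|a q IHa]; first by rewrite rmorph0; left.
rewrite rmorphD rmorphM /= eval2X eval2C.
by apply: vgeD; [apply: vgeM0|apply: vge_eval1].
Qed.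

Lemma vge_residue_unit x c : c != 0 -> vge 1 (x - iota c) -> x != 0 /\ v x = 0.
Proof.
move=> c0 xc; have x0 : x != 0.
  apply/eqP => x0; move: xc; rewrite x0 sub0r => /vgeP.
  by rewrite oppr_eq0 fmorph_eq0 => /(_ c0); rewrite placeN ?fmorph_eq0 ?placeC.
split=> //; apply/eqP; rewrite eq_le; apply/andP; split; last first.
  apply: (vgeP x0); rewrite -[x](subrK (iota c)); apply: vgeD; last exact: vgeC.
  by apply: vgeW xc.
rewrite leNgt; apply/negP => vx.
have : vge 1 (iota c) by rewrite -[iota c](subKr x); apply: vgeB => //; right; rewrite -gtz0_ge1.
by move=> /vgeP; rewrite fmorph_eq0 placeC // => /(_ c0).
Qed.

(** Two divisions write a(Z, S) - a(al, ga) as r(Z, S) (S - ga) + q(Z) (Z - al), with polynomial and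
    hence regular r and q. *)
Lemma vge_point Z S al ga a : vge 1 (Z - iota al) -> vge 1 (S - iota ga) ->
  vge 1 (eval2 iota Z S a - iota a.[ga, al]).
Proof.
move=> Zal Sga.
have reg1 x c : vge 1 (x - iota c) -> vge 0 x.
  move=> xc; rewrite -[x](subrK (iota c)); apply: vgeD; last exact: vgeC.
  exact: vgeW xc.
have [r ->] := root_sub a ga%:P; have [q ->] := root_sub a.[ga%:P] al.
rewrite rmorphD rmorphM /= eval2B eval2X !eval2C !hornerE rmorphD rmorphM /=.
rewrite eval1B eval1X !eval1C subrr mulr0 add0r subrr mulr0 add0r addrA addrK.
apply: vgeD; rewrite -[1]add0r; apply: vgeM => //.
  by apply: vge_eval2; [apply: reg1 Zal|apply: reg1 Sga].
by apply: vge_eval1; apply: reg1 Zal.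
Qed.

Lemma vge_point_unit Z S al ga a : vge 1 (Z - iota al) -> vge 1 (S - iota ga) ->
  a.[ga, al] != 0 -> v (eval2 iota Z S a) = 0.
Proof.
move=> Zal Sga aP.
by have [] := vge_residue_unit aP (vge_point a Zal Sga).
Qed.

End PlaceTheory.

(** * The local ring of the curve at a point *)

Section LocalRing.
Context {K F : fieldType} (iota : {rmorphism K -> F}).
Context (Z S : F) (al ga : K).
Local Notation ev2 := (eval2 iota Z S).

Definition local_reg (x : F) : Prop :=
  exists a b, b.[ga, al] != 0 /\ x = ev2 a / ev2 b.

Definition local_unit (x : F) : Prop :=
  exists a b, [/\ a.[ga, al] != 0, b.[ga, al] != 0 & x = ev2 a / ev2 b].

Lemma local_unit_reg x : local_unit x -> local_reg x.
Proof. by move=> [a [b [_ b0 ->]]]; exists a, b. Qed.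

(** Evaluation at the point is well defined on K[Z, S], which holds on the curve by [se_point]. A
    denominator that does not vanish at the point is then nonzero in F. *)
Hypothesis point_wd : forall a, ev2 a = 0 -> a.[ga, al] = 0.

Let ev_neq0 a : a.[ga, al] != 0 -> ev2 a != 0.
Proof. by apply: contra_neq => /point_wd. Qed.

Lemma local_unit_neq0 x : local_unit x -> x != 0.
Proof.
by move=> [a [b [a0 b0 ->]]]; rewrite mulf_neq0 ?invr_eq0 ?ev_neq0.
Qed.

Lemma local_unitV x : local_unit x -> local_unit x^-1.
Proof. by move=> [a [b [a0 b0 ->]]]; exists b, a; rewrite invf_div. Qed.

Lemma local_unitM x y : local_unit x -> local_unit y -> local_unit (x * y).
Proof.
move=> [a [b [a0 b0 ->]]] [a' [b' [a0' b0' ->]]]; exists (a * a'), (b * b').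
by rewrite !hornerM !mulf_neq0 // !rmorphM /= mulf_div.
Qed.

Lemma local_regM x y : local_reg x -> local_reg y -> local_reg (x * y).
Proof.
move=> [a [b [b0 ->]]] [a' [b' [b0' ->]]]; exists (a * a'), (b * b').
by rewrite !hornerM !mulf_neq0 // !rmorphM /= mulf_div.
Qed.

Lemma local_regD x y : local_reg x -> local_reg y -> local_reg (x + y).
Proof.
move=> [a [b [b0 ->]]] [a' [b' [b0' ->]]]; exists (a * b' + a' * b), (b * b').
by rewrite !hornerM !mulf_neq0 // addf_div ?ev_neq0 // rmorphD !rmorphM.
Qed.

Lemma local_reg_eval a : local_reg (ev2 a).
Proof. by exists a, 1; rewrite rmorph1 divr1 !hornerC oner_eq0. Qed.

Lemma local_unit_eval a : a.[ga, al] != 0 -> local_unit (ev2 a).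
Proof. by exists a, 1; rewrite rmorph1 divr1 !hornerC oner_eq0. Qed.

Lemma local_unit1 : local_unit 1.
Proof.
by rewrite -(rmorph1 (eval2 iota Z S)); apply: local_unit_eval; rewrite !hornerC oner_eq0.
Qed.

Lemma local_unitX x k : local_unit x -> local_unit (x ^+ k).
Proof.
move=> ux; elim: k => [|k IHk]; first exact: local_unit1.
by rewrite exprS; apply: local_unitM.
Qed.

Lemma local_regN x : local_reg x -> local_reg (- x).
Proof.
by move=> [a [b [b0 ->]]]; exists (- a), b; rewrite eval2N mulNr.
Qed.

Lemma local_unit_iota c : c != 0 -> local_unit (iota c).
Proof.
move=> c0; rewrite -(eval1C iota Z) -(eval2C iota Z S); apply: local_unit_eval.
by rewrite !hornerC.
Qed.

End LocalRing.

(** * The discrete valuation attached to a local parameter *)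

Section LocalPoint.
Context {K : closedFieldType} {F : fieldType} {iota : {rmorphism K -> F}}.
Context {N : nat} {p : {poly K}} {Z S : F}.
Hypothesis M : superelliptic iota N p Z S.
Local Notation ev1 := (eval1 iota Z).
Local Notation ev2 := (eval2 iota Z S).

(* t = tau(Z, S) generates the maximal ideal of the point (al, ga), and dt
   generates the differentials that are regular there. *)
Record local_parameter (al ga : K) (tau : {poly {poly K}}) (e : nat) : Prop :=
  LocalParameter {
    lp_point : ga ^+ N = p.[al];
    lp_tau : tau.[ga, al] = 0;
    lp_e : (0 < e)%N;
    lp_Z : exists2 u, local_unit iota Z S al ga u & Z - iota al = ev2 tau ^+ e * u;
    lp_S : exists2 r, local_reg iota Z S al ga r & S - iota ga = ev2 tau * r;
    lp_dZ : exists2 r, local_reg iota Z S al ga r & 1 = r * se_der M (ev2 tau);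
    lp_dS : exists2 r, local_reg iota Z S al ga r &
      se_dS (iota := iota) (N := N) (p := p) (Z := Z) (S := S) = r * se_der M (ev2 tau)
  }.

Context {al ga : K} {tau : {poly {poly K}}} {e : nat}.
Hypothesis P : local_parameter al ga tau e.
Local Notation t := (ev2 tau).
Local Notation unit := (local_unit iota Z S al ga).
Local Notation reg := (local_reg iota Z S al ga).

Lemma lp_wd a : ev2 a = 0 -> a.[ga, al] = 0.
Proof.
by rewrite -(rmorph0 ev2) => /(se_point M (lp_point P)) ->; rewrite !horner0.
Qed.

Lemma lp_Z_neq0 : Z - iota al != 0.
Proof. by rewrite subr_eq0 (se_trans M). Qed.

Lemma lp_t_neq0 : t != 0.
Proof.
have [u uu tE] := lp_Z P; have := lp_Z_neq0; rewrite tE.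
by apply: contra_neq => ->; rewrite expr0n gtn_eqF ?(lp_e P) // mul0r.
Qed.

Lemma lp_nonunit x : reg x -> t * x != 1.
Proof.
move=> [a [b [b0 ->]]]; have eb0 : ev2 b != 0 by apply: contra_neq b0; apply: lp_wd.
apply/eqP => tab; have : ev2 (tau * a) = ev2 b.
  by rewrite rmorphM /= -[RHS]mul1r -tab mulrA divfK.
move=> /(se_point M (lp_point P)); rewrite !hornerM (lp_tau P) mul0r => bP.
by rewrite -bP eqxx in b0.
Qed.

Lemma lp_eval a : exists2 r, reg r & ev2 a = iota a.[ga, al] + t * r.
Proof.
have [r aE] := root_sub a ga%:P; have [q qE] := root_sub a.[ga%:P] al.
have [u uu tZ] := lp_Z P; have [s rs tS] := lp_S P.
exists (ev2 r * s + ev1 q * (t ^+ e.-1 * u)).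
  apply: (local_regD lp_wd); apply: local_regM => //; try exact: local_reg_eval.
    by rewrite -(eval2C iota Z S); apply: local_reg_eval.
  apply: local_regM => //; last exact: local_unit_reg.
  by rewrite -rmorphXn; apply: local_reg_eval.
rewrite {1}aE {1}qE rmorphD rmorphM /= eval2B eval2X !eval2C rmorphD rmorphM /=.
have te : t ^+ e = t * t ^+ e.-1 by rewrite -exprS (prednK (lp_e P)).
rewrite eval1B eval1X !eval1C tS tZ te; ring.
Qed.

(** By [lp_eval] a numerator that vanishes at the point is a multiple of t, so t generates the
    maximal ideal. *)
Lemma lp_reg_dec x : reg x -> unit x \/ exists2 y, reg y & x = t * y.
Proof.
move=> [a [b [b0 xE]]]; have [a0|a0] := eqVneq a.[ga, al] 0; last first.
  by left; exists a, b.
have [r rr aE] := lp_eval a; right; exists (r / ev2 b).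
  apply: local_regM => //; apply: local_unit_reg; apply: local_unitV.
  exact: local_unit_eval.
by rewrite xE aE a0 rmorph0 add0r mulrA.
Qed.

Lemma lp_eval1_factor c : c != 0 -> exists k u, unit u /\ ev1 c = t ^+ k * u.
Proof.
have [u uu tZ] := lp_Z P.
have [n] := ubnP (size c); elim: n c => // n IHn c szc c0.
have [cal|cal] := eqVneq c.[al] 0; last first.
  exists 0%N, (ev1 c); rewrite expr0 mul1r; split=> //.
  by rewrite -(eval2C iota Z S); apply: local_unit_eval; rewrite hornerC.
have [c1 c1E] := factor_theorem _ _ (introT eqP cal : root c al).
have c10 : c1 != 0 by apply: contra_neq c0 => c10; rewrite c1E c10 mul0r.
have [|k [w [uw wE]]] := IHn c1 _ c10.
  by move: szc; rewrite c1E size_Mmonic ?monicXsubC // size_XsubC addn2 ltnS.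
exists (k + e)%N, (w * u); split; first exact: local_unitM.
by rewrite c1E rmorphM /= eval1B eval1X eval1C tZ wE exprD; ring.
Qed.

(* a divides a nonzero polynomial in Z, that is t^k times a unit, so t cannot
   divide a more than k times. *)
Lemma lp_eval_factor a : ev2 a != 0 -> exists k u, unit u /\ ev2 a = t ^+ k * u.
Proof.
move=> a0; have [b [c [c0 baE]]] := eval2_dvd_eval1 M a0.
have [k [w [uw cE]]] := lp_eval1_factor c0.
have dec j : (exists i u, unit u /\ ev2 a = t ^+ i * u) \/
    exists2 y, reg y & ev2 a = t ^+ j * y.
  elim: j => [|j [|[y ry aE]]]; first by right; exists (ev2 a); [exact: local_reg_eval|rewrite mul1r].
    by left.
  have [uy|[y' ry' yE]] := lp_reg_dec ry; first by left; exists j, y.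
  by right; exists y' => //; rewrite aE yE exprSr mulrA.
have [//|[y ry aE]] := dec k.+1.
have tk0 : t ^+ k != 0 by rewrite expf_neq0 ?lp_t_neq0.
have w0 := local_unit_neq0 lp_wd uw.
suff /negP[] : t * (ev2 b * y / w) != 1.
  apply/eqP/(mulfI tk0)/(mulIf w0); rewrite mulr1 -cE -baE aE exprSr.
  by rewrite !mulrA divfK //; ring.
apply: lp_nonunit; apply: local_regM; last exact/local_unit_reg/local_unitV.
by apply: local_regM => //; apply: local_reg_eval.
Qed.

Lemma lp_factor x : x != 0 -> exists (k : int) u, unit u /\ x = t ^ k * u.
Proof.
have [a [b [b0 ->]]] := se_gen M x; rewrite mulf_eq0 invr_eq0 negb_or => /andP[a0 _].
have [k [u [uu ->]]] := lp_eval_factor a0; have [l [w [uw ->]]] := lp_eval_factor b0.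
exists (k%:Z - l%:Z), (u / w); split.
  by apply: local_unitM => //; apply: local_unitV.
rewrite expfzDr ?lp_t_neq0 // -exprnN -exprnP invfM; ring.
Qed.

(** A negative exponent would make t invertible in the local ring, against [lp_nonunit]. *)
Lemma lp_factor_reg (k : int) u : unit u -> reg (t ^ k * u) -> 0 <= k.
Proof.
case: k => // k uu rtu; rewrite NegzE in rtu *.
have t0 := lp_t_neq0; have u0 := local_unit_neq0 lp_wd uu.
suff /negP[] : t * (t ^+ k * (t ^ (- k.+1%:Z) * u) / u) != 1.
  by rewrite -exprnN -[_ / u]mulrA mulfK // mulrA -exprS mulfV // expf_neq0.
apply: lp_nonunit; apply: local_regM; last exact/local_unit_reg/local_unitV.
by apply: local_regM => //; rewrite -rmorphXn; apply: local_reg_eval.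
Qed.

Lemma lp_factor_uniq (k l : int) u w : unit u -> unit w ->
  t ^ k * u = t ^ l * w -> k = l.
Proof.
have t0 := lp_t_neq0.
have le i j a b : unit a -> unit b -> t ^ i * a = t ^ j * b -> j <= i.
  move=> ua ub; have a0 := local_unit_neq0 lp_wd ua.
  move=> ijE; rewrite -subr_ge0; apply: (lp_factor_reg ua).
  rewrite expfzDr // mulrAC ijE mulrAC -expfzDr // subrr expr0z mul1r.
  exact: local_unit_reg.
by move=> uu uw E; apply/eqP; rewrite eq_le (le _ _ _ _ uu uw E) (le _ _ _ _ uw uu (esym E)).
Qed.

(** The valuation is the exponent of t in [lp_factor], well defined by [lp_factor_uniq]. *)
Lemma place_exists : exists v, [/\ place iota v, 0 < v (Z - iota al),
  forall r, reg r -> vge (v := v) 0 r & v t = 1].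
Proof.
have t0 := lp_t_neq0.
have [v vE] : exists v : F -> int, forall x, x != 0 ->
    exists2 u, unit u & x = t ^ (v x) * u.
  have : forall x, exists k : int, x != 0 -> exists2 u, unit u & x = t ^ k * u.
    move=> x; have [x0|x0] := eqVneq x 0; first by exists 0.
    by have [k [u [uu xE]]] := lp_factor x0; exists k => _; exists u.
  by move=> /choice[v vE]; exists v.
have vtu (k : int) u : unit u -> v (t ^ k * u) = k.
  move=> uu; have tu0 : t ^ k * u != 0.
    by rewrite mulf_neq0 ?expfz_neq0 // (local_unit_neq0 lp_wd uu).
  by have [w uw tuE] := vE _ tu0; apply/esym/(lp_factor_uniq uu uw).
have u1 := local_unit1 iota Z S al ga.
have vt : v t = 1 by rewrite -[in LHS](mulr1 t) -{1}(expr1z t) vtu.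
have vreg r : reg r -> vge (v := v) 0 r.
  move=> rr; have [r0|r0] := eqVneq r 0; [by left|right].
  have [u uu rE] := vE _ r0; apply: (lp_factor_reg uu); by rewrite -rE.
have vM x y : x != 0 -> y != 0 -> v (x * y) = v x + v y.
  move=> x0 y0; have [u uu xE] := vE _ x0; have [w uw yE] := vE _ y0.
  by rewrite {1}xE {1}yE mulrACA -expfzDr // vtu //; apply: local_unitM.
have pv : place iota v.
  split=> //; last by exists t.
    (* Ultrametric inequality: divided by t to the smaller exponent, both terms lie in the local
       ring, hence so does their sum. *)
    have aux x y : x != 0 -> y != 0 -> x + y != 0 -> v x <= v y -> v x <= v (x + y).
      move=> x0 y0 xy0 xy; have [u uu xE] := vE _ x0; have [w uw yE] := vE _ y0.
      have [z uz zE] := vE _ xy0; rewrite -subr_ge0; apply: (lp_factor_reg uz).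
      have -> : t ^ (v (x + y) - v x) * z = u + t ^ (v y - v x) * w.
        apply: (mulfI (expfz_neq0 (v x) t0)); rewrite mulrDr !mulrA -!expfzDr //.
        by rewrite ![v x + _]addrC !subrK -zE -xE -yE.
      apply: (local_regD lp_wd); first exact: local_unit_reg.
      apply: local_regM; last exact: local_unit_reg.
      move: xy; rewrite -subr_ge0; case: (v y - v x) => // k _.
      by rewrite -exprnP -rmorphXn; apply: local_reg_eval.
    move=> x y x0 y0 xy0; have [xy|yx] := leP (v x) (v y); first exact: aux.
    by rewrite addrC; apply: aux; rewrite // 1?addrC // ltW.
  move=> c c0; rewrite -[in LHS](mul1r (iota c)) -(expr0z t) vtu //.
  exact: local_unit_iota.
exists v; split=> //; have [u uu ->] := lp_Z P.
by rewrite exprnP vtu // ltz_nat (lp_e P).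
Qed.

End LocalPoint.

Section PlaceAtPoint.
Context {K : closedFieldType} {F : fieldType} {iota : {rmorphism K -> F}}.
Context {N : nat} {p : {poly K}} {Z S : F}.
Hypothesis M : superelliptic iota N p Z S.
Local Notation ev1 := (eval1 iota Z).
Local Notation ev2 := (eval2 iota Z S).
Context {al ga : K} {tau : {poly {poly K}}} {e : nat}.
Hypothesis P : local_parameter M al ga tau e.
Local Notation t := (ev2 tau).
Local Notation unit := (local_unit iota Z S al ga).
Local Notation reg := (local_reg iota Z S al ga).

Lemma lp_place_exists : exists v, [/\ place iota v,
  vge (v := v) 1 (Z - iota al) & vge (v := v) 1 (S - iota ga)].
Proof.
have [v [pv vZ vr vt]] := place_exists P; exists v; split=> //.
  by right; rewrite -gtz0_ge1.
have [r rr ->] := lp_S P; rewrite -[1]addr0; apply: (vgeM pv); last exact: vr.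
by right; rewrite vt.
Qed.

Lemma lp_der_reg x : reg x -> exists2 r, reg r & se_der M x = r * se_der M t.
Proof.
have [rZ rrZ dZ] := lp_dZ P; have [rS rrS dS] := lp_dS P.
have wd := lp_wd P.
have key a : exists2 r, reg r & se_der M (ev2 a) = r * se_der M t.
  have := derivation_eval2 (se_derP M) Z S a.
  rewrite (derivation_S M (se_derP M)) !scale_regE (se_derZ M) dS => ->.
  rewrite -[eval2 _ S Z _]eval2_swap.
  exists (ev2 (swapXY (swapXY a)^`()) * rZ + ev2 a^`() * rS); last by rewrite mulrDl -!mulrA -dZ !mulr1.
  by apply: (local_regD wd); apply: local_regM => //; apply: local_reg_eval.
move=> [a [b [b0 ->]]]; have eb0 : ev2 b != 0 by apply: contra_neq b0; apply: wd.
have := derivation_quot (se_derP M) (ev2 a) eb0; rewrite !scale_regE => ->.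
have [r rr ->] := key a; have [s rs ->] := key b.
exists ((ev2 b)^-1 ^+ 2 * (ev2 b * r - ev2 a * s)); last by rewrite exprVn; ring.
apply: local_regM.
  by apply/local_unit_reg/local_unitX/local_unitV/local_unit_eval.
apply: (local_regD wd); last apply: local_regN.
  by apply: local_regM => //; apply: local_reg_eval.
by apply: local_regM => //; apply: local_reg_eval.
Qed.

Context {v : F -> int}.
Hypotheses (pv : place iota v) (vZ : vge (v := v) 1 (Z - iota al))
  (vS : vge (v := v) 1 (S - iota ga)).

Let vZ0 : vge (v := v) 0 Z.
Proof.
by rewrite -[Z](subrK (iota al)); apply: (vgeD pv) (vgeC pv _); apply: vgeW vZ.
Qed.

Let vS0 : vge (v := v) 0 S.
Proof.
by rewrite -[S](subrK (iota ga)); apply: (vgeD pv) (vgeC pv _); apply: vgeW vS.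
Qed.

Lemma lp_place_unit u : unit u -> v u = 0.
Proof.
move=> uu; have u0 := local_unit_neq0 (lp_wd P) uu.
move: uu u0 => [a [b [a0 b0 ->]]]; rewrite mulf_eq0 invr_eq0 negb_or => /andP[ea eb].
rewrite (placeM pv) ?invr_eq0 // (placeV pv) //.
by rewrite !(vge_point_unit pv vZ vS) // subrr.
Qed.

Lemma lp_place_reg x : reg x -> vge (v := v) 0 x.
Proof.
move=> [a [b [b0 ->]]]; rewrite -[0]addr0; apply: (vgeM pv).
  exact: vge_eval2.
have eb : ev2 b != 0 by apply: contra_neq b0; apply: (lp_wd P).
by right; rewrite (placeV pv) // (vge_point_unit pv vZ vS) ?oppr0.
Qed.

(** [tau] vanishes at the point, so v t > 0. An element of value 1 exists and has the form t^k u
    with u a unit, so v t divides 1. *)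
Lemma lp_place_t : v t = 1.
Proof.
have t0 := lp_t_neq0 P.
have vt : 0 < v t.
  have := vge_point pv tau vZ vS; rewrite (lp_tau P) rmorph0 subr0 => /(vgeP t0).
  by rewrite -gtz0_ge1.
have [_ _ _ [s [s0 vs]]] := pv; have [k [u [uu sE]]] := lp_factor P s0.
have u0 := local_unit_neq0 (lp_wd P) uu.
move: vs; rewrite sE (placeM pv) ?expfz_neq0 // (placeZ pv) // (lp_place_unit uu) addr0.
move=> /(congr1 absz)/eqP; rewrite abszM muln_eq1 => /andP[/eqP vt1 _].
by rewrite -(gtz0_abs vt) vt1.
Qed.

(** [holomorphic_at] allows any uniformizer t'. It is t times a unit, so dt' is a regular multiple
    of dt, and a regular coefficient of dt' yields a regular one of dt. *)
Lemma lp_holomorphic_at h :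
  holomorphic_at v (h *: diff iota t) <-> vge (v := v) 0 h.
Proof.
split=> [[t' [g [t'0 vt' hE g0]]]|h0]; last first.
  by exists t, h; split=> //; [exact: (lp_t_neq0 P)|exact: lp_place_t].
have [k [u [uu t'E]]] := lp_factor P t'0.
have k1 : k = 1.
  move: vt'; rewrite t'E (placeM pv) ?expfz_neq0 ?(lp_t_neq0 P) ?(local_unit_neq0 (lp_wd P) uu) //.
  by rewrite (placeZ pv) ?(lp_t_neq0 P) // (lp_place_unit uu) lp_place_t addr0 mul1r.
have rt' : reg t'.
  rewrite t'E k1 expr1z; apply: local_regM; last exact: local_unit_reg.
  exact: local_reg_eval.
have [r rr dt'] := lp_der_reg rt'.
move: hE; rewrite !(diff_der M t, diff_der M t') !scalerA => /(diffZ_scale_inj M).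
rewrite dt' mulrA => /mulIf hE.
have -> : h = g * r.
  (* [lp_dZ] reads 1 = s dt/dZ, so dt/dZ is nonzero and can be cancelled. *)
  apply: hE; have [s _ sE] := lp_dZ P; apply/eqP => dt0.
  by move/eqP: sE; rewrite dt0 mulr0 oner_eq0.
by apply: (vgeM0 pv) => //; apply: lp_place_reg.
Qed.

End PlaceAtPoint.

(** * Local parameters at unramified and ramified points *)

Section SmoothPoints.
Context {K : closedFieldType} {F : fieldType} {iota : {rmorphism K -> F}}.
Context {N : nat} {p : {poly K}} {Z S : F}.
Hypothesis M : superelliptic iota N p Z S.
Local Notation ev1 := (eval1 iota Z).
Local Notation ev2 := (eval2 iota Z S).
Let N_gt0 : (0 < N)%N := charf_exp_gt0 (se_exp M).

Lemma ev1_eval2 q : ev1 q = ev2 q%:P. Proof. by rewrite eval2C. Qed.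

Lemma se_der_shift c x : se_der M (x - iota c) = se_der M x.
Proof.
have [dD _ dC] := se_derP M.
by rewrite -rmorphN dD dC addr0.
Qed.

Lemma horner2_polyC (q : {poly K}) al ga : (q^:P).[ga, al] = q.[ga].
Proof. by rewrite horner_map /= hornerC. Qed.

Lemma eval2_polyP (q : {poly K}) : ev2 q^:P = eval1 iota S q.
Proof. by rewrite -swapXY_polyC eval2_swap eval2C. Qed.

Lemma horner2_polyCC (q : {poly K}) al ga : q%:P.[ga, al] = q.[al].
Proof. by rewrite hornerC. Qed.

Lemma deriv_root_sub (q r : {poly K}) x :
  q = r * ('X - x%:P) + q.[x]%:P -> r.[x] = q^`().[x].
Proof.
move=> qE; rewrite qE derivD derivM derivXsubC derivC addr0 mulr1 hornerD hornerM.
by rewrite hornerXsubC subrr mulr0 add0r.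
Qed.

Lemma horner_derivXn N' (x : K) : ('X^N')^`().[x] = N'%:R * x ^+ N'.-1.
Proof. by rewrite derivXn hornerMn hornerXn mulr_natl. Qed.

Lemma unramified_parameter al ga : ga != 0 -> ga ^+ N = p.[al] ->
  local_parameter M al ga ('X - al%:P)%:P 1.
Proof.
move=> ga0 gaN.
have tE : ev2 ('X - al%:P)%:P = Z - iota al by rewrite eval2C eval1B eval1X eval1C.
have dt : se_der M (ev2 ('X - al%:P)%:P) = 1 by rewrite tE se_der_shift se_derZ.
have Nga : N%:R * ga ^+ N.-1 != 0 by rewrite mulf_neq0 ?(se_exp M) ?expf_neq0.
split=> //.
- by rewrite horner2_polyCC hornerXsubC subrr.
- by exists 1; [exact: local_unit1|rewrite tE expr1 mulr1].
(* Divided differences: Q(S) (S - ga) = S^N - ga^N = p(Z) - p(al) = R(Z) (Z - al), where Q(ga) = N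
   ga^(N-1) is nonzero. *)
- have [Q QE] := root_sub ('X^N : {poly K}) ga; have [R RE] := root_sub p al.
  have Qga : (Q^:P).[ga, al] != 0.
    by rewrite horner2_polyC (deriv_root_sub QE) horner_derivXn.
  have QR : ev2 Q^:P * (S - iota ga) = (Z - iota al) * ev2 R%:P.
    have := congr1 (eval1 iota S) QE; have := congr1 ev1 RE.
    rewrite !(rmorphD, rmorphM, rmorphXn) /= !eval1N !eval1X !eval1C hornerXn.
    rewrite -(se_eqn M) gaN eval2C eval2_polyP => -> /addIr <-; ring.
  have Q0 : ev2 Q^:P != 0.
    by apply: contra_neq Qga => Q0; rewrite (se_point M gaN (etrans Q0 (esym (rmorph0 _)))) !horner0.
  exists (ev2 R%:P / ev2 Q^:P).
    apply: local_regM; first exact: local_reg_eval.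
    exact/local_unit_reg/local_unitV/local_unit_eval.
  by rewrite tE mulrA -QR mulrC mulKf.
- by exists 1; [exact/local_unit_reg/local_unit1|rewrite dt mulr1].
- exists (se_dS (iota := iota) (N := N) (p := p) (Z := Z) (S := S)); last by rewrite dt mulr1.
  rewrite /se_dS ev1_eval2; apply: local_regM; first exact: local_reg_eval.
  apply/local_unit_reg/local_unitV.
  have -> : N%:R * S ^+ N.-1 = ev2 ('X^N)^`()^:P.
    by rewrite eval2_polyP derivXn rmorphMn rmorphXn /= eval1X mulr_natl.
  by apply: local_unit_eval; rewrite horner2_polyC horner_derivXn.
Qed.

(** Here S^N = (Z - al) R(Z), and R(al) is the nonzero derivative of p at al: S is a parameter and
    the ramification index over Z is N. *)
Lemma ramified_parameter al : p.[al] = 0 -> p^`().[al] != 0 ->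
  local_parameter M al 0 'X N.
Proof.
move=> pal dpal; have [R RE] := root_sub p al.
have Ral := deriv_root_sub RE; rewrite pal addr0 in RE.
have gaN : 0 ^+ N = p.[al] by rewrite pal expr0n gtn_eqF.
have neq0 (q : {poly K}) : q.[al] != 0 -> ev1 q != 0.
  move=> q0; rewrite (eval1_eq0 _ (se_trans M)).
  by apply: contra_neq q0 => ->; rewrite horner0.
have dSE : se_der M S = se_dS (iota := iota) (N := N) (p := p) (Z := Z) (S := S).
  by have := derivation_S M (se_derP M); rewrite scale_regE se_derZ mulr1.
have u1 := local_unit1 iota Z S al 0.
split=> //.
- by rewrite hornerX hornerC.
- exists (ev1 R)^-1.
    by rewrite ev1_eval2; apply/local_unitV/local_unit_eval; rewrite horner2_polyCC Ral.
  have R0 : ev1 R != 0 by rewrite neq0 // Ral.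
  rewrite eval2X (se_eqn M) RE rmorphM /= eval1B eval1X eval1C.
  by rewrite mulrC mulKf.
- by exists 1; [exact: local_unit_reg|rewrite rmorph0 subr0 eval2X mulr1].
- exists (N%:R * S ^+ N.-1 / ev1 p^`()).
    apply: local_regM; last first.
      apply/local_unit_reg/local_unitV; rewrite ev1_eval2; apply: local_unit_eval.
      by rewrite horner2_polyCC.
    have -> : N%:R * S ^+ N.-1 = ev2 ('X^N)^`()^:P.
      by rewrite eval2_polyP derivXn rmorphMn rmorphXn /= eval1X mulr_natl.
    exact: local_reg_eval.
  rewrite eval2X dSE /se_dS mulrA divfK ?neq0 // mulfV //.
  by rewrite mulf_neq0 ?(se_natr_neq0 M) ?expf_neq0 ?(se_S_neq0 M).
- by exists 1; [exact: local_unit_reg|rewrite eval2X dSE mul1r].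
Qed.

End SmoothPoints.

(** * Separating elements and the kernel of the Cartier operator *)

Section PthPower.
Context {R : idomainType} {l : nat}.
Hypothesis charl : l \in [pchar R].

Lemma pchar_exprD (x y : R) : (x + y) ^+ l = x ^+ l + y ^+ l.
Proof. by apply: exprDn_pchar; rewrite pnatE ?(pcharf_prime charl). Qed.

Lemma pchar_expr_sum I (r : seq I) (P : pred I) (G : I -> R) :
  (\sum_(i <- r | P i) G i) ^+ l = \sum_(i <- r | P i) G i ^+ l.
Proof.
apply: (big_morph (fun x => x ^+ l)) => //; first exact: pchar_exprD.
by rewrite expr0n gtn_eqF ?prime_gt0 ?(pcharf_prime charl).
Qed.

(** The constant coefficient is peeled off: q = X^l q' + c^l, where q' = [drop_poly l q] satisfies
    the same hypotheses, and raising to the l-th power is additive. *)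
Lemma poly_pth_power (q : {poly R}) :
  (forall i, exists c, q`_i = c ^+ l) -> (forall i, ~~ (l %| i)%N -> q`_i = 0) ->
  exists r, q = r ^+ l.
Proof.
have l_gt0 : (0 < l)%N by rewrite prime_gt0 ?(pcharf_prime charl).
have [n] := ubnP (size q); elim: n q => // n IHn q szq qp qi.
have [q0|q0] := eqVneq q 0; first by exists 0; rewrite q0 expr0n gtn_eqF.
have [|||r rE] := IHn (drop_poly l q).
- rewrite size_drop_poly; apply: leq_trans (_ : size q <= n)%N => //.
  by rewrite ltn_subrL l_gt0 lt0n size_poly_eq0.
- by move=> i; rewrite coef_drop_poly.
- by move=> i li; rewrite coef_drop_poly qi // dvdn_addl.
have [c cE] := qp 0%N; exists (r * 'X + c%:P).
have charP : l \in [pchar {poly R}] by rewrite pchar_poly.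
rewrite exprDn_pchar ?pnatE ?(pcharf_prime charl) // exprMn -rE -polyC_exp -cE.
apply/polyP => i; rewrite coefD coefMXn coefC coef_drop_poly.
have [->|i0] := eqVneq i 0%N; first by rewrite l_gt0 add0r.
have [il|li] := ltnP i l; last by rewrite addr0 subnK.
by rewrite addr0 qi // gtnNdvd // lt0n.
Qed.

Lemma poly_deriv0_coef (q : {poly R}) : q^`() = 0 ->
  forall i, ~~ (l %| i)%N -> q`_i = 0.
Proof.
move=> dq [|i]; first by rewrite dvdn0.
rewrite (dvdn_pcharf charl) => i0; have := coef_deriv q i; rewrite dq coef0.
by move=> /esym/eqP; rewrite -mulr_natr mulf_eq0 (negPf i0) orbF => /eqP.
Qed.

End PthPower.

Section Separating.
Context {K : closedFieldType} {F : fieldType} {iota : {rmorphism K -> F}}.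
Context {N : nat} {p : {poly K}} {Z S : F} {l : nat}.
Hypothesis M : superelliptic iota N p Z S.
Hypothesis charl : l \in [pchar K].
Local Notation ev1 := (eval1 iota Z).

Lemma closed_pth_root (c : K) : exists d, c = d ^+ l.
Proof.
have l_gt0 : (0 < l)%N by rewrite prime_gt0 ?(pcharf_prime charl).
have [|d dE] := closed_rootP ('X^l - c%:P : {poly K}) _.
  by rewrite size_XnsubC // eqSS gtn_eqF.
by exists d; move: dE; rewrite rootE !hornerE subr_eq0 => /eqP.
Qed.

Lemma poly_deriv0_pth_power (q : {poly K}) : q^`() = 0 -> exists r, q = r ^+ l.
Proof.
move=> dq; apply: (poly_pth_power charl).
  by move=> i; apply: closed_pth_root.
exact: (poly_deriv0_coef charl).
Qed.

(* The relation a of minimal degree satisfied by z is separable: otherwise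
   b = lc(a)^(l-1) * a, whose leading coefficient is an l-th power, has zero
   derivative in both variables by minimality, hence is an l-th power. *)
Lemma separating_se : separating iota Z.
Proof.
move=> z.
have l_gt0 : (0 < l)%N by rewrite prime_gt0 ?(pcharf_prime charl).
pose ev := eval2 iota Z z.
pose Q k := `[< exists b : {poly {poly K}}, [/\ b != 0, size b = k & ev b = 0] >].
have exQ : exists k, Q k.
  have [a a0 az] := se_algebraic M z.
  by exists (size a); apply/asboolP; exists a.
case: (ex_minnP exQ) => k /asboolP[a [a0 sza eva]] kmin.
have mina (r : {poly {poly K}}) : (size r < k)%N -> ev r = 0 -> r = 0.
  move=> szr evr; apply/eqP; apply: contraTT szr => r0.
  by rewrite -leqNgt; apply: kmin; apply/asboolP; exists r.
have k1 : (1 < k)%N.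
  rewrite ltnNge; apply/negP => k1; have aC : a = (a`_0)%:P.
    by apply: size1_polyC; rewrite sza.
  move: eva; rewrite aC /ev eval2C => /eqP; rewrite (eval1_eq0 _ (se_trans M)).
  by move=> /eqP a00; move: a0; rewrite aC a00 eqxx.
have charKX : l \in [pchar {poly K}] by rewrite pchar_poly.
have da0 : a^`() != 0.
  apply/eqP => da; pose b := (lead_coef a ^+ l.-1) *: a.
  have lc0 : lead_coef a ^+ l.-1 != 0 by rewrite expf_neq0 // lead_coef_eq0.
  have szb : size b = k by rewrite size_scale.
  have evb : ev b = 0 by rewrite /ev eval2Z -/ev eva mulr0.
  have db : b^`() = 0 by rewrite derivZ da scaler0.
  (* [bX] is b differentiated coefficientwise in Z. Differentiating b(Z, z) = 0 shows that z is a
     root of [bX], and its degree drops because the leading coefficient of b is an l-th power. *)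
  pose bX := swapXY (swapXY b)^`().
  have bXi i : bX`_i = (b`_i)^`().
    by apply/polyP => j; rewrite coef_swapXY !coef_deriv coefMn coef_swapXY.
  have bX0 : bX = 0.
    apply: mina; last first.
      have := derivation_eval2 (se_derP M) Z z b.
      rewrite -/ev evb db !scale_regE /ev rmorph0 mul0r addr0 se_derZ mulr1.
      by rewrite (derivation0 (se_derP M)) -eval2_swap.
    rewrite -(prednK (ltnW k1)) ltnS; apply/leq_sizeP => j; rewrite leq_eqVlt bXi.
    case/predU1P => [<-|kj]; last first.
      by rewrite nth_default ?deriv0 // szb -(prednK (ltnW k1)).
    rewrite coefZ -sza -lead_coefE -exprSr (prednK l_gt0) deriv_exp.
    by rewrite -mulr_natr (pcharf0 charKX) mulr0.
  have bi i : exists c, b`_i = c ^+ l.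
    apply: poly_deriv0_pth_power.
    by rewrite -bXi bX0 coef0.
  have [r rE] := poly_pth_power charKX bi (poly_deriv0_coef charKX db).
  have evr : ev r = 0.
    have : ev r ^+ l == 0 by rewrite /ev -rmorphXn /= -rE -/ev evb.
    by rewrite expf_eq0 l_gt0 => /eqP.
  have := congr1 (fun q : {poly {poly K}} => (size q).-1) rE.
  rewrite size_exp szb => kE; have r0 : r = 0.
    apply: mina => //; have := prime_gt1 (pcharf_prime charl).
    move: kE k1; clear; case: (size r) => [|s] /=; first by rewrite mul0n; lia.
    case: s => [|s] kE k1 l1; first by rewrite mul0n in kE; lia.
    by have := leq_mul (leqnn s.+1) l1; lia.
  by move: kE k1; rewrite r0 size_poly0 mul0n; clear; lia.
exists (map_poly ev1 a); split.
- move=> i; rewrite coef_map /=; exists (a`_i), 1.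
  by rewrite rmorph1 hornerC oner_eq0 divr1.
(* A nonconstant gcd of [a] and its derivative contradicts minimality: z is a root of the gcd or of
   its cofactor, both of size below k. *)
- rewrite unlock; have g1 : (size (gcdp a a^`()) <= 1)%N.
    rewrite leqNgt; apply/negP => szg.
    have gz : ev (gcdp a a^`()) = 0.
      have [[c h] /= c0 aE] := Pdiv.Idomain.dvdpP _ _ (dvdp_gcdl a a^`()).
      have h0 : h != 0.
        apply: contra_neq a0 => h0; apply/eqP.
        by move/eqP: aE; rewrite h0 mul0r scale_poly_eq0 (negPf c0).
      have g0 : gcdp a a^`() != 0 by rewrite -size_poly_eq0 -lt0n ltnW.
      have szh : (size h < k)%N.
        have := congr1 (fun q : {poly {poly K}} => size q) aE.
        rewrite size_scale // size_mul // sza => ->.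
        by move: szg; clear; lia.
      move/(congr1 ev): aE; rewrite /ev eval2Z -[eval2 _ _ _ a]/(ev a) eva mulr0 rmorphM /=.
      move=> /esym/eqP; rewrite mulf_eq0 => /orP[/eqP hz|/eqP//].
      by rewrite (mina _ szh hz) eqxx in h0.
    have szg' : (size (gcdp a a^`()) < k)%N.
      apply: leq_ltn_trans (leq_gcdpr a da0) _; rewrite -sza.
      exact: lt_size_deriv.
    by rewrite (mina _ szg' gz) size_poly0 in szg.
  have [[u w] /=] := Pdiv.Idomain.Bezoutp a a^`().
  rewrite (size1_polyC g1) => /eqpP[[c1 c2] /= /andP[c10 c20] uwE].
  have gc : (gcdp a a^`())`_0 != 0.
    by rewrite -polyC_eq0 -(size1_polyC g1) gcdp_eq0 negb_and a0.
  apply/Bezout_coprimepP; exists (map_poly ev1 (c1 *: u), map_poly ev1 (c1 *: w)).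
  rewrite /= deriv_map -!rmorphM -rmorphD /= -!scalerAl -scalerDr uwE.
  rewrite map_polyZ map_polyC /= -size_poly_eq1 size_scale; last first.
    by rewrite (eval1_eq0 _ (se_trans M)).
  by rewrite size_polyC (eval1_eq0 _ (se_trans M)) gc.
- by rewrite rootE; apply/eqP.
Qed.
End Separating.

Lemma prime_ndvd_fact q k : prime q -> (k < q)%N -> ~~ (q %| k`!)%N.
Proof.
move=> qP; elim: k => [|k IHk] kq.
  by rewrite fact0 dvdn1 neq_ltn orbC prime_gt1.
by rewrite factS Euclid_dvdM // negb_or gtnNdvd // IHk // ltnW.
Qed.

(** * Iterates of a derivation *)

Section IteratedDerivation.
Context {K F : fieldType} {iota : {rmorphism K -> F}} {E : F -> F}.
Hypothesis der : is_derivation iota (E : F -> F^o).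

Lemma derD x y : E (x + y) = E x + E y. Proof. by case: der. Qed.
Lemma derM x y : E (x * y) = x * E y + y * E x. Proof. by case: der. Qed.
Lemma derC c : E (iota c) = 0. Proof. by case: der. Qed.

Lemma der_sum I (r : seq I) (P : pred I) (G : I -> F) :
  E (\sum_(i <- r | P i) G i) = \sum_(i <- r | P i) E (G i).
Proof. exact: (derivation_sum der). Qed.

Lemma der_natr n : E n%:R = 0.
Proof. by rewrite -(rmorph_nat iota) derC. Qed.

Lemma derX x k : E (x ^+ k) = k%:R * x ^+ k.-1 * E x.
Proof. by have := derivationX der x k; rewrite scale_regE. Qed.

Lemma iter_derD k x y : iter k E (x + y) = iter k E x + iter k E y.
Proof. by elim: k => //= k ->; rewrite derD. Qed.

Lemma iter_der_sum k I (r : seq I) (P : pred I) (G : I -> F) :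
  iter k E (\sum_(i <- r | P i) G i) = \sum_(i <- r | P i) iter k E (G i).
Proof. by elim: k => //= k ->; rewrite der_sum. Qed.

Lemma iter_der_constM k c x : E c = 0 -> iter k E (c * x) = c * iter k E x.
Proof. by move=> c0; elim: k => //= k ->; rewrite derM c0 mulr0 addr0. Qed.

Lemma iter_derM k x y : iter k E (x * y) =
  \sum_(i < k.+1) 'C(k, i)%:R * (iter i E x * iter (k - i) E y).
Proof.
elim: k => [|k IHk]; first by rewrite big_ord1 bin0 mul1r.
rewrite iterS IHk der_sum.
have eqE (i : 'I_k.+1) : E ('C(k, i)%:R * (iter i E x * iter (k - i) E y)) =
    'C(k, i)%:R * (iter i E x * iter (k.+1 - i) E y)
    + 'C(k, i)%:R * (iter i.+1 E x * iter (k - i) E y).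
  rewrite (subSn (leq_ord i)) !iterS derM der_natr mulr0 addr0 derM mulrDr.
  by rewrite (mulrC (iter (k - i) E y)).
rewrite (eq_bigr _ (fun i _ => eqE i)) big_split /=.
rewrite [in RHS]big_ord_recl [X in X + _]big_ord_recl !bin0 -addrA; congr (_ + _).
rewrite [RHS](eq_bigr (fun i : 'I_k.+1 =>
    'C(k, i.+1)%:R * (iter i.+1 E x * iter (k - i) E y)
    + 'C(k, i)%:R * (iter i.+1 E x * iter (k - i) E y))); last first.
  by move=> i _; rewrite !lift0 binS natrD mulrDl subSS.
rewrite big_split /=; congr (_ + _).
by rewrite [RHS]big_ord_recr /= bin_small // mul0r addr0.
Qed.

Lemma iter_der_pchar l x y : l \in [pchar F] ->
  iter l E (x * y) = x * iter l E y + y * iter l E x.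
Proof.
move=> charl; have := prime_gt0 (pcharf_prime charl).
case: l charl => // l charl _; rewrite iter_derM big_ord_recl bin0 mul1r subn0.
congr (_ + _); rewrite big_ord_recr lift0 binn subnn mul1r big1 => [|i _].
  by rewrite /= add0r mulrC.
by rewrite lift0 (bin_lt_pcharf_0 charl) ?mul0r //= ltnS ltn_ord.
Qed.

Lemma iter_der_exp t k i : E t = 1 ->
  iter k E (t ^+ i) = (i ^_ k)%:R * t ^+ (i - k).
Proof.
move=> Et; elim: k => [|k IHk]; first by rewrite ffactn0 mul1r subn0.
rewrite iterS IHk derM der_natr mulr0 addr0 derX Et mulr1 ffactnSr natrM.
by rewrite -mulrA subnS.
Qed.

End IteratedDerivation.

(** * The kernel of the Cartier operator *)

Section CartierKernel.
Context {K : closedFieldType} {F : fieldType} {iota : {rmorphism K -> F}}.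
Context {N : nat} {p : {poly K}} {Z S : F} {l : nat}.
Hypothesis M : superelliptic iota N p Z S.
Hypothesis charl : l \in [pchar K].
Local Notation D := (se_der M).

Lemma pchar_ext : l \in [pchar F].
Proof. by rewrite (fmorph_pchar iota). Qed.

Let l_gt0 : (0 < l)%N.
Proof. by rewrite prime_gt0 ?(pcharf_prime charl). Qed.

Lemma der_quot_derivation t : is_derivation iota ((fun x => D x / D t) : F -> F^o).
Proof.
have dP := se_derP M; split=> [x y|x y|c].
- by rewrite (derD dP) mulrDl.
- by rewrite !scale_regE (derM dP); ring.
- by rewrite (derC dP) mul0r.
Qed.

(* In characteristic l the l-th iterate of a derivation is a derivation; this
   one kills t, hence everything. *)
Lemma iter_der_quot_eq0 t x : D t != 0 -> iter l (fun x => D x / D t) x = 0.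
Proof.
move=> dt0; pose E x := D x / D t; have EP := der_quot_derivation t.
have Et : E t = 1 by rewrite /E divff.
have Ec c : E (iota c) = 0 by rewrite /E (derC (se_derP M)) mul0r.
have E0 k : iter k E 0 = 0 by elim: k => //= k ->; rewrite -[X in E X](rmorph0 iota) Ec.
have [k lE] : exists k, l = k.+2.
  by have := prime_gt1 (pcharf_prime charl); case: (l) => [|[|k]] // _; exists k.
have ElP : is_derivation iota (iter l E : F -> F^o).
  split=> [y z|y z|c].
  - exact: (iter_derD EP).
  - by rewrite (iter_der_pchar EP _ _ pchar_ext).
  - by rewrite lE iterSr Ec E0.
have Elt : iter l E t = 0.
  by rewrite lE !iterSr Et -[X in E X](rmorph1 iota) Ec E0.
have := derivation_der M t ElP; rewrite Elt scale_regE => /esym/eqP.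
rewrite mulf_eq0 (negPf dt0) /= => /eqP ElZ.
by have := derivation_der M x ElP; rewrite ElZ scale_regE mulr0.
Qed.

(** Otherwise D kills K(t). Differentiating q(Z) = 0, with q separable over K(t), then gives q'(Z) =
    0, a common root of q and q'. *)
Lemma separating_der_neq0 t : separating iota t -> D t != 0.
Proof.
move=> sep_t; apply/eqP => dt; have dP := se_derP M.
have [q [qr qs /rootP qZ]] := sep_t Z.
have dr z : in_rational_subfield iota t z -> D z = 0.
  move=> [a [b [b0 ->]]]; have := derivation_quot dP (eval1 iota t a) b0.
  rewrite !(derivation_eval1 dP) !scale_regE => ->.
  by rewrite dt !mulr0 subr0 mulr0.
have dq : D q.[Z] = q^`().[Z].
  rewrite horner_coef (der_sum dP) -[in RHS](coefK q) poly_def linear_sum /= horner_sum.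
  apply: eq_bigr => i _; rewrite derivZ derivXn hornerZ hornerMn hornerXn.
  by rewrite (derM dP) (dr _ (qr i)) mulr0 addr0 (derX dP) se_derZ mulr1 mulr_natl.
have : root (gcdp q q^`()) Z.
  rewrite root_gcd /root qZ eqxx /= -dq qZ -[X in D X](rmorph0 iota).
  by rewrite (derC dP).
have g1 : gcdp q q^`() %= 1 by rewrite gcdp_eqp1; rewrite unlock in qs.
by rewrite (eqp_root g1) (negPf (root1 _)).
Qed.

(** E kills l-th powers. Its iterate E^(l-1) kills t^i for i < l-1 and sends t^(l-1) to (l-1)!, so
    it isolates the coefficient that defines the Cartier operator. *)
Lemma iter_der_expansion (E : F -> F) t (x : nat -> F) :
  is_derivation iota (E : F -> F^o) -> E t = 1 ->
  iter l.-1 E (\sum_(i < l) x i ^+ l * t ^+ i) = x l.-1 ^+ l * (l.-1)`!%:R.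
Proof.
move=> EP Et; have El y : E (y ^+ l) = 0.
  by rewrite (derX EP) (pcharf0 pchar_ext) !mul0r.
rewrite (iter_der_sum EP); under eq_bigr do
  rewrite (iter_der_constM EP) // (iter_der_exp EP) //.
rewrite -(prednK l_gt0) big_ord_recr /= big1 ?add0r => [|i _]; last first.
  by rewrite ffact_small ?mul0r ?mulr0.
by rewrite ffactnn subnn mulr1 (prednK l_gt0).
Qed.

Lemma fact_pred_neq0 : (l.-1)`!%:R != 0 :> F.
Proof.
rewrite -(dvdn_pcharf pchar_ext).
by rewrite prime_ndvd_fact ?ltn_predL ?(pcharf_prime charl).
Qed.

(** Let E = d/dt. For i < l-1 the power t^i has an antiderivative, since i+1 is invertible.
    Conversely E^(l-1) maps E g to E^l g = 0 and isolates the last coefficient. Exactness is a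
    property of the differential alone, free of t. *)
Lemma graph_exact t (x : nat -> F) : D t != 0 ->
  x l.-1 = 0 <-> exists g,
    (\sum_(i < l) x i ^+ l * t ^+ i) *: diff iota t = diff iota g.
Proof.
move=> dt0; pose E y := D y / D t.
have EP : is_derivation iota (E : F -> F^o) := der_quot_derivation t.
have Et : E t = 1 by rewrite /E divff.
have El y : E (y ^+ l) = 0.
  by rewrite (derX EP) (pcharf0 pchar_ext) !mul0r.
have exactE h : (exists g, h *: diff iota t = diff iota g) <-> exists g, h = E g.
  split=> -[g hg]; exists g.
    move: hg; rewrite !(diff_der M t, diff_der M g) scalerA => /(diffZ_scale_inj M) hE.
    by rewrite /E -hE mulfK.
  by rewrite hg /E !(diff_der M t, diff_der M g) scalerA divfK.
rewrite exactE; split=> [x0|[g gE]].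
  exists (\sum_(i < l) x i ^+ l * (iota i.+1%:R^-1 * t ^+ i.+1)).
  rewrite (der_sum EP); apply: eq_bigr => i _; rewrite (derM EP) El mulr0 addr0.
  have [il|il] := eqVneq (i : nat) l.-1.
    by rewrite il x0 expr0n gtn_eqF // !mul0r.
  rewrite (derM EP) (derC EP) mulr0 addr0 (derX EP) Et mulr1; congr (_ * _).
  rewrite mulrA -(rmorph_nat iota) -rmorphM mulVf ?rmorph1 ?mul1r // -(dvdn_pcharf charl) gtnNdvd //.
  by move: (ltn_ord i) il l_gt0; clear; lia.
have : iter l E g = 0 := iter_der_quot_eq0 g dt0.
rewrite -{1}(prednK l_gt0) iterSr -gE.
rewrite (iter_der_expansion x EP Et) => /eqP.
by rewrite mulf_eq0 (negPf fact_pred_neq0) orbF expf_eq0 l_gt0 => /eqP.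
Qed.

(** [xget] returns a value for some unknown t, or its default 0 if the relation is empty. The
    expansion in Z excludes the second case, and exactness removes t. *)
Lemma cartier_eq0 (w : differential iota) :
  (exists x : nat -> F, w = (\sum_(i < l) x i ^+ l * Z ^+ i) *: diff iota Z) ->
  cartier l w = 0 <-> exists g, w = diff iota g.
Proof.
move=> [x wE]; have exw : exists w', cartier_graph l w w'.
  exists (x l.-1 *: diff iota Z), Z, x; split=> //.
  exact: separating_se M charl.
rewrite /cartier; have [t [y [st -> ->]]] := xgetPex 0 exw.
have dt0 := separating_der_neq0 st.
rewrite -(graph_exact y dt0); split=> [|->]; last by rewrite scale0r.
rewrite (diff_der M t) scalerA -[in RHS](scale0r (diff iota Z)).
move=> /(diffZ_scale_inj M)/eqP; rewrite mulf_eq0 (negPf dt0) orbF.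
by move/eqP.
Qed.

Lemma cartier_eq0_iter (h : F) :
  (exists x : nat -> F, h = \sum_(i < l) x i ^+ l * Z ^+ i) ->
  cartier l (h *: diff iota Z) = 0 <-> iter l.-1 D h = 0.
Proof.
move=> [x hE]; have dZ : D Z != 0 by rewrite se_derZ oner_eq0.
rewrite cartier_eq0; last by exists x; rewrite -hE.
rewrite hE -(graph_exact x dZ) (iter_der_expansion x (se_derP M) (se_derZ M)).
split=> [->|/eqP]; first by rewrite expr0n gtn_eqF // mul0r.
by rewrite mulf_eq0 (negPf fact_pred_neq0) orbF expf_eq0 l_gt0 => /eqP.
Qed.

(** Constants are l-th powers, and Z^k is an l-th power times Z^(k mod l). This supplies the
    expansion required by [cartier_eq0_iter]. *)
Lemma pth_expansion (I : finType) (y : I -> F) (q : I -> {poly K}) :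
  exists x : nat -> F,
    \sum_i y i ^+ l * eval1 iota Z (q i) = \sum_(i < l) x i ^+ l * Z ^+ i.
Proof.
pose ex h := exists x : nat -> F, h = \sum_(i < l) x i ^+ l * Z ^+ i.
have ex0 : ex 0.
  exists (fun=> 0); rewrite big1 // => i _.
  by rewrite expr0n gtn_eqF // mul0r.
have exD g h : ex g -> ex h -> ex (g + h).
  move=> [x ->] [x' ->]; exists (fun i => x i + x' i).
  rewrite -big_split /=; apply: eq_bigr => i _.
  by rewrite (pchar_exprD pchar_ext) mulrDl.
rewrite -/(ex _); apply: (big_ind ex) => // i _.
rewrite -[q i]coefK poly_def rmorph_sum mulr_sumr; apply: (big_ind ex) => // k _.
rewrite /= eval1Z rmorphXn /= eval1X; have [d ->] := closed_pth_root charl (q i)`_k.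
exists (fun j => if j == (k %% l)%N then y i * iota d * Z ^+ (k %/ l) else 0).
rewrite (bigD1 (Ordinal (ltn_pmod k l_gt0))) //= eqxx big1 ?addr0; last first.
  by move=> j /negPf jk; rewrite -val_eqE /= in jk; rewrite jk expr0n gtn_eqF // mul0r.
by rewrite !exprMn rmorphXn -!mulrA -exprM -exprD -divn_eq.
Qed.

End CartierKernel.

(** * Places of the Fermat function field *)

Section Residues.
Context {K : closedFieldType} {F : fieldType} {iota : {rmorphism K -> F}}.
Context {v : F -> int}.
Hypothesis pv : place iota v.

(** q splits into linear factors; if x - c had value 0 for every root c, so would q(x). *)
Lemma vge1_root x (q : {poly K}) : transcendental iota x -> vge (v := v) 0 x -> q != 0 ->
  vge (v := v) 1 (eval1 iota x q) -> exists2 c, q.[c] = 0 & vge (v := v) 1 (x - iota c).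
Proof.
move=> trx x0 q0; have [r qE] := closed_field_poly_normal q.
have xc c : x - iota c != 0 by rewrite subr_eq0 trx.
have lq : lead_coef q != 0 by rewrite lead_coef_eq0.
have [[c cr xc1]|nr] := EM (exists2 c, c \in r & vge (v := v) 1 (x - iota c)).
  move=> _; exists c => //; rewrite qE hornerZ; apply/eqP.
  by rewrite mulf_eq0 orbC -rootE root_prod_XsubC cr.
have v0 c : c \in r -> v (x - iota c) = 0.
  move=> cr; apply/eqP; rewrite eq_le; apply/andP; split.
    by rewrite leNgt; apply/negP => vc; apply: nr; exists c => //; right; rewrite -gtz0_ge1.
  by apply: (vgeP (xc c)); apply: (vgeB pv x0); apply: (vgeC pv).
have [p0 vp] : eval1 iota x (\prod_(z <- r) ('X - z%:P)) != 0 /\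
    v (eval1 iota x (\prod_(z <- r) ('X - z%:P))) = 0.
  rewrite rmorph_prod /=; move: v0; clear -xc pv; elim: r => [|c r IHr] v0.
    by rewrite big_nil oner_eq0 (place1 pv).
  have [|i0 vi] := IHr; first by move=> z zr; apply: v0; rewrite inE zr orbT.
  rewrite big_cons eval1B eval1X eval1C mulf_neq0 //; split=> //.
  by rewrite (placeM pv) // vi v0 ?mem_head.
rewrite qE eval1Z => /vgeP; rewrite mulf_neq0 ?fmorph_eq0 // => /(_ isT).
by rewrite (placeM pv) ?fmorph_eq0 // vp (placeC pv).
Qed.

Lemma vge_expP k x N : (0 < N)%N -> vge (v := v) k (x ^+ N) -> x != 0 -> k <= v x *+ N.
Proof. by move=> N0 xk x0; rewrite -(placeX pv) //; apply: vgeP; rewrite ?expf_neq0. Qed.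

Lemma vge_exp0 x N : (0 < N)%N -> vge (v := v) 0 (x ^+ N) -> vge (v := v) 0 x.
Proof.
move=> N0 xN; have [->|x0] := eqVneq x 0; [by left|right].
by have := vge_expP N0 xN x0; rewrite pmulrn_lge0.
Qed.

Lemma vge_exp1 x N : (0 < N)%N -> vge (v := v) 1 (x ^+ N) -> vge (v := v) 1 x.
Proof.
move=> N0 xN; have [->|x0] := eqVneq x 0; [by left|right].
have := vge_expP N0 xN x0; rewrite -!gtz0_ge1.
by rewrite pmulrn_lgt0.
Qed.

End Residues.

Section Center.
Context {K : closedFieldType} {F : fieldType} {iota : {rmorphism K -> F}}.
Context {N : nat} {p : {poly K}} {Z S : F}.
Hypothesis M : superelliptic iota N p Z S.
Context {v : F -> int}.
Hypothesis pv : place iota v.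

Let N_gt0 : (0 < N)%N := charf_exp_gt0 (se_exp M).

Lemma se_S_trans : transcendental iota S.
Proof.
move=> c; apply/eqP => Sc; have := se_eqn M; rewrite Sc -rmorphXn => /esym/eqP.
rewrite -(eval1C iota Z) -subr_eq0 -eval1B (eval1_eq0 _ (se_trans M)) subr_eq0.
move=> /eqP pE; have [b _] := se_root M.
by rewrite pE derivC horner0 eqxx.
Qed.

Lemma se_center : vge (v := v) 0 Z -> exists al ga, [/\ ga ^+ N = p.[al],
  vge (v := v) 1 (Z - iota al) & vge (v := v) 1 (S - iota ga)].
Proof.
move=> Z0; have S0 : vge (v := v) 0 S.
  by apply: (vge_exp0 pv N_gt0); rewrite (se_eqn M); apply: vge_eval1.
(* Otherwise v is zero on all nonzero elements of K[Z], hence of K[Z, S], each of which divides one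
   of them, and v could not take the value 1. *)
have [q q0 vq] : exists2 q, q != 0 & vge (v := v) 1 (eval1 iota Z q).
  apply: contrapT => nq.
  have v0 q : q != 0 -> v (eval1 iota Z q) = 0.
    move=> q0; apply/eqP; rewrite eq_le; apply/andP; split.
      by rewrite leNgt; apply/negP => vq; apply: nq; exists q => //; right; rewrite -gtz0_ge1.
    by apply: vgeP; [rewrite (eval1_eq0 _ (se_trans M))|apply: vge_eval1].
  have ve a : eval2 iota Z S a != 0 -> v (eval2 iota Z S a) = 0.
    move=> a0; have [u [c [c0 uaE]]] := eval2_dvd_eval1 M a0.
    have c0' : eval1 iota Z c != 0 by rewrite (eval1_eq0 _ (se_trans M)).
    have u0 : eval2 iota Z S u != 0.
      by apply: contra_neq c0' => u0; rewrite -uaE u0 mul0r.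
    have := v0 c c0; rewrite -uaE (placeM pv) // => uv.
    have := vgeP a0 (vge_eval2 pv a Z0 S0); have := vgeP u0 (vge_eval2 pv u Z0 S0).
    by move: uv; clear; move: (v _) (v _) => x y; lia.
  have [_ _ _ [s [s0 vs]]] := pv; have [a [b [b0 sE]]] := se_gen M s.
  move: s0 vs; rewrite sE mulf_eq0 invr_eq0 negb_or => /andP[a0 _].
  by rewrite (placeM pv) ?invr_eq0 // (placeV pv) // !ve.
have [al _ Zal] := vge1_root pv (se_trans M) Z0 q0 vq.
have XN0 : ('X^N - p.[al]%:P : {poly K}) != 0.
  by rewrite monic_neq0 // monicXnsubC.
have [|ga gaN Sga] := vge1_root pv se_S_trans S0 XN0.
  rewrite eval1B rmorphXn /= eval1X eval1C (se_eqn M).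
  have [r rE] := root_sub p al; rewrite {1}rE rmorphD rmorphM /= eval1B eval1X !eval1C addrK.
  rewrite -[1]add0r; apply: (vgeM pv) => //; exact: vge_eval1.
exists al, ga; split=> //; move: gaN; rewrite !hornerE => /eqP.
by rewrite subr_eq0 => /eqP.
Qed.

End Center.

(** * The affine model and the model at infinity *)

Section FermatModels.
Context {K : closedFieldType} {F : fieldType} {iota : {rmorphism K -> F}}.
Context {n m : nat} {U V : F}.
Hypotheses (n_neq0 : n%:R != 0 :> K) (m_neq0 : m%:R != 0 :> K).
Hypothesis fermat : fermat_function_field iota n m U V.

Let n_gt0 : (0 < n)%N := charf_exp_gt0 n_neq0.
Let m_gt0 : (0 < m)%N := charf_exp_gt0 m_neq0.

Lemma fermat_eqn : V ^+ m = - (U ^+ n + 1).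
Proof.
have [UV _ _] := fermat; apply/eqP; rewrite -subr_eq0 opprK -UV.
by apply/eqP; ring.
Qed.

Lemma fermat_U_trans : transcendental iota U.
Proof.
move=> c; apply/eqP => Uc; have [_ trU _] := fermat; apply: trU.
exists ('X - c%:P); first by rewrite polyXsubC_eq0.
by rewrite rmorphB /= map_polyX map_polyC /= Uc root_XsubC.
Qed.

Definition affine_poly : {poly K} := - ('X^n + 1).

Lemma affine_poly_simple al : affine_poly.[al] = 0 -> affine_poly^`().[al] != 0.
Proof.
rewrite /affine_poly derivN derivD derivXn derivC addr0 !hornerE => /eqP.
rewrite oppr_eq0 hornerMn hornerXn => al0; rewrite oppr_eq0 -mulr_natr mulf_neq0 //.
rewrite expf_neq0 //; apply: contraTneq al0 => ->.
by rewrite expr0n gtn_eqF // add0r oner_eq0.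
Qed.

Lemma affine_model : superelliptic iota m affine_poly U V.
Proof.
split=> //.
- exact: fermat_U_trans.
- by rewrite fermat_eqn eval1N rmorphD rmorphXn /= eval1X rmorph1.
- have [|al alE] := closed_rootP affine_poly _.
    by rewrite size_polyN -polyC1 -[1%:P]opprK -polyCN size_XnsubC // eqSS gtn_eqF.
  by exists al; [exact/eqP|apply/affine_poly_simple/eqP].
- exact: fermat_gen_by fermat.
Qed.

Let U0 : U != 0.
Proof. by rewrite -(rmorph0 iota) fermat_U_trans. Qed.
Let V0 : V != 0 := se_S_neq0 affine_model.

Context {d n' m' a b : nat}.
Hypotheses (nE : n = (d * n')%N) (mE : m = (d * m')%N).
Hypothesis bezout : (a * m' = (b * n').+1)%N.

(* s is a uniformizer and z a unit at each place at infinity. *)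
Definition inf_s : F := V ^+ b / U ^+ a.
Definition inf_z : F := V ^+ m' / U ^+ n'.
Definition inf_poly : {poly K} := - ('X^(b * n) * ('X^d + 1)).
Local Notation s := inf_s.
Local Notation z := inf_z.

(** The exponents of z and s in U and V form a matrix of determinant a m' - b n' = 1, so the
    monomial change of coordinates is invertible. *)
Lemma U_inf : U = z ^+ b / s ^+ m'.
Proof.
rewrite /inf_z /inf_s !expr_div_n -!exprM (mulnC b) bezout exprS (mulnC b).
by field; rewrite U0 !expf_neq0 ?U0 ?V0.
Qed.

Lemma V_inf : V = z ^+ a / s ^+ n'.
Proof.
rewrite /inf_z /inf_s !expr_div_n -!exprM (mulnC m') bezout exprS (mulnC a).
by field; rewrite ?U0 ?V0 ?s0 ?z0 ?expf_neq0 ?U0 ?V0 ?s0 ?z0.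
Qed.

Let s0 : s != 0. Proof. by rewrite mulf_neq0 ?invr_eq0 ?expf_neq0. Qed.
Let z0 : z != 0. Proof. by rewrite mulf_neq0 ?invr_eq0 ?expf_neq0. Qed.

Lemma z_inf : z ^+ d + 1 = - U ^- n.
Proof.
rewrite /inf_z expr_div_n -!exprM (mulnC m') (mulnC n') -nE -mE fermat_eqn.
by field; rewrite ?U0 ?V0 ?s0 ?z0 ?expf_neq0 ?U0 ?V0 ?s0 ?z0.
Qed.

(** [U_inf] is substituted in [z_inf]. The points of interest are s = 0, z^d = -1, where the factor
    [z ^+ (b * n)] is a unit. *)
Lemma s_inf : s ^+ (n * m') = - (z ^+ (b * n) * (z ^+ d + 1)).
Proof.
have Un : U ^+ n = z ^+ (b * n) / s ^+ (n * m').
  by rewrite {1}U_inf expr_div_n -!exprM (mulnC m').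
rewrite z_inf mulrN opprK Un invf_div mulrC divfK //.
by rewrite expf_neq0.
Qed.

Lemma inf_poly_simple zeta : zeta ^+ d = -1 ->
  inf_poly.[zeta] = 0 /\ inf_poly^`().[zeta] != 0.
Proof.
move=> zd; have d_neq0 : d%:R != 0 :> K by apply: contraNneq n_neq0 => d0; rewrite nE natrM d0 mul0r.
have zeta0 : zeta != 0.
  apply: contra_eq_neq zd => ->; rewrite expr0n.
  by rewrite gtn_eqF ?(charf_exp_gt0 d_neq0) // eq_sym oppr_eq0 oner_eq0.
rewrite /inf_poly derivN derivM derivD derivC addr0 !derivXn !hornerE zd addNr.
split; first by rewrite mulr0 oppr0.
rewrite mulr0 add0r oppr_eq0 hornerMn !hornerXn.
by rewrite -mulr_natr !mulf_neq0 ?expf_neq0.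
Qed.

Lemma inf_model : superelliptic iota (n * m') inf_poly z s.
Proof.
have trz : transcendental iota z.
  move=> c; apply/eqP => zc; have Un : U ^+ n = iota (- (c ^+ d + 1))^-1.
    by rewrite fmorphV rmorphN rmorphD rmorphXn rmorph1 -zc z_inf opprK invrK.
  have q0 : ('X^n - ((- (c ^+ d + 1))^-1)%:P : {poly K}) != 0.
    by rewrite monic_neq0 // monicXnsubC.
  have [|x Ux] := algebraic_const (iota := iota) q0 (_ : eval1 iota U _ = 0).
    by rewrite eval1B rmorphXn /= eval1X eval1C Un subrr.
  by have := fermat_U_trans x; rewrite Ux eqxx.
split=> //.
- rewrite natrM mulf_neq0 //; apply: contraNneq m_neq0 => m0.
  by rewrite mE natrM m0 mulr0.
- by rewrite s_inf eval1N rmorphM rmorphD !rmorphXn /= eval1X rmorph1.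
- have d_gt0 : (0 < d)%N by move: n_gt0; rewrite nE muln_gt0 => /andP[].
  have [|ze zeE] := closed_rootP ('X^d - (-1)%:P : {poly K}) _.
    by rewrite size_XnsubC // eqSS gtn_eqF.
  have ze1 : ze ^+ d = -1.
    by move: zeE; rewrite rootE !hornerE subr_eq0 => /eqP.
  by have [] := inf_poly_simple ze1; exists ze.
- move=> x; apply: (gen_by_sub _ _ (fermat_gen_by fermat x)).
  + rewrite U_inf; apply: gen_byM; first by apply/gen_byX/gen_byl.
    by apply/gen_byV/gen_byX/gen_byr.
  + rewrite V_inf; apply: gen_byM; first by apply/gen_byX/gen_byl.
    by apply/gen_byV/gen_byX/gen_byr.
Qed.

End FermatModels.

Section ScaledParameter.
Context {K : closedFieldType} {F : fieldType} {iota : {rmorphism K -> F}}.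
Context {N : nat} {p : {poly K}} {Z S : F}.
Context {M : superelliptic iota N p Z S}.
Context {al ga : K} {tau : {poly {poly K}}} {e : nat}.
Context {v : F -> int}.

(** [v g] is the order of w at v. *)
Lemma holomorphic_at_scaled (P : local_parameter M al ga tau e)
    (pv : place iota v) (w : differential iota) g :
  vge (v := v) 1 (Z - iota al) -> vge (v := v) 1 (S - iota ga) ->
  g != 0 -> w = g *: diff iota (eval2 iota Z S tau) ->
  forall h, holomorphic_at v (h *: w) <-> vge (v := v) (- v g) h.
Proof.
move=> vZ vS g0 -> h; rewrite scalerA (lp_holomorphic_at P pv vZ vS).
have [->|h0] := eqVneq h 0; first by rewrite mul0r; split; left.
split=> [/(vgeP (mulf_neq0 h0 g0))|/(vgeP h0)] hg; right; move: hg;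
  by rewrite (placeM pv) // -lerBlDr sub0r.
Qed.

End ScaledParameter.

Section FermatPlaces.
Context {K : closedFieldType} {F : fieldType} {iota : {rmorphism K -> F}}.
Context {n m : nat} {U V : F}.
Hypotheses (n_neq0 : n%:R != 0 :> K) (m_neq0 : m%:R != 0 :> K).
Hypothesis fermat : fermat_function_field iota n m U V.

Let M1 := affine_model n_neq0 m_neq0 fermat.
Let n_gt0 : (0 < n)%N := charf_exp_gt0 n_neq0.
Let m_gt0 : (0 < m)%N := charf_exp_gt0 m_neq0.
Let U_neq0 : U != 0.
Proof. by rewrite -(rmorph0 iota) (fermat_U_trans fermat). Qed.
Let V_neq0 : V != 0 := se_S_neq0 M1.

(** Differentiating the equation gives dU / V^(m-1) = -(m/n) dV / U^(n-1), so this form has neither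
    zero nor pole at finite distance: there, h omega is holomorphic exactly when h is regular. *)
Definition fermat_omega : differential iota := V ^- m.-1 *: diff iota U.
Local Notation omega := fermat_omega.
Local Notation pa := (@affine_poly K n).

Lemma affine_place_exists al ga : ga ^+ m = pa.[al] ->
  exists v, [/\ place iota v, vge (v := v) 1 (U - iota al)
    & vge (v := v) 1 (V - iota ga)].
Proof.
move=> gam; have [ga0|ga0] := eqVneq ga 0; last first.
  exact: lp_place_exists (unramified_parameter M1 ga0 gam).
have pal : pa.[al] = 0 by rewrite -gam ga0 expr0n gtn_eqF.
have := lp_place_exists (ramified_parameter M1 pal (affine_poly_simple n_neq0 pal)).
by rewrite ga0.
Qed.

Lemma holomorphic_at_affine v al ga h : ga ^+ m = pa.[al] ->
  place iota v -> vge (v := v) 1 (U - iota al) -> vge (v := v) 1 (V - iota ga) ->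
  holomorphic_at v (h *: omega) <-> vge (v := v) 0 h.
Proof.
move=> gam pv vU vV; have [ga0|ga0] := eqVneq ga 0; last first.
  have P := unramified_parameter M1 ga0 gam.
  have Vu : v V = 0.
    rewrite -(eval2X iota U V); apply: (lp_place_unit P pv vU vV).
    by apply: local_unit_eval; rewrite hornerX hornerC.
  have vg : v (V ^- m.-1) = 0.
    by rewrite (placeV pv) ?expf_neq0 // (placeX pv) // Vu mul0rn oppr0.
  rewrite -[X in vge X]oppr0 -{1}vg; apply: (holomorphic_at_scaled P pv) => //.
    by rewrite invr_eq0 expf_neq0.
  rewrite /omega eval2C eval1B eval1X eval1C; congr (_ *: _).
  by rewrite (diff_der M1 (U - _)) se_der_shift se_derZ scale1r.
have pal : pa.[al] = 0 by rewrite -gam ga0 expr0n gtn_eqF.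
have dpal := affine_poly_simple n_neq0 pal.
have P := ramified_parameter M1 pal dpal; rewrite ga0 in vV.
have dp0 : eval1 iota U pa^`() != 0.
  rewrite (eval1_eq0 _ (se_trans M1)); apply: contra_neq dpal => ->.
  by rewrite horner0.
(* omega = g dV, because dV is p'(U) / (m V^(m-1)) times dU, with p = [affine_poly]. *)
pose g := m%:R / eval1 iota U pa^`().
have g0 : g != 0 by rewrite mulf_neq0 ?invr_eq0 ?(se_natr_neq0 M1).
have vg : v g = 0.
  rewrite (placeM pv) ?invr_eq0 ?(se_natr_neq0 M1) // (placeV pv) //.
  rewrite -(rmorph_nat iota) (placeC pv) // add0r -(eval2C _ _ V).
  by rewrite (vge_point_unit pv vU vV) ?oppr0 // hornerC.
rewrite -[X in vge X]oppr0 -{1}vg; apply: (holomorphic_at_scaled P pv) => //.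
rewrite /omega eval2X (derivation_S M1 (diff_is_derivation iota)) scalerA.
congr (_ *: _); rewrite /g /se_dS.
move: (eval1 _ _ _) dp0 => x x0; field.
by rewrite x0 (se_natr_neq0 M1) expf_neq0.
Qed.

Lemma affine_place v : place iota v -> vge (v := v) 0 U ->
  vge (v := v) 0 V /\
  forall h, holomorphic_at v (h *: omega) <-> vge (v := v) 0 h.
Proof.
move=> pv U0; split; last first.
  have [al [ga [gam vU vV]]] := se_center M1 pv U0.
  by move=> h; apply: holomorphic_at_affine gam pv vU vV.
apply: (vge_exp0 pv m_gt0); rewrite (se_eqn M1); exact: vge_eval1.
Qed.

Context {d n' m' a b : nat}.
Hypotheses (nE : n = (d * n')%N) (mE : m = (d * m')%N).
Hypothesis bezout : (a * m' = (b * n').+1)%N.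

Local Notation s := (@inf_s F U V a b).
Local Notation z := (@inf_z F U V n' m').
Let M2 := inf_model n_neq0 m_neq0 fermat nE mE bezout.

Lemma inf_place_exists zeta : zeta ^+ d = -1 ->
  exists v, [/\ place iota v, vge (v := v) 1 (z - iota zeta) & vge (v := v) 1 s].
Proof.
move=> zd; have [p0 dp0] := inf_poly_simple (b := b) n_neq0 nE zd.
have [v [pv vz vs]] := lp_place_exists (ramified_parameter M2 p0 dp0).
by exists v; split=> //; rewrite rmorph0 subr0 in vs.
Qed.

(* omega has order - inf_order at the places at infinity. *)
Definition inf_order : int := m'%:Z + 1 - m.-1%:Z * n'%:Z.

Let dm'n' : [/\ (0 < d)%N, (0 < m')%N & (0 < n')%N].
Proof. by move: n_gt0 m_gt0; rewrite nE mE !muln_gt0 => /andP[-> ->] /andP[_ ->]. Qed.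

Let natF_neq0 k : k%:R != 0 :> K -> k%:R != 0 :> F.
Proof. by rewrite -(rmorph_nat iota) fmorph_eq0. Qed.

Let d_neq0 : d%:R != 0 :> K.
Proof. by apply: contraNneq n_neq0 => d0; rewrite nE natrM d0 mul0r. Qed.

Let s_neq0 : s != 0 := se_S_neq0 M2.

Let z_neq0 : z != 0.
Proof. by rewrite -(rmorph0 iota) (se_trans M2). Qed.

Lemma der_U_inf : se_der M2 U = d%:R / n%:R * U ^+ n.+1 * z ^+ d.-1.
Proof.
have dP := se_derP M2; have zE := z_inf fermat nE mE.
have D1 : se_der M2 1 = 0 := derivation1 dP.
have Un0 : U ^+ n != 0 by rewrite expf_neq0.
(* This relation is differentiated with respect to z. *)
have : U ^+ n * (z ^+ d + 1) = iota (-1) by rewrite zE mulrN mulfV // rmorphN1.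
move=> /(congr1 (se_der M2)); rewrite (derC dP) (derM dP) (derD dP) D1 !(derX dP).
rewrite se_derZ zE addr0 mulr1.
have UE : U ^+ n = U * U ^+ n.-1 by rewrite -exprS prednK.
have nF := natF_neq0 n_neq0; have Un1 : U ^+ n.-1 != 0 by rewrite expf_neq0.
rewrite exprS UE; move: (z ^+ d.-1) (U ^+ n.-1) Un1 (se_der M2 U) => x y y0 DU E.
apply: (mulfI (_ : (U * y)^-1 * (n%:R * y) != 0)).
  by rewrite mulf_neq0 ?invr_eq0 // mulf_neq0.
have -> : (U * y)^-1 * (n%:R * y) * DU = U * y * (d%:R * x).
  by apply/eqP; rewrite -subr_eq0 -oppr_eq0 -E; apply/eqP; field; rewrite U_neq0 y0.
by field; rewrite U_neq0 nF y0.
Qed.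

Lemma inf_place_at v zeta : zeta ^+ d = -1 -> place iota v ->
  vge (v := v) 1 (z - iota zeta) -> vge (v := v) 1 s ->
  [/\ v U = - m'%:Z, v V = - n'%:Z, v s = 1, v z = 0
    & forall h, holomorphic_at v (h *: omega) <-> vge (v := v) inf_order h].
Proof.
move=> zd pv vz vs; have [p0 dp0] := inf_poly_simple (b := b) n_neq0 nE zd.
have P := ramified_parameter M2 p0 dp0.
have vs' : vge (v := v) 1 (s - iota 0) by rewrite rmorph0 subr0.
have ze0 : zeta != 0.
  apply: contra_eq_neq zd => ->; rewrite expr0n.
  by have [d0 _ _] := dm'n'; rewrite gtn_eqF // eq_sym oppr_eq0 oner_eq0.
have vs1 : v s = 1 by rewrite -[s in LHS](eval2X iota z) (lp_place_t P pv vz vs').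
have vz0 : v z = 0.
  rewrite -[z in LHS](eval1X iota) -(eval2C _ _ s).
  by apply: (vge_point_unit pv vz vs'); rewrite hornerC hornerX.
have vU : v U = - m'%:Z.
  rewrite {1}(U_inf n_neq0 m_neq0 fermat bezout) (placeM pv) ?invr_eq0 ?expf_neq0 //.
  rewrite (placeV pv) ?expf_neq0 // !(placeX pv) // vs1 vz0 mul0rn add0r.
  by rewrite natz.
have vV : v V = - n'%:Z.
  rewrite {1}(V_inf n_neq0 m_neq0 fermat bezout) (placeM pv) ?invr_eq0 ?expf_neq0 //.
  rewrite (placeV pv) ?expf_neq0 // !(placeX pv) // vs1 vz0 mul0rn add0r.
  by rewrite natz.
split=> //.
pose p2 := @inf_poly K n d b; have Ep2 : p2 = @inf_poly K n d b by [].
have ep0 : eval1 iota z p2^`() != 0.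
  rewrite (eval1_eq0 _ (se_trans M2)); apply: contra_neq dp0 => ->.
  by rewrite horner0.
have vep : v (eval1 iota z p2^`()) = 0.
  by rewrite -(eval2C _ _ s) (vge_point_unit pv vz vs') // hornerC.
have vnat k : k%:R != 0 :> K -> v k%:R = 0.
  by move=> k0; rewrite -(rmorph_nat iota) (placeC pv).
have N0 := se_exp M2.
pose dS : F := se_dS (iota := iota) (N := n * m') (p := p2) (Z := z) (S := s).
have dS0 : dS != 0.
  by rewrite mulf_neq0 ?invr_eq0 ?mulf_neq0 ?expf_neq0 // natF_neq0.
have vdS : v dS = - (n * m').-1%:Z.
  rewrite (placeM pv) ?invr_eq0 ?mulf_neq0 ?expf_neq0 ?natF_neq0 //.
  rewrite vep (placeV pv) ?mulf_neq0 ?expf_neq0 ?natF_neq0 //.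
  rewrite (placeM pv) ?expf_neq0 ?natF_neq0 // vnat // (placeX pv) // vs1.
  by rewrite add0r natz add0r.
have dU0 : se_der M2 U != 0.
  by rewrite der_U_inf !mulf_neq0 ?invr_eq0 ?expf_neq0 ?natF_neq0.
have vdU : v (se_der M2 U) = - (m'%:Z * n.+1%:Z).
  rewrite der_U_inf !(placeM pv) ?mulf_neq0 ?invr_eq0 ?expf_neq0 ?natF_neq0 //.
  rewrite (placeV pv) ?natF_neq0 // !vnat // !(placeX pv) // vz0 vU mul0rn.
  by rewrite addr0 add0r -mulr_natr natz mulNr.
(* omega = g ds, since [dS] is ds/dz. The three factors give the order (m-1) n' - m' (n+1) + (n m' -
   1). *)
pose g := V ^- m.-1 * se_der M2 U / dS.
have g0 : g != 0 by rewrite !mulf_neq0 ?invr_eq0 ?expf_neq0.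
have vg : v g = - inf_order.
  rewrite !(placeM pv) ?mulf_neq0 ?invr_eq0 ?expf_neq0 // !(placeV pv) ?expf_neq0 //.
  rewrite (placeX pv) // vdS vdU vV /inf_order.
  have : (0 < n * m')%N by have [_ m'0 _] := dm'n'; rewrite muln_gt0 n_gt0.
  rewrite -mulr_natr natz; clear; nia.
rewrite -[inf_order]opprK -vg; apply: (holomorphic_at_scaled P pv) => //.
rewrite /omega eval2X (derivation_S M2 (diff_is_derivation iota)) (diff_der M2 U).
by rewrite !scalerA -/p2 -/dS /g divfK.
Qed.

(** At a pole of U, z^d + 1 = -U^(-n) has positive value, so the residue zeta of z satisfies zeta^d
    = -1, and [s_inf] makes the value of s positive. *)
Lemma inf_place v : place iota v -> ~ vge (v := v) 0 U ->
  exists2 zeta, zeta ^+ d = -1 & vge (v := v) 1 (z - iota zeta) /\ vge (v := v) 1 s.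
Proof.
move=> pv nU; have [d0 m'0 n'0] := dm'n'.
have vU : v U < 0 by rewrite ltNge; apply/negP => vU; apply: nU; right.
have vUn : vge (v := v) 1 (U ^- n).
  right; rewrite (placeV pv) ?expf_neq0 // (placeX pv) // -gtz0_ge1 oppr_gt0.
  by rewrite pmulrn_llt0.
have vzd : vge (v := v) 1 (z ^+ d + 1).
  by rewrite (z_inf fermat nE mE); apply: (vgeN pv).
have vz : vge (v := v) 0 z.
  apply: (vge_exp0 pv d0); rewrite -[z ^+ d](addrK 1); apply: (vgeB pv).
    exact: vgeW vzd.
  by rewrite -(rmorph1 iota); apply: (vgeC pv).
have q0 : ('X^d + 1 : {poly K}) != 0.
  by rewrite -polyC1 -[1%:P]opprK -polyCN monic_neq0 // monicXnsubC.
have [|zeta zE vze] := vge1_root pv (se_trans M2) vz q0.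
  by rewrite rmorphD rmorphXn /= eval1X rmorph1.
exists zeta.
  by apply/eqP; rewrite -addr_eq0 -zE !hornerE.
split=> //; apply: (vge_exp1 pv (_ : 0 < n * m')%N); first by rewrite muln_gt0 n_gt0.
rewrite (s_inf n_neq0 m_neq0 fermat nE mE bezout); apply: (vgeN pv).
by rewrite -[1]add0r; apply: (vgeM pv) => //; apply: (vgeX pv).
Qed.

End FermatPlaces.

(** * Holomorphic differentials *)

Section HolomorphicFermat.
Context {K : closedFieldType} {F : fieldType} {iota : {rmorphism K -> F}}.
Context {n m : nat} {U V : F}.
Hypotheses (n_neq0 : n%:R != 0 :> K) (m_neq0 : m%:R != 0 :> K).
Hypothesis fermat : fermat_function_field iota n m U V.

Let M1 := affine_model n_neq0 m_neq0 fermat.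
Let n_gt0 : (0 < n)%N := charf_exp_gt0 n_neq0.
Let m_gt0 : (0 < m)%N := charf_exp_gt0 m_neq0.
Local Notation pa := (@affine_poly K n).
Local Notation ev1 := (eval1 iota U).
Local Notation ev2 := (eval2 iota U V).
Local Notation omega := (@fermat_omega K F iota m U V).

Definition affine_reg (g : F) : Prop := forall al ga v, ga ^+ m = pa.[al] ->
  place iota v -> vge (v := v) 1 (U - iota al) -> vge (v := v) 1 (V - iota ga) ->
  vge (v := v) 0 g.

(* Above al with al^n + 1 <> 0, the polynomial a(al, .) vanishes at m distinct
   points; above al with al^n + 1 = 0, the terms of a have distinct valuations. *)
Lemma affine_coef_root g (a : {poly {poly K}}) c al : affine_reg g ->
  (size a <= m)%N -> ev1 c * g = ev2 a -> c.[al] = 0 -> forall j, (a`_j).[al] = 0.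
Proof.
move=> reg_g sza cgE cal; pose A := map_poly (horner_eval al) a.
have Aj j : A`_j = (a`_j).[al] by rewrite coef_map.
have AE be : A.[be] = a.[be, al].
  by rewrite /A -[in LHS](hornerC be al) -[_.[al]]/(horner_eval al _) horner_map.
have vUal v : place iota v -> vge (v := v) 1 (U - iota al) ->
    forall q, q.[al] = 0 -> vge (v := v) (v (U - iota al)) (ev1 q).
  move=> pv vU q q0; have [r ->] := root_sub q al.
  rewrite q0 addr0 rmorphM /= eval1B eval1X eval1C -[v _]add0r; apply: (vgeM pv); last by right.
  apply: (vge_eval1 pv); rewrite -[U](subrK (iota al)); apply: (vgeD pv) (vgeC pv _).
  exact: vgeW vU.
have Ual0 : U - iota al != 0 by rewrite subr_eq0 (se_trans M1).
suff A0 : A = 0 by move=> j; rewrite -Aj A0 coef0.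
have [pal|pal] := eqVneq pa.[al] 0; last first.
  have [r [ur szr rE]] := XnsubC_split m_neq0 pal.
  apply: (roots_geq_poly_eq0 (rs := r)) => //; last first.
    by rewrite szr; apply: leq_trans (size_poly _ _) sza.
  apply/allP => be ber; rewrite rootE AE.
  have beE : be ^+ m = pa.[al].
    have : root ('X^m - pa.[al]%:P) be by rewrite rE root_prod_XsubC.
    by rewrite rootE !hornerE subr_eq0 => /eqP.
  have [v [pv vU vV]] := affine_place_exists n_neq0 m_neq0 fermat beE.
  apply: contraT => aP; have va := vge_point_unit pv vU vV aP.
  have : vge (v := v) 1 (ev2 a).
    rewrite -cgE -[1]addr0; apply: (vgeM pv); last exact: reg_g vU vV.
    apply: vgeW (vUal v pv vU c cal); exact: (vgeP Ual0).
  have a0 : ev2 a != 0.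
    by have [] := vge_residue_unit pv aP (vge_point pv a vU vV).
  by move=> /(vgeP a0); rewrite va.
have gam : 0 ^+ m = pa.[al] by rewrite pal expr0n gtn_eqF.
have [v [pv vU vV]] := affine_place_exists n_neq0 m_neq0 fermat gam.
have P := ramified_parameter M1 pal (affine_poly_simple n_neq0 pal).
have V0 : V != 0 := se_S_neq0 M1.
have vV1 : v V = 1 by rewrite -[V in LHS](eval2X iota U) (lp_place_t P pv vU vV).
have vUm : v (U - iota al) = m%:Z.
  have [u uu ->] := lp_Z P; rewrite (placeM pv) ?expf_neq0 ?(local_unit_neq0 (lp_wd P) uu) //.
    by rewrite (lp_place_unit P pv vU vV uu) (placeX pv) eval2X // vV1 addr0 natz.
  by rewrite eval2X.
apply/eqP; apply: contraT => A0.
have exj : exists j, A`_j != 0.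
  by exists (size A).-1; rewrite -lead_coefE lead_coef_eq0.
(* The term of index [j0] has value exactly j0. Coefficients of lower terms are divisible by U - al,
   of value m > j0; higher terms carry a higher power of V; the whole sum has value at least m. This
   is contradictory. *)
case: (ex_minnP exj) => j0 Aj0 minj.
have j0m : (j0 < m)%N.
  apply: leq_trans sza; rewrite ltnNge; apply: contra Aj0 => sz0.
  by rewrite Aj nth_default // horner0.
have va : vge (v := v) (j0.+1)%:Z (ev2 a).
  apply: vgeW (_ : vge m%:Z _); first by rewrite lez_nat.
  rewrite -cgE -[m%:Z]addr0; apply: (vgeM pv); last exact: reg_g vU vV.
  by rewrite -vUm; apply: vUal.
have U0 : vge (v := v) 0 U.
  by rewrite -[U](subrK (iota al)); apply: (vgeD pv) (vgeC pv _); apply: vgeW vU.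
have vq q : vge (v := v) 0 (ev1 q) by apply: vge_eval1.
have vVX j : vge (v := v) j%:Z (V ^+ j) by right; rewrite (placeX pv) // vV1 natz.
have szj0 : (j0 < size a)%N.
  by rewrite ltnNge; apply: contra Aj0 => sz0; rewrite Aj nth_default // horner0.
have : vge (v := v) (j0.+1)%:Z (ev1 a`_j0 * V ^+ j0).
  have := eval2E iota U V a; rewrite (bigD1 (Ordinal szj0)) //= => /esym/eqP.
  rewrite -eq_sym -subr_eq => /eqP <-; apply: (vgeB pv) => //.
  apply: (vge_sum pv) => i /negPf ij; rewrite -val_eqE /= in ij.
  have [ilt|] := ltnP i j0; last rewrite leq_eqVlt eq_sym ij /= => j0i.
    apply: vgeW (_ : vge m%:Z _); first by rewrite lez_nat.
    rewrite -[m%:Z]addr0; apply: (vgeM pv).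
      rewrite -vUm; apply: vUal => //; apply/eqP; apply: contraTT ilt => ai.
      by rewrite -leqNgt minj // Aj.
    by apply: vgeW (vVX i).
  apply: vgeW (_ : vge i%:Z _); first by rewrite lez_nat.
  by rewrite -[i%:Z]add0r; apply: (vgeM pv).
have aj0 : v (ev1 a`_j0) = 0.
  rewrite -(eval2C _ _ V); apply: (vge_point_unit pv vU vV); rewrite hornerC.
  by rewrite -Aj.
have ej0 : ev1 a`_j0 != 0.
  by rewrite (eval1_eq0 _ (se_trans M1)); apply: contra_neq Aj0 => a0; rewrite Aj a0 horner0.
move=> /vgeP; rewrite mulf_neq0 ?expf_neq0 // => /(_ isT).
by rewrite (placeM pv) ?expf_neq0 // aj0 (placeX pv) // vV1 add0r natz lez_nat ltnn.
Qed.

(** A root al of the denominator is a root of all coefficients of the numerator by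
    [affine_coef_root], so U - al cancels; the induction is on the degree of the denominator. *)
Lemma affine_regular g : affine_reg g ->
  exists a : {poly {poly K}}, (size a <= m)%N /\ g = ev2 a.
Proof.
move=> reg_g; have [a [c [c0 sza cgE]]] := se_quotient M1 g.
have [k] := ubnP (size c); elim: k a c c0 sza cgE => // k IHk a c c0 sza cgE szc.
have [sz1|sz1] := eqVneq (size c) 1%N.
  have cC : c = (c`_0)%:P by apply: size1_polyC; rewrite sz1.
  have c00 : c`_0 != 0 by rewrite -polyC_eq0 -cC.
  exists ((c`_0)^-1%:P *: a); split.
    by apply: leq_trans (size_scale_leq _ _) sza.
  by rewrite eval2Z -cgE cC !eval1C coefC eqxx fmorphV mulKf // fmorph_eq0.
have [al ral] := closed_rootP c sz1; have cal : c.[al] = 0 by apply/eqP.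
have aal := affine_coef_root reg_g sza cgE cal.
have [c1 c1E] := factor_theorem _ _ ral.
have c10 : c1 != 0 by apply: contra_neq c0 => c10; rewrite c1E c10 mul0r.
pose a1 : {poly {poly K}} := \poly_(j < m) (a`_j %/ ('X - al%:P)).
have aE : a = ('X - al%:P) *: a1.
  apply/polyP => j; rewrite coefZ coef_poly; case: ltnP => jm.
    by rewrite mulrC divpK // dvdp_XsubCl rootE aal.
  by rewrite mulr0 nth_default // (leq_trans sza).
apply: (IHk a1 c1) => //.
- exact: size_poly.
- apply: (mulfI (_ : U - iota al != 0)); first by rewrite subr_eq0 (se_trans M1).
  move: cgE; rewrite aE c1E eval2Z rmorphM /= eval1B eval1X eval1C => <-; ring.
- by move: szc; rewrite c1E size_Mmonic ?monicXsubC // size_XsubC addn2 ltnS.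
Qed.

End HolomorphicFermat.

(** * Regularity at infinity and the support of a polynomial *)

Section InfiniteSupport.
Context {K : closedFieldType} {F : fieldType} {iota : {rmorphism K -> F}}.
Context {n m : nat} {U V : F}.
Hypotheses (n_neq0 : n%:R != 0 :> K) (m_neq0 : m%:R != 0 :> K).
Hypothesis fermat : fermat_function_field iota n m U V.

Let n_gt0 : (0 < n)%N := charf_exp_gt0 n_neq0.
Let m_gt0 : (0 < m)%N := charf_exp_gt0 m_neq0.
Local Notation ev2 := (eval2 iota U V).

Lemma eval1_wide Z (q : {poly K}) B : (size q <= B)%N ->
  eval1 iota Z q = \sum_(i < B) iota q`_i * Z ^+ i.
Proof.
move=> szq; rewrite /eval1 (@horner_coef_wide _ B); last first.
  by apply: leq_trans szq; apply: size_poly.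
by apply: eq_bigr => i _; rewrite coef_map.
Qed.

Lemma eval2_wide Z S (a : {poly {poly K}}) B1 B2 : (size a <= B2)%N ->
  (forall j, (size (a`_j)%R <= B1)%N) ->
  eval2 iota Z S a = \sum_(x : 'I_B1 * 'I_B2) iota ((a`_(x.2))`_(x.1)) * (Z ^+ x.1 * S ^+ x.2).
Proof.
move=> sza szj; rewrite /eval2 (@horner_coef_wide _ B2); last first.
  by apply: leq_trans sza; apply: size_poly.
rewrite -(pair_big xpredT xpredT
  (fun (i : 'I_B1) (j : 'I_B2) => iota (a`_j)`_i * (Z ^+ i * S ^+ j))) /= exchange_big /=.
apply: eq_bigr => j _; rewrite coef_map /= (eval1_wide _ (szj j)) mulr_suml.
by apply: eq_bigr => i _; rewrite mulrA.
Qed.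

Context {d n' m' a b : nat}.
Hypotheses (nE : n = (d * n')%N) (mE : m = (d * m')%N).
Hypothesis bezout : (a * m' = (b * n').+1)%N.
Local Notation s := (@inf_s F U V a b).
Local Notation z := (@inf_z F U V n' m').
Let M2 := inf_model n_neq0 m_neq0 fermat nE mE bezout.

Let dm'n' : [/\ (0 < d)%N, (0 < m')%N & (0 < n')%N].
Proof. by move: n_gt0 m_gt0; rewrite nE mE !muln_gt0 => /andP[-> ->] /andP[_ ->]. Qed.

Let d_neq0 : d%:R != 0 :> K.
Proof. by apply: contraNneq n_neq0 => d0; rewrite nE natrM d0 mul0r. Qed.

Definition inf_reg (g : F) : Prop := forall zeta v, zeta ^+ d = -1 ->
  place iota v -> vge (v := v) 1 (z - iota zeta) -> vge (v := v) 1 s ->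
  vge (v := v) (@inf_order m n' m') g.

(* Indices are shifted by one: (i, j) stands for U^i V^j dU / V^(m-1). *)
Definition fermat_index (i j : nat) : bool := (i.+1 * m + j.+1 * n < n * m)%N.

(** U^i V^j = z^([ex i j]) / s^([wt i j]), so [wt] is the pole order of the monomial at infinity. *)
Let wt (i j : nat) := (i * m' + j * n')%N.
Let ex (i j : nat) := (b * i + a * j)%N.

Let ex_wt i j : (m' * ex i j = b * wt i j + j)%N.
Proof.
rewrite /ex /wt; have -> : (m' * (b * i + a * j) = b * (i * m') + (a * m') * j)%N by lia.
by rewrite bezout; lia.
Qed.

(** By [ex_wt], weight and [ex] modulo d determine j modulo m' d = m, hence j; the weight then gives
    i. *)
Let ex_wt_inj i1 j1 i2 j2 : (j1 < m)%N -> (j2 < m)%N ->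
  wt i1 j1 = wt i2 j2 -> ex i1 j1 = ex i2 j2 %[mod d] -> i1 = i2 /\ j1 = j2.
Proof.
move=> j1m j2m wE eE; have [d0 m0 n0] := dm'n'.
have : (m' * ex i1 j1 = m' * ex i2 j2 %[mod m' * d])%N by rewrite -!muln_modr eE.
rewrite !ex_wt wE (mulnC m') -mE => /eqP; rewrite eqn_modDl !modn_small // => /eqP jE.
split=> //; move: wE; rewrite /wt jE => /addIn/eqP.
by rewrite eqn_pmul2r // => /eqP.
Qed.

(* Multiplied by s^E with E the maximal weight in the support, g is regular
   at infinity, and its values at the points z = zeta are those of a polynomial
   of degree < d whose coefficients are the ones of weight E. *)
Lemma inf_support g (A : {poly {poly K}}) : inf_reg g -> (size A <= m)%N ->
  g = ev2 A -> forall i j, (A`_j)`_i != 0 -> fermat_index i j.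
Proof.
move=> reg_g szA gE i0 j0 c0; apply: contraT => nS; have [d0 m0 n0] := dm'n'.
pose c i j := (A`_j)`_i.
have jm i j : c i j != 0 -> (j < m)%N.
  move=> cij; apply: leq_trans szA; rewrite ltnNge; apply: contra cij => szj.
  by rewrite /c (nth_default _ szj) coef0.
pose B := \max_(j < m) size (A`_j)%R.
have szB j : (size (A`_j)%R <= B)%N.
  have [jlt|mj] := ltnP j m; first exact: (leq_bigmax (Ordinal jlt)).
  by rewrite nth_default ?size_poly0 // (leq_trans szA).
have iB i j : c i j != 0 -> (i < B)%N.
  move=> cij; apply: leq_trans (szB j); rewrite ltnNge; apply: contra cij => szj.
  by rewrite /c nth_default.
pose Q k := `[< exists i j, c i j != 0 /\ wt i j = k >].
have exQ : exists k, Q k by exists (wt i0 j0); apply/asboolP; exists i0, j0.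
have boundQ k : Q k -> (k <= wt B m)%N.
  move=> /asboolP[i [j [cij <-]]]; rewrite leq_add // leq_mul // ltnW //.
    exact: iB cij.
  exact: jm cij.
case: (ex_maxnP exQ boundQ) => E /asboolP[i1 [j1 [c1 wt1]]] maxE.
have wtE i j : c i j != 0 -> (wt i j <= E)%N.
  by move=> cij; apply: maxE; apply/asboolP; exists i, j.
(* The regularity inequality fails at (i0, j0); divided by d, its negation says [inf_order] + E >=
   1, so g s^E vanishes at infinity. *)
have Elarge : (m * n' <= E + m' + n')%N.
  have E0 := wtE _ _ c0; move: nS; rewrite /fermat_index -leqNgt => nS.
  have : (m * n' <= wt i0 j0 + m' + n')%N.
    have : (d * (m * n') <= d * (wt i0 j0 + m' + n'))%N.
      have -> : (d * (m * n') = n * m)%N by rewrite nE; lia.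
      apply: leq_trans nS _; rewrite /wt mE nE; nia.
    by rewrite leq_pmul2l.
  by move=> h; apply: leq_trans h _; rewrite !leq_add2r.
pose e (x : 'I_B * 'I_m) := ex x.1 x.2.
pose G : {poly {poly K}} := \sum_(x : 'I_B * 'I_m)
  (c x.1 x.2 *: 'X^(e x)) *: 'X^(E - wt x.1 x.2).
have UsE : U * s ^+ m' = z ^+ b.
  by rewrite {1}(U_inf n_neq0 m_neq0 fermat bezout) divfK // expf_neq0 // (se_S_neq0 M2).
have VsE : V * s ^+ n' = z ^+ a.
  by rewrite {1}(V_inf n_neq0 m_neq0 fermat bezout) divfK // expf_neq0 // (se_S_neq0 M2).
have GE : eval2 iota z s G = g * s ^+ E.
  rewrite gE (eval2_wide _ _ szA szB) rmorph_sum mulr_suml; apply: eq_bigr => x _.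
  rewrite /= eval2Z eval1Z !rmorphXn /= eval1X eval2X -/(c _ _).
  have [->|cx] := eqVneq (c x.1 x.2) 0; first by rewrite rmorph0 !mul0r.
  rewrite -!mulrA; congr (_ * _).
  have -> : z ^+ e x = U ^+ x.1 * V ^+ x.2 * s ^+ wt x.1 x.2.
    rewrite /e /ex exprD !exprM -UsE -VsE /wt; move: s => t.
    by rewrite !exprMn exprD -!exprM (mulnC m') (mulnC n'); ring.
  by rewrite -!mulrA -exprD subnKC // wtE.
have Gval zeta : zeta ^+ d = -1 -> G.[0, zeta] = 0.
  move=> zd; have [v [pv vz vs]] := inf_place_exists n_neq0 m_neq0 fermat nE mE bezout zd.
  have [_ _ vs1 _ _] := inf_place_at n_neq0 m_neq0 fermat nE mE bezout zd pv vz vs.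
  have vs' : vge (v := v) 1 (s - iota 0) by rewrite rmorph0 subr0.
  apply/eqP; apply: contraT => G0; have vG := vge_point_unit pv vz vs' G0.
  have [eG0 _] := vge_residue_unit pv G0 (vge_point pv G vz vs').
  have : vge (v := v) 1 (eval2 iota z s G).
    rewrite GE; apply: vgeW (vgeM pv (reg_g _ _ zd pv vz vs) (_ : vge E%:Z _)).
      move: Elarge; rewrite /inf_order; move: m_gt0 => /prednK {1}<-; clear; nia.
    by right; rewrite (placeX pv) ?(se_S_neq0 M2) // vs1 natz.
  by move=> /(vgeP eG0); rewrite vG.
(* The exponents of z are reduced modulo d by zeta^d = -1, so [h] has degree below d but vanishes at
   the d roots of X^d + 1. *)
pose h : {poly K} := \sum_(x : 'I_B * 'I_m | wt x.1 x.2 == E)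
  (c x.1 x.2 * (-1) ^+ (e x %/ d)) *: 'X^(e x %% d).
have hval zeta : zeta ^+ d = -1 -> h.[zeta] = 0.
  move=> zd; rewrite -(Gval zeta zd) /h /G horner_sum [in RHS]horner_sum.
  rewrite [in RHS](big_morph (horner^~ zeta) (fun p q => hornerD p q zeta) (horner0 zeta)).
  rewrite big_mkcond; apply: eq_bigr => x _.
  have [wx|wx] := eqVneq (wt x.1 x.2) E; rewrite !hornerE /=.
    rewrite wx subnn expr0 mulr1 {3}(divn_eq (e x) d) exprD mulnC exprM zd.
    by rewrite mulrA.
  have [->|cx] := eqVneq (c x.1 x.2) 0; first by rewrite !mul0r.
  have Ewx : (0 < E - wt x.1 x.2)%N by rewrite subn_gt0 ltn_neqAle wx wtE.
  by rewrite expr0n gtn_eqF // mulr0.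
have szh : (size h <= d)%N.
  apply: (big_ind (fun q : {poly K} => (size q <= d)%N)).
  - by rewrite size_poly0.
  - by move=> p q pd qd; rewrite (leq_trans (size_polyD _ _)) // geq_max pd.
  - move=> x _; apply: leq_trans (size_scale_leq _ _) _.
    by rewrite size_polyXn ltn_pmod.
have h0 : h = 0.
  have N10 : -1 != 0 :> K by rewrite oppr_eq0 oner_eq0.
  have [r [ur szr rE]] := XnsubC_split d_neq0 N10.
  apply: (roots_geq_poly_eq0 (rs := r)) => //; last by rewrite szr.
  apply/allP => ze zer; rewrite rootE hval //.
  have : root ('X^d - (-1)%:P) ze by rewrite rE root_prod_XsubC.
  by rewrite rootE !hornerE subr_eq0 => /eqP.
pose x1 : 'I_B * 'I_m := (Ordinal (iB _ _ c1), Ordinal (jm _ _ c1)).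
have := congr1 (fun q : {poly K} => q`_(e x1 %% d)) h0.
rewrite coef0 /h (bigD1 x1) /=; last by rewrite wt1.
rewrite coefD coefZ coefXn eqxx mulr1 coef_sum big1 ?addr0 => [/eqP|x /andP[/eqP wx xx1]].
  by rewrite mulf_eq0 signr_eq0 orbF (negPf c1).
rewrite coefZ coefXn; case: eqP => [ex1|]; last by rewrite mulr0.
case/eqP: xx1; have [iE jE] := ex_wt_inj (ltn_ord x.2) (jm _ _ c1) (etrans wx (esym wt1)) (esym ex1).
move: iE jE; clear wx ex1; by case: x => i j /= iE jE; congr pair; apply: val_inj.
Qed.

End InfiniteSupport.

Lemma bezout_exists n m : (0 < n)%N -> (0 < m)%N -> exists d n' m' a b,
  [/\ n = (d * n')%N, m = (d * m')%N & (a * m' = (b * n').+1)%N].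
Proof.
move=> n0 m0; have d0 : (0 < gcdn n m)%N by rewrite gcdn_gt0 n0.
have /dvdnP[n' nE] := dvdn_gcdl n m; have /dvdnP[m' mE] := dvdn_gcdr n m.
have m'0 : (0 < m')%N by move: m0; rewrite mE muln_gt0 => /andP[].
have cop : gcdn m' n' = 1%N.
  apply/eqP; rewrite -(eqn_pmul2r d0) mul1n muln_gcdl -nE -mE gcdnC.
  by rewrite eqxx.
case: (egcdnP n' m'0) => a b abE _; exists (gcdn n m), n', m', a, b.
by split; [rewrite mulnC|rewrite mulnC|rewrite abE cop addn1].
Qed.

(** * The monomial basis of the holomorphic differentials *)

Section HolomorphicBasis.
Context {K : closedFieldType} {F : fieldType} {iota : {rmorphism K -> F}}.
Context {n m : nat} {U V : F}.
Hypotheses (n_neq0 : n%:R != 0 :> K) (m_neq0 : m%:R != 0 :> K).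
Hypothesis fermat : fermat_function_field iota n m U V.

Let M1 := affine_model n_neq0 m_neq0 fermat.
Let n_gt0 : (0 < n)%N := charf_exp_gt0 n_neq0.
Let m_gt0 : (0 < m)%N := charf_exp_gt0 m_neq0.
Let V_neq0 : V != 0 := se_S_neq0 M1.
Local Notation omega := (@fermat_omega K F iota m U V).
Local Notation idx := ('I_n * 'I_m)%type.
Local Notation Sx := (@fermat_index n m).

Definition fermat_mono (x : idx) : F := U ^+ x.1 * V ^+ x.2.

Lemma mono_indep (c : idx -> K) :
  \sum_x iota (c x) * fermat_mono x = 0 -> forall x, c x = 0.
Proof.
move=> c0; pose A : {poly {poly K}} := \sum_(x : idx) (c x *: 'X^(x.1)) *: 'X^(x.2).
have A0 : A = 0.
  apply: (se_indep M1).
    apply: (big_ind (fun q : {poly {poly K}} => (size q <= m)%N)).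
    - by rewrite size_poly0.
    - by move=> p q pd qd; rewrite (leq_trans (size_polyD _ _)) // geq_max pd.
    - by move=> x _; apply: leq_trans (size_scale_leq _ _) _; rewrite size_polyXn.
  rewrite -c0 rmorph_sum; apply: eq_bigr => x _.
  by rewrite /= eval2Z eval1Z !rmorphXn /= eval1X eval2X mulrA.
move=> x; have := congr1 (fun q : {poly {poly K}} => (q`_(x.2))`_(x.1)) A0.
rewrite !coef0 coef_sum coef_sum (bigD1 x) //= big1 ?addr0 => [|y yx].
  by rewrite coefZ coefXn eqxx mulr1 coefZ coefXn eqxx mulr1.
rewrite coefZ coefXn; have [x2|] := eqVneq; last by rewrite mulr0 coef0.
rewrite mulr1 coefZ coefXn; have [x1|] := eqVneq; last by rewrite mulr0.
case/eqP: yx; case: x y x1 x2 => [x1 x2] [y1 y2] /= e1 e2.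
by congr pair; apply/esym/val_inj.
Qed.

Lemma omega_scale_inj g h : g *: omega = h *: omega -> g = h.
Proof.
rewrite /fermat_omega !scalerA => /(diffZ_scale_inj M1)/mulIf; apply.
by rewrite invr_eq0 expf_neq0.
Qed.

(** Finite places force the coefficient of omega to be a polynomial in U and V of degree below m in
    V; the places at infinity restrict its support. Conversely, each regular monomial is checked at
    both kinds of places. *)
Lemma holomorphic_fermat (w : differential iota) : holomorphic w <->
  exists c : idx -> K, w = (\sum_(x : idx | Sx x.1 x.2)
    iota (c x) * fermat_mono x) *: omega.
Proof.
have [d [n' [m' [a [b [nE mE bezout]]]]]] := bezout_exists n_gt0 m_gt0.
have [d0 n'0 m'0] : [/\ (0 < d)%N, (0 < n')%N & (0 < m')%N].
  by move: n_gt0 m_gt0; rewrite nE mE !muln_gt0 => /andP[-> ->] /andP[_ ->].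
split=> [hol|[c ->] v pv].
  have [g' wE'] := differential_der M1 w.
  pose g := g' * V ^+ m.-1; have wE : w = g *: omega.
    by rewrite wE' /g /fermat_omega scalerA mulfK // expf_neq0.
  have areg : @affine_reg K F iota n m U V g.
    move=> al ga v gam pv vU vV; have := hol v pv; rewrite wE.
    by move/(holomorphic_at_affine n_neq0 m_neq0 fermat g gam pv vU vV).
  have ireg : @inf_reg K F iota m U V d n' m' a b g.
    move=> zeta v zd pv vz vs; have := hol v pv; rewrite wE.
    have [_ _ _ _ hE] := inf_place_at n_neq0 m_neq0 fermat nE mE bezout zd pv vz vs.
    by move/hE.
  have [A [szA gE]] := affine_regular n_neq0 m_neq0 fermat areg.
  have supp := inf_support n_neq0 m_neq0 fermat nE mE bezout ireg szA gE.
  have szj j : (size (A`_j)%R <= n)%N.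
    apply/leq_sizeP => i ni; apply/eqP; apply: contraT => /supp.
    rewrite /fermat_index => h; suff : (n * m < n * m)%N by rewrite ltnn.
    apply: leq_trans h; rewrite ltnS; apply: leq_trans (leq_addr _ _).
    by rewrite leq_mul // (leq_trans ni).
  exists (fun x : idx => (A`_(x.2))`_(x.1)); rewrite wE gE; congr (_ *: _).
  rewrite (eval2_wide U V szA szj) (bigID (fun x : idx => Sx x.1 x.2)) /=.
  rewrite [X in _ + X]big1 ?addr0 // => x nS.
  have [->|/supp] := eqVneq ((A`_(x.2))`_(x.1)) 0; first by rewrite rmorph0 mul0r.
  by rewrite (negPf nS).
have [U0|U0] := EM (vge (v := v) 0 U).
  have [V0 hE] := affine_place n_neq0 m_neq0 fermat pv U0.
  apply/hE; apply: (vge_sum pv) => x _; apply: (vgeM0 pv); first exact: (vgeC pv).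
  by apply: (vgeM0 pv); apply: (vgeX pv).
have [zeta zd [vz vs]] := inf_place n_neq0 m_neq0 fermat nE mE bezout pv U0.
have [vU vV _ _ hE] := inf_place_at n_neq0 m_neq0 fermat nE mE bezout zd pv vz vs.
apply/hE; apply: (vge_sum pv) => x Sxx; rewrite -[inf_order]add0r.
apply: (vgeM pv); [exact: (vgeC pv)|right].
have U_neq0 : U != 0 by rewrite -(rmorph0 iota) (fermat_U_trans fermat).
rewrite (placeM pv) ?expf_neq0 // !(placeX pv) // vU vV.
have h : (x.1.+1 * m' + x.2.+1 * n' < m * n')%N.
  move: Sxx; rewrite /fermat_index; move: (nat_of_ord x.1) (nat_of_ord x.2) => i j h.
  by rewrite -(ltn_pmul2l d0); move: h; rewrite mE nE; clear; lia.
rewrite /inf_order -[_ *+ x.1]mulr_natr -[_ *+ x.2]mulr_natr !natz.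
move: h m_gt0; move: (nat_of_ord x.1) (nat_of_ord x.2) => i j; clear.
by case: m => // k h _; move: h; rewrite /=; nia.
Qed.

End HolomorphicBasis.

(** * The a-number *)

Section PcharFfact.
Context {K : fieldType} {l : nat}.
Hypothesis charl : l \in [pchar K].
Let l_prime := pcharf_prime charl.
Let l_gt0 : (0 < l)%N := prime_gt0 l_prime.

(** The l-1 consecutive integers from e downwards contain a multiple of l unless e+1 is one; the
    factor e - (e mod l) is such a multiple. *)
Lemma ffact_pchar_eq0 e : ~~ (l %| e.+1)%N -> (e ^_ l.-1)%:R = 0 :> K.
Proof.
move=> le; apply/eqP; rewrite -(dvdn_pcharf charl) ffact_prod.
have r_lt : (e %% l < l.-1)%N.
  rewrite ltn_neqAle -ltnS (prednK l_gt0) ltn_pmod // andbT; apply: contra le => /eqP r.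
  by rewrite {1}(divn_eq e l) r -addnS (prednK l_gt0) dvdn_add ?dvdn_mull.
rewrite (bigD1 (Ordinal r_lt)) //= dvdn_mulr //.
by rewrite {1}(divn_eq e l) addnK dvdn_mull.
Qed.

Lemma ffact_pchar_neq0 e : (l %| e.+1)%N -> (e ^_ l.-1)%:R != 0 :> K.
Proof.
move=> le; rewrite ffact_prod natr_prod; apply/prodf_neq0 => i _.
have le1 : (l <= e.+1)%N by apply: dvdn_leq.
have il : (i.+1 < l)%N by have := ltn_ord i; rewrite -ltnS (prednK l_gt0).
have ie : (i <= e)%N by rewrite -ltnS; apply: leq_trans le1; apply: ltnW.
rewrite -(dvdn_pcharf charl); apply/negP => lei.
have : (l %| i.+1)%N.
  by rewrite -(dvdn_addr _ lei) addnS subnK.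
by rewrite gtnNdvd.
Qed.

Lemma bin_pchar_neq0 N t : (t <= N)%N -> (N < l)%N -> 'C(N, t)%:R != 0 :> K.
Proof.
move=> tN Nl; rewrite -(dvdn_pcharf charl); apply: contra (prime_ndvd_fact l_prime Nl).
by move=> lC; rewrite -(bin_fact tN) dvdn_mulr.
Qed.

(** Only exponents i + n t congruent to -1 modulo l survive l-1 differentiations. As n is prime to
    l, t0 is the only such t below l, and its term occurs in the expansion iff t0 <= N. *)
Lemma derivn_pred_affine_pow n i a t0 N : n%:R != 0 :> K -> (0 < a)%N ->
  (l * a = n * t0 + i.+1)%N -> (t0 < l)%N -> (N < l)%N ->
  exists2 gamma : K, (gamma != 0) = (t0 <= N)%N
    & ((- ('X^n + 1)) ^+ N * 'X^i)^`(l.-1) = gamma *: 'X^(l * a.-1).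
Proof.
move=> n0 a0 laE t0l Nl.
pose k t : K := (-1) ^+ N * 'C(N, t)%:R.
have e_dvd t : (t < l)%N -> (l %| (i + n * t).+1)%N = (t == t0).
  move=> tl; have cop : coprime l n by rewrite prime_coprime // (dvdn_pcharf charl).
  have small s r : (s < l)%N -> (l %| n * (s - r))%N -> (s <= r)%N.
    move=> sl; rewrite Gauss_dvdr // => lsr; rewrite -subn_eq0.
    by apply: contraTT lsr; rewrite -lt0n => sr; rewrite gtnNdvd // ltn_subLR; lia.
  apply/idP/eqP => [ldt|->]; last first.
    by rewrite (_ : (i + n * t0).+1 = l * a)%N ?dvdn_mulr //; lia.
  apply/eqP; rewrite eqn_leq; have [tt0|t0t] := leqP t t0.
    rewrite small // -(dvdn_addr _ ldt).
    rewrite (_ : _ + _ = l * a)%N ?dvdn_mulr // mulnBr; have := leq_mul (leqnn n) tt0; lia.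
  move: (t0t); rewrite ltnNge small //.
  have la : (l %| l * a)%N by rewrite dvdn_mulr.
  rewrite -(dvdn_addr _ la) (_ : l * a + _ = (i + n * t).+1)%N // mulnBr.
  by have := leq_mul (leqnn n) (ltnW t0t); lia.
have qE : (- ('X^n + 1)) ^+ N * 'X^i = \sum_(t < N.+1) k t *: 'X^(i + n * t).
  rewrite exprNn addrC exprDn mulr_sumr mulr_suml; apply: eq_bigr => t _.
  rewrite expr1n mul1r -exprM exprD /k -mul_polyC rmorphM rmorphXn rmorphN1.
  by rewrite -[_ *+ _]mulr_natl rmorph_nat; ring.
rewrite qE linear_sum /=.
have term t : (t < l)%N -> (k t *: 'X^(i + n * t))^`(l.-1) =
    (if t == t0 then k t0 * ((i + n * t0) ^_ l.-1)%:R else 0) *: 'X^(l * a.-1).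
  move=> tl; rewrite derivnZ derivnXn -scaler_nat.
  have := e_dvd t tl; have [->|tt0] := eqVneq t t0 => /esym dv.
    rewrite scalerA (_ : i + n * t0 - l.-1 = l * a.-1)%N //.
    by move: laE a0 l_gt0; clear; case: a => // a'; rewrite mulnS /=; lia.
  by rewrite (ffact_pchar_eq0 (negbT (esym dv))) !(scale0r, scaler0).
exists (if (t0 <= N)%N then k t0 * ((i + n * t0) ^_ l.-1)%:R else 0).
  case: leqP => [t0N|_]; last by rewrite eqxx.
  rewrite !mulf_neq0 ?signr_eq0 ?bin_pchar_neq0 ?ffact_pchar_neq0 //.
  by rewrite e_dvd // eqxx.
rewrite (eq_bigr _ (fun (t : 'I_N.+1) _ => term t (leq_trans (ltn_ord t) Nl))) -scaler_suml.
congr (_ *: _); case: leqP => [t0N|Nt0].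
  have t0N' : (t0 < N.+1)%N by [].
  by rewrite (bigD1 (Ordinal t0N')) //= eqxx big1 ?addr0 // => t /negPf; rewrite -val_eqE /= => ->.
by rewrite big1 // => t _; rewrite ltn_eqF // (leq_trans (ltn_ord t)).
Qed.

End PcharFfact.

(** * Dimensions of spaces of differentials *)

Section Dimension.
Context {K F : fieldType} {iota : {rmorphism K -> F}}.
Implicit Types (P : set (differential iota)).

Lemma has_dim_le P k k' : has_dim P k -> has_dim P k' -> (k <= k')%N.
Proof.
move=> [b [bfree bP]] [b' [_ bP']]; rewrite leqNgt; apply/negP => k'k.
have bA i : exists A : 'I_k' -> K, b i = \sum_(j < k') iota (A j) *: b' j.
  apply/bP'/bP; exists (fun j => (j == i)%:R).
  rewrite (bigD1 i) //= eqxx rmorph1 scale1r big1 ?addr0 // => j /negPf ->.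
  by rewrite rmorph0 scale0r.
have [A AE] := choice bA; pose MA : 'M[K]_(k, k') := \matrix_(i, j) A i j.
have : kermx MA != 0.
  rewrite kermx_eq0 /row_free neq_ltn; apply/orP; left.
  exact: leq_ltn_trans (rank_leq_col _) k'k.
rewrite -nz_row_eq0; set u := nz_row _ => u0.
have uA : u *m MA = 0 by apply/sub_kermxP/nz_row_sub.
have : \sum_(i < k) iota (u 0 i) *: b i = 0.
  under eq_bigr do rewrite AE scaler_sumr.
  rewrite exchange_big /= big1 // => j _.
  under eq_bigr do rewrite scalerA -rmorphM.
  rewrite -scaler_suml -rmorph_sum /=.
  have := congr1 (fun B : 'rV[K]_k' => B 0 j) uA; rewrite !mxE => uj.
  rewrite (eq_bigr (fun i => u 0 i * MA i j)) ?uj ?rmorph0 ?scale0r //.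
  by move=> i _; rewrite mxE.
move=> /bfree ui; case/eqP: u0; apply/rowP => i; rewrite mxE; exact: ui.
Qed.

Lemma dimK_eq P k : has_dim P k -> dimK P = k.
Proof.
move=> Pk; apply: xget_unique => // k' Pk'; apply/eqP.
by rewrite eqn_leq !(has_dim_le (P := P)).
Qed.

Lemma has_dim_basis (I : finType) (J : {pred I}) (e : I -> differential iota) P :
  (forall c : I -> K, \sum_x iota (c x) *: e x = 0 -> forall x, c x = 0) ->
  (forall w, P w <-> exists c : I -> K, w = \sum_(x in J) iota (c x) *: e x) ->
  has_dim P #|J|.
Proof.
move=> efree eP; exists (fun i => e (enum_val i)).
pose ext (c : 'I_#|J| -> K) x := \sum_(i | enum_val i == x) c i.
have extE c i : ext c (enum_val i) = c i.
  rewrite /ext (big_pred1 i) // => j; exact: (inj_eq enum_val_inj).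
have sumE c : \sum_(i < #|J|) iota (c i) *: e (enum_val i) =
    \sum_(x in J) iota (ext c x) *: e x.
  by rewrite [RHS]big_enum_val; apply: eq_bigr => i _; rewrite extE.
split=> [c c0 i|w].
  rewrite -extE; apply: (efree (ext c)); apply: etrans c0; rewrite sumE.
  rewrite [RHS]big_mkcond; apply: eq_bigr => x _; case: ifP => // xJ.
  rewrite /ext big_pred0 ?rmorph0 ?scale0r // => i'.
  by apply: contraFF xJ => /eqP <-; apply: enum_valP.
rewrite eP; split=> -[c ->]; last by exists (ext c); rewrite sumE.
by exists (fun i => c (enum_val i)); rewrite [LHS]big_enum_val.
Qed.

End Dimension.

Section MulIndex.
Context {q : nat}.
Implicit Types (i j : 'I_q) (l : nat).

(* i represents the residue class of i + 1 modulo q. *)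
Definition mul_index l i : 'I_q :=
  Ordinal (ltn_pmod (l * i.+1 + q.-1) (leq_ltn_trans (leq0n i) (ltn_ord i))).

Lemma mul_indexE l i : (mul_index l i).+1 = l * i.+1 %[mod q].
Proof.
have q0 : (0 < q)%N := leq_ltn_trans (leq0n i) (ltn_ord i).
by rewrite /= -addn1 modnDml -addnA addn1 (prednK q0) modnDr.
Qed.

Lemma eq_index i j : i.+1 = j.+1 %[mod q] -> i = j.
Proof.
move=> /eqP; rewrite -(addn1 i) -(addn1 j) eqn_modDr !modn_small ?ltn_ord // => /eqP ij.
exact: val_inj.
Qed.

Lemma mul_index_inj l : coprime l q -> injective (mul_index l).
Proof.
move=> cop i j ij; apply: eq_index; have := congr1 (fun k : 'I_q => k.+1 %% q)%N ij.
rewrite !mul_indexE => /eqP E; apply/eqP.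
wlog le : i j E {ij} / (i <= j)%N => [H|].
  by have [le|/ltnW le] := leqP i j; [apply: H|rewrite eq_sym; apply: H; rewrite // eq_sym].
move: E; rewrite eq_sym eqn_mod_dvd ?leq_mul // -mulnBr Gauss_dvdr 1?coprime_sym //.
by rewrite -eqn_mod_dvd // eq_sym.
Qed.

(** The class of 0 is represented by q, which the hypothesis excludes, so the representative is the
    actual remainder. *)
Lemma mul_index_lift l i : ((mul_index l i).+1 < q)%N ->
  (l * i.+1 = q * ((l * i.+1) %/ q) + (mul_index l i).+1)%N.
Proof.
move=> lt; rewrite {1}(divn_eq (l * i.+1) q) mulnC; congr (_ + _)%N.
by rewrite -mul_indexE modn_small.
Qed.

Lemma mul_index_mod l l' i : l = l' %[mod q] -> mul_index l i = mul_index l' i.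
Proof. by move=> ll'; apply: eq_index; rewrite !mul_indexE -modnMml ll' modnMml. Qed.

Lemma mul_indexK l l' : (l * l')%N = 1%N %[mod q] ->
  cancel (mul_index l) (mul_index l').
Proof.
move=> ll' i; apply: eq_index; rewrite mul_indexE -modnMmr mul_indexE modnMmr.
by rewrite mulnA (mulnC l') -modnMml ll' modnMml mul1n.
Qed.

End MulIndex.

(** The exponents in V^j / V^(m-1) = (V^b / V^(m-1))^l (V^m)^(l-1-r), with denominators cleared. *)
Lemma residue_exponent l m b r j : (0 < m)%N -> (r < l)%N ->
  (l * b.+1 = m * r + j.+1)%N ->
  (j + m.-1 * l = b * l + m * (l.-1 - r) + m.-1)%N.
Proof.
case: m => // m _ rl; have [k ->] : exists k, l = (r + k).+1.
  by exists (l.-1 - r)%N; lia.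
by rewrite /= addKn; lia.
Qed.

(** l times the weight (a+1) m + (b+1) n equals n m (t + r) plus the weight of (i, j), which is
    below n m. So the weight of (a, b) is below n m iff t + r < l. *)
Lemma residue_index_iff n m l a b i j t r : (0 < n)%N -> (0 < m)%N ->
  (i.+1 * m + j.+1 * n < n * m)%N ->
  (l * a.+1 = n * t + i.+1)%N -> (l * b.+1 = m * r + j.+1)%N -> (r < l)%N ->
  (t <= l.-1 - r)%N = (a.+1 * m + b.+1 * n < n * m)%N.
Proof.
move=> n0 m0 ij aE bE rl; have l0 : (0 < l)%N by lia.
have -> : (t <= l.-1 - r)%N = (t + r < l)%N by lia.
rewrite -[RHS](ltn_pmul2l l0).
have -> : (l * (a.+1 * m + b.+1 * n) = n * m * (t + r) + (i.+1 * m + j.+1 * n))%N.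
  by rewrite mulnDr !mulnA aE bE; lia.
have X0 : (0 < n * m)%N by rewrite muln_gt0 n0.
move: X0 ij; move: (n * m)%N (_ + _)%N (t + r)%N => X e u; clear => X0 eX.
have [ul|lu] := ltnP u l.
  apply/esym; apply: leq_trans (leq_mul ul (leqnn X)); rewrite mulSn mulnC; lia.
by apply/esym/negbTE; rewrite -leqNgt; have := leq_mul lu (leqnn X); lia.
Qed.

(** * The Cartier operator on monomial forms *)

Section FermatCartier.
Context {K : closedFieldType} {F : fieldType} {iota : {rmorphism K -> F}}.
Context {n m l : nat} {U V : F}.
Hypotheses (n_neq0 : n%:R != 0 :> K) (m_neq0 : m%:R != 0 :> K).
Hypothesis charl : l \in [pchar K].
Hypothesis fermat : fermat_function_field iota n m U V.

Let M1 := affine_model n_neq0 m_neq0 fermat.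
Let n_gt0 : (0 < n)%N := charf_exp_gt0 n_neq0.
Let m_gt0 : (0 < m)%N := charf_exp_gt0 m_neq0.
Let V_neq0 : V != 0 := se_S_neq0 M1.
Let l_gt0 : (0 < l)%N := prime_gt0 (pcharf_prime charl).
Local Notation D := (se_der M1).
Local Notation omega := (@fermat_omega K F iota m U V).
Local Notation idx := ('I_n * 'I_m)%type.
Local Notation mono := (@fermat_mono F n m U V).

Definition fermat_reg (x : 'I_n * 'I_m) : bool := @fermat_index n m x.1 x.2.
Definition residue_mul (x : 'I_n * 'I_m) : 'I_n * 'I_m :=
  (mul_index l x.1, mul_index l x.2).
Local Notation mu := residue_mul.

Let coprime_l q : q%:R != 0 :> K -> coprime l q.
Proof. by move=> q0; rewrite prime_coprime ?(pcharf_prime charl) // (dvdn_pcharf charl). Qed.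

Lemma residue_mul_inj : injective mu.
Proof.
move=> [i j] [i' j'] xy.
have e1 : mul_index l i = mul_index l i' := congr1 fst xy.
have e2 : mul_index l j = mul_index l j' := congr1 snd xy.
by rewrite (mul_index_inj (coprime_l n_neq0) e1) (mul_index_inj (coprime_l m_neq0) e2).
Qed.

Lemma iter_der_eval1 k q : iter k D (eval1 iota U q) = eval1 iota U q^`(k).
Proof.
elim: k => [//|k IHk]; rewrite iterS IHk derivnS.
by have := derivation_eval1 (se_derP M1) U q^`(k); rewrite scale_regE se_derZ mulr1.
Qed.

(** [residue_exponent] splits off an l-th power and leaves a power of V^m = -(U^n + 1), a polynomial
    in U. The exponent is N = l-1-r, with r the quotient of l (j+1) by m and j the second component
    of y. *)
Lemma fermat_mono_pth (y : idx) : fermat_reg (mu y) ->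
  exists N, [/\ (N < l)%N,
    mono (mu y) / V ^+ m.-1 = (V ^+ y.2 / V ^+ m.-1) ^+ l *
      eval1 iota U ((- ('X^n + 1)) ^+ N * 'X^((mu y).1))
    & ((l * y.1.+1) %/ n <= N)%N = fermat_reg y].
Proof.
move=> Sy; have [lt1 lt2] : ((mu y).1.+1 < n)%N /\ ((mu y).2.+1 < m)%N.
  move: Sy; rewrite /fermat_reg /fermat_index; move: n_gt0 m_gt0; clear.
  by move: (nat_of_ord (mu y).1) (nat_of_ord (mu y).2) => i j; split; nia.
have laE := mul_index_lift lt1; have lbE := mul_index_lift lt2.
have rl : ((l * y.2.+1) %/ m < l)%N.
  have := ltn_ord y.2; move: lbE; move: ((l * y.2.+1) %/ m)%N m_gt0; clear; nia.
exists (l.-1 - (l * y.2.+1) %/ m)%N; split.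
- by apply: leq_ltn_trans (leq_subr _ _) _; rewrite ltn_predL.
- have Vm : V ^+ m = eval1 iota U (- ('X^n + 1)) := se_eqn M1.
  rewrite rmorphM !rmorphXn /= eval1X -Vm /fermat_mono expr_div_n -!exprM.
  suff key : V ^+ (mu y).2 / V ^+ m.-1 = V ^+ (y.2 * l) / V ^+ (m.-1 * l) *
      V ^+ (m * (l.-1 - (l * y.2.+1) %/ m)) by rewrite -mulrA key; ring.
  rewrite mulrAC; apply/eqP; rewrite eqr_div ?expf_neq0 // -!exprD; apply/eqP.
  congr (_ ^+ _).
  exact: residue_exponent.
- exact: residue_index_iff n_gt0 m_gt0 Sy laE lbE rl.
Qed.

Lemma iter_der_mono (y : idx) : fermat_reg (mu y) ->
  exists2 gamma : K, (gamma != 0) = fermat_reg y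
  & iter l.-1 D (mono (mu y) / V ^+ m.-1) = iota gamma * (mono y / V ^+ m.-1) ^+ l.
Proof.
move=> Sy; have [N [Nl monoE NE]] := fermat_mono_pth Sy.
have lt1 : ((mu y).1.+1 < n)%N.
  move: Sy; rewrite /fermat_reg /fermat_index; move: m_gt0; clear.
  move: (nat_of_ord (mu y).1) (nat_of_ord (mu y).2) => i j; nia.
have laE := mul_index_lift lt1.
have t0l : ((l * y.1.+1) %/ n < l)%N.
  have := ltn_ord y.1; move: laE; move: ((l * y.1.+1) %/ n)%N n_gt0; clear; nia.
have [gamma gE dE] := derivn_pred_affine_pow charl n_neq0 (ltn0Sn y.1) laE t0l Nl.
exists gamma; first by rewrite gE.
have dl x : D (x ^+ l) = 0.
  by rewrite (derX (se_derP M1)) (pcharf0 (pchar_ext (iota := iota) charl)) !mul0r.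
rewrite monoE (iter_der_constM (se_derP M1) _ _ (dl _)) iter_der_eval1 dE.
rewrite eval1Z rmorphXn /= eval1X /fermat_mono mulnC exprM.
rewrite !exprMn; ring.
Qed.

(** The Cartier operator divides indices by l. Indexing by the target y, so that the monomial itself
    has index [mu y], avoids naming the inverse of [mu]. *)
Definition fermat_form (y : idx) : differential iota := mono (mu y) *: omega.

Lemma fermat_form_free (c : idx -> K) :
  \sum_y iota (c y) *: fermat_form y = 0 -> forall y, c y = 0.
Proof.
move=> c0 y; have inj := residue_mul_inj.
have := @mono_indep K F iota n m U V n_neq0 m_neq0 fermat (fun x => c (invF inj x)) _ (mu y).
rewrite invF_f; apply; apply: (omega_scale_inj n_neq0 m_neq0 fermat).
rewrite scale0r -[RHS]c0 scaler_suml (reindex_inj inj); apply: eq_bigr => x _ /=.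
by rewrite invF_f -scalerA.
Qed.

Lemma holomorphic_fermat_form (w : differential iota) : holomorphic w <->
  exists c : idx -> K, w = \sum_(y | fermat_reg (mu y)) iota (c y) *: fermat_form y.
Proof.
have inj := residue_mul_inj.
rewrite (holomorphic_fermat n_neq0 m_neq0 fermat).
split=> -[c ->].
  exists (fun y => c (mu y)); rewrite scaler_suml (reindex_inj inj).
  by apply: eq_bigr => y _ /=; rewrite -scalerA.
exists (fun x => c (invF inj x)); rewrite scaler_suml [RHS](reindex_inj inj).
by apply: eq_bigr => y _ /=; rewrite invF_f -scalerA.
Qed.

(** D^(l-1) sends each term to a constant times the l-th power of the monomial of index y, the
    constant being nonzero iff y is regular. Distinct targets do not interfere. *)
Lemma cartier_fermat_form (c : idx -> K) :
  cartier l (\sum_(y | fermat_reg (mu y)) iota (c y) *: fermat_form y) = 0 <->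
  forall y, fermat_reg (mu y) -> fermat_reg y -> c y = 0.
Proof.
set h := \sum_(y | fermat_reg (mu y)) iota (c y) * (mono (mu y) / V ^+ m.-1).
have -> : \sum_(y | fermat_reg (mu y)) iota (c y) *: fermat_form y = h *: diff iota U.
  rewrite scaler_suml; apply: eq_bigr => y _.
  by rewrite /fermat_form /fermat_omega !scalerA mulrA.
have exg (y : idx) : exists g : K, fermat_reg (mu y) -> (g != 0) = fermat_reg y /\
    iter l.-1 D (mono (mu y) / V ^+ m.-1) = iota g * (mono y / V ^+ m.-1) ^+ l.
  have [Sy|nS] := boolP (fermat_reg (mu y)); last by exists 0.
  by have [g g1 g2] := iter_der_mono Sy; exists g.
have [g gP] := choice exg.
have hexp : exists x : nat -> F, h = \sum_(i < l) x i ^+ l * U ^+ i.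
  have ex y : exists Yq : F * {poly K}, fermat_reg (mu y) ->
      iota (c y) * (mono (mu y) / V ^+ m.-1) = Yq.1 ^+ l * eval1 iota U Yq.2.
    have [Sy|nS] := boolP (fermat_reg (mu y)); last by exists (0, 0).
    have [N [_ monoE _]] := fermat_mono_pth Sy; 
    exists (V ^+ y.2 / V ^+ m.-1,
      c y *: ((- ('X^n + 1)) ^+ N * 'X^((mu y).1))) => _ /=.
    by rewrite monoE eval1Z; rewrite mulrCA.
  have [Yq YqE] := choice ex.
  have [x xE] := pth_expansion (iota := iota) (Z := U) charl
    (fun y => (Yq y).1) (fun y => if fermat_reg (mu y) then (Yq y).2 else 0).
  exists x; rewrite -xE /h big_mkcond; apply: eq_bigr => y _.
  by case: ifP => [/YqE //|_]; rewrite rmorph0 mulr0.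
rewrite (cartier_eq0_iter M1 charl hexp) (iter_der_sum (se_derP M1)).
have -> : \sum_(y | fermat_reg (mu y)) iter l.-1 D (iota (c y) * (mono (mu y) / V ^+ m.-1))
    = \sum_(y | fermat_reg (mu y)) iota (c y * g y) * (mono y / V ^+ m.-1) ^+ l.
  apply: eq_bigr => y Sy; rewrite (iter_der_constM (se_derP M1)) ?(derC (se_derP M1)) //.
  by rewrite (gP y Sy).2 rmorphM mulrA.
split=> [sum0 y Sy Ry|c0]; last first.
  apply: big1 => y Sy; have [Ry|nR] := boolP (fermat_reg y).
    by rewrite c0 // mul0r rmorph0 mul0r.
  by have := (gP y Sy).1; rewrite (negPf nR) => /negbFE/eqP ->; rewrite mulr0 rmorph0 mul0r.
(* With l-th roots of the constants the sum is the l-th power of a linear combination of monomials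
   over V^(m-1), so [mono_indep] applies. *)
have exr x : exists d, c x * g x = d ^+ l by apply: (closed_pth_root charl).
have [r rE] := choice exr.
have : c y * g y = 0.
  rewrite rE; pose r' x := if fermat_reg (mu x) then r x else 0.
  suff -> : r y = r' y.
    rewrite (@mono_indep K F iota n m U V n_neq0 m_neq0 fermat r') ?expr0n ?gtn_eqF //.
    have : (\sum_(y | fermat_reg (mu y)) iota (r y) * (mono y / V ^+ m.-1)) ^+ l = 0.
      rewrite (pchar_expr_sum (pchar_ext (iota := iota) charl)).
      apply: etrans sum0; apply: eq_bigr => x _.
      by rewrite rE rmorphXn -exprMn.
    move=> /eqP; rewrite expf_eq0 l_gt0 /= => /eqP s0.
    apply: (mulIf (_ : (V ^+ m.-1)^-1 != 0)); first by rewrite invr_eq0 expf_neq0.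
    rewrite mul0r -[RHS]s0 mulr_suml [RHS]big_mkcond; apply: eq_bigr => x _.
    by rewrite /r'; case: ifP => _; rewrite ?rmorph0 ?mul0r // mulrA.
  by rewrite /r' Sy.
by move=> /eqP; rewrite mulf_eq0 => /orP[/eqP//|]; rewrite (negPf (_ : g y != 0)) // (gP y Sy).1.
Qed.

Lemma a_number_fermat :
  a_number iota l = #|[pred y : idx | fermat_reg (mu y) && ~~ fermat_reg y]|.
Proof.
apply: dimK_eq; apply: (has_dim_basis fermat_form_free) => w /=; split.
  move=> [/holomorphic_fermat_form[c ->]]; rewrite cartier_fermat_form => c0.
  exists c; rewrite [LHS]big_mkcond [RHS]big_mkcond; apply: eq_bigr => y _ /=.
  rewrite inE; case: ifP => //= Sy; case: ifP => // /negbFE Ry.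
  by rewrite c0 // rmorph0 scale0r.
move=> [c ->]; pose c' y := if fermat_reg y then 0 else c y.
have -> : \sum_(y in [pred y : idx | fermat_reg (mu y) && ~~ fermat_reg y])
    iota (c y) *: fermat_form y =
    \sum_(y | fermat_reg (mu y)) iota (c' y) *: fermat_form y.
  rewrite [LHS]big_mkcond [RHS]big_mkcond; apply: eq_bigr => y _ /=.
  rewrite inE /c'; case: ifP => [/andP[-> /negPf->] //|].
  by case: ifP => //= _ /negbFE ->; rewrite rmorph0 scale0r.
split; first by apply/holomorphic_fermat_form; exists c'.
by apply/cartier_fermat_form => y _ Ry; rewrite /c' Ry.
Qed.

End FermatCartier.

(** * Counting regular indices that become irregular *)

Section Counting.
Context {n m : nat}.

Definition fermat_count (l : nat) : nat :=
  #|[pred y : 'I_n * 'I_m | fermat_reg (@residue_mul n m l y) && ~~ fermat_reg y]|.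

Lemma fermat_count_mod l l' : l = l' %[mod n] -> l = l' %[mod m] ->
  fermat_count l = fermat_count l'.
Proof.
move=> ln lm; apply: eq_card => y; rewrite !inE /residue_mul.
by rewrite (mul_index_mod _ ln) (mul_index_mod _ lm).
Qed.

(* With S the set of regular indices and mu the permutation induced by l, both
   sides are #|S| minus the size of the intersection of S and mu^-1(S). *)
Lemma fermat_count_inv l l' : (l * l')%N = 1%N %[mod n] -> (l * l')%N = 1%N %[mod m] ->
  fermat_count l = fermat_count l'.
Proof.
move=> ln lm; pose S : pred ('I_n * 'I_m) := @fermat_reg n m.
have muK : cancel (@residue_mul n m l) (@residue_mul n m l').
  by move=> [i j]; rewrite /residue_mul /= (mul_indexK ln) (mul_indexK lm).
have inj := can_inj muK.
have cl : (fermat_count l + #|[pred y | S (@residue_mul n m l y) && S y]| = #|S|)%N.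
  rewrite -[RHS]sum1_card (reindex_inj inj) /= sum1_card.
  rewrite -(cardID S) addnC; congr (_ + _)%N; apply: eq_card => y;
    by rewrite !inE /= andbC.
have cl' : (fermat_count l' + #|[pred y | S (@residue_mul n m l y) && S y]| = #|S|)%N.
  rewrite -[RHS](cardID [pred y | S (@residue_mul n m l y)]) addnC; congr (_ + _)%N.
    by apply: eq_card => y; rewrite !inE /= andbC.
  (* The substitution of [mu y] turns the count for l' into that of the regular y with [mu y]
     irregular. *)
  rewrite /fermat_count -sum1_card (reindex_inj inj) /= sum1_card.
  by apply: eq_card => y; rewrite !inE [LHS]unfold_in /= muK andbC.
by apply/eqP; rewrite -(eqn_add2r #|[pred y | S (@residue_mul n m l y) && S y]|) cl cl'.
Qed.

End Counting.

Lemma eq_mod_dvd d M x y : (d %| M)%N -> x = y %[mod M] -> x = y %[mod d].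
Proof. by move=> dM xy; rewrite -(modn_dvdm x dM) xy modn_dvdm. Qed.

Theorem corollary4p13 (n m p pbar ptilde pinv : nat)
    (K Kbar Ktilde : closedFieldType) (F Fbar Ftilde : fieldType)
    (iota : {rmorphism K -> F})
    (iotabar : {rmorphism Kbar -> Fbar})
    (iotatilde : {rmorphism Ktilde -> Ftilde})
    (U V : F) (Ubar Vbar : Fbar) (Utilde Vtilde : Ftilde) :
  (0 < n)%N -> (0 < m)%N ->
  prime p -> prime pbar -> prime ptilde ->
  coprime p (lcmn n m) ->
  pbar = p %[mod lcmn n m] ->
  (p * pinv)%N = 1%N %[mod lcmn n m] ->
  ptilde = pinv %[mod lcmn n m] ->
  ~~ (p %| n * m)%N -> ~~ (pbar %| n * m)%N -> ~~ (ptilde %| n * m)%N ->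
  p \in [pchar K]%R -> pbar \in [pchar Kbar]%R -> ptilde \in [pchar Ktilde]%R ->
  fermat_function_field iota n m U V ->
  fermat_function_field iotabar n m Ubar Vbar ->
  fermat_function_field iotatilde n m Utilde Vtilde ->
  a_number iota p = a_number iotabar pbar /\
  a_number iotabar pbar = a_number iotatilde ptilde.
Proof.
move=> _ _ _ _ _ _ pbarE pinvE ptildeE pnm pbarnm ptildenm chp chpbar chptilde.
move=> ff ffbar fftilde.
have aE (k : closedFieldType) (E : fieldType) (j : {rmorphism k -> E}) u v l :
    l \in [pchar k] -> ~~ (l %| n * m)%N -> fermat_function_field j n m u v ->
    a_number j l = @fermat_count n m l.
  move=> chl lnm ffj; apply: (a_number_fermat _ _ chl ffj).
    by rewrite -(dvdn_pcharf chl); apply: contra lnm => ln; rewrite dvdn_mulr.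
  by rewrite -(dvdn_pcharf chl); apply: contra lnm => lm; rewrite dvdn_mull.
have nM := dvdn_lcml n m; have mM := dvdn_lcmr n m.
have pp : (p * ptilde)%N = 1%N %[mod lcmn n m] by rewrite -modnMmr ptildeE modnMmr.
have pbE : @fermat_count n m p = @fermat_count n m pbar.
  by apply/esym/fermat_count_mod; [apply: eq_mod_dvd nM _|apply: eq_mod_dvd mM _].
have ptE : @fermat_count n m p = @fermat_count n m ptilde.
  by apply: fermat_count_inv; [apply: eq_mod_dvd nM _|apply: eq_mod_dvd mM _].
by rewrite (aE _ _ _ _ _ _ chp pnm ff) (aE _ _ _ _ _ _ chpbar pbarnm ffbar)
  (aE _ _ _ _ _ _ chptilde ptildenm fftilde) -pbE.
Qed.
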